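(* Consider the system $$\partial_t u = \partial_x^2 u + \mu u - u^3 + \varepsilon\lambda + \mathcal R(u,\mu,\varepsilon),\qquad \dot\mu = \varepsilon,$$ with $x\in\mathbb R$, $t>0$, $u=u(x,t)\in\mathbb R$, $\mu=\mu(t)\in\mathbb R$, $\mathcal R(u,\mu,\varepsilon)=\mathcal O(u^4,u^2\mu,u\mu^2,u\varepsilon,\mu\varepsilon,\varepsilon^2)$, and a constant $\lambda\ne0$. There exist $\varepsilon_0>0$, $\chi>0$, $\rho>0$ and $\gamma>0$ such that for all $\varepsilon\in(0,\varepsilon_0)$, solutions with initial conditions in $$\Delta^{\mathrm{in}}=\{(u,-\rho):\ \|u(\cdot,0)\|_{\widetilde{\mathcal Z}}\le\chi\}$$ (i.e. $\mu(0)=-\rho$ and $\|u(\cdot,0)\|_{\widetilde{\mathcal Z}}\le\chi$) satisfy, at time $T=2\rho/\varepsilon$ (so that $\mu(T)=\rho$), one of the following assertions: (i) If $\lambda>0$, then $u(x,T)=\phi_+(\rho,\varepsilon)+\mathcal O\big(e^{-\gamma\rho^2/(2\varepsilon)}\big)$ as $\varepsilon\to0$, where $\phi_+$ is the function which defines the (spatially homogeneous) slow manifold $\mathcal S_a^+$. (ii) If $\lambda<0$, then $u(x,T)=\phi_-(\rho,\varepsilon)+\mathcal O\big(e^{-\gamma\rho^2/(2\varepsilon)}\big)$ as $\varepsilon\to0$, where $\phi_-$ is the function which defines the (spatially homogeneous) slow manifold $\mathcal S_a^-$. The $\mathcal O$-terms in (i) and (ii) are understood in the $\widetilde{\mathcal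 Z}$ norm.
   Context: Spaces: $\mathcal C^k_{\mathrm{b,unif}}(\mathbb R)$ is the Banach space of $k$-times differentiable, bounded and uniformly continuous functions on $\mathbb R$ with norm $\sum_{i=0}^k\|v^{(i)}\|_\infty$ ($\|\cdot\|_\infty$ the supremum norm). $\widetilde{\mathcal Z}=\{v\in\mathcal C^2_{\mathrm{b,unif}}(\mathbb R):\|v\|_{\widetilde{\mathcal Z}}<\infty\}$ with $\|v\|_{\widetilde{\mathcal Z}}=\|v\|_\infty+\|(1+|\cdot|)v'\|_\infty+\|(1+(\cdot)^2)v''\|_\infty$. $\mathcal O(g_1,\dots,g_m)$ for a remainder function means bounded near the origin by a constant times $|g_1|+\dots+|g_m|$. The function $\mathcal R$ is a sufficiently smooth real-valued function of $(u,\mu,\varepsilon)$ near the origin. Slow manifolds: spatially homogeneous solutions $(u,\mu)=(\varphi,\mu)(t)$ solve the planar slow-fast ODE system $\dot\varphi=\mu\varphi-\varphi^3+\varepsilon\lambda+\mathcal R(\varphi,\mu,\varepsilon)$, $\dot\mu=\varepsilon$. Let $\mathcal I_+\subset(0,\mu_0)$ be a compact interval with $\mu_0>0$ small. By Fenichel theory, for all sufficiently small $\varepsilon>0$ this ODE system has two attracting slow manifolds $\mathcal S_a^\pm=\{(\phi_\pm(\mu,\varepsilon),\mu):\mu\in\mathcal I_+\}$, where $\phi_\pm$ are $\mathcal C^k$-smooth with $\phi_\pm(\mu,\varepsilon)=\pm\sqrt\mu+\mathcal O(\mu,\varepsilon)$. *)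

(* Defs.v *)
From HB Require Import structures.
From mathcomp Require Import all_boot all_order all_algebra.
From mathcomp Require Import all_classical all_reals all_analysis.
Import Order.TTheory GRing.Theory Num.Theory.
Import numFieldNormedType.Exports.
Set Implicit Arguments.
Unset Strict Implicit.
Unset Printing Implicit Defensive.
Local Open Scope classical_set_scope.
Local Open Scope ring_scope.

(* The norms below take values in \bar R, so that they are meaningful (possibly
   +oo) for every function. *)
Definition supnorm (R : realType) (v : R -> R) : \bar R :=
  ereal_sup (range (fun x => (`|v x|)%:E)).

(* C^k_{b,unif}(R): all derivatives of order at most k exist, are bounded and
   uniformly continuous. *)
Definition Cbunif (R : realType) (k : nat) (v : R -> R) : Prop :=
  (forall (i : nat) (x : R), (i < k)%N -> derivable (derive1n i v) x 1) /\
  (forall i : nat, (i <= k)%N ->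
     (supnorm (derive1n i v) < +oo)%E /\ unif_continuous (derive1n i v)).

Definition Znorm (R : realType) (v : R -> R) : \bar R :=
  (supnorm v + supnorm (fun x => (1 + `|x|) * derive1 v x)%R
   + supnorm (fun x => (1 + x ^+ 2) * derive1n 2 v x)%R)%E.

Definition Ztilde (R : realType) (v : R -> R) : Prop :=
  Cbunif 2 v /\ (Znorm v < +oo)%E.

(* Class C^k on an open subset U of a finite-dimensional space V, through
   iterated directional derivatives. *)
Fixpoint Ck (R : realType) (V : normedModType R) (k : nat) (U : set V)
    (f : V -> R) : Prop :=
  (forall p, U p -> {for p, continuous f}) /\
  match k with
  | 0%N => True
  | k'.+1 => forall v : V,
      (forall p, U p -> derivable f p v) /\ Ck k' U (fun p => 'D_v f p)
  end.

(* Class C^k on a subset A that need not be open: existence of a C^k extension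
   to an open neighbourhood of A. *)
Definition Ck_on (R : realType) (V : normedModType R) (k : nat) (A : set V)
    (f : V -> R) : Prop :=
  exists (U : set V) (g : V -> R),
    [/\ open U, A `<=` U, Ck k U g & forall p, A p -> g p = f p].

(* The remainder is a total function of (u, mu, eps) about which nothing is
   assumed away from the origin. *)
Definition smooth_near0 (R : realType) (N : nat) (rem : R -> R -> R -> R) : Prop :=
  exists U : set (R * R * R)%type,
    open_nbhs (0, 0, 0) U /\ Ck N U (fun p => rem p.1.1 p.1.2 p.2).

(* rem = O(u^4, u^2 mu, u mu^2, u eps, mu eps, eps^2) *)
Definition remainder_order (R : realType) (rem : R -> R -> R -> R) : Prop :=
  exists C d : R, 0 < d /\
    forall u mu eps : R, `|u| < d -> `|mu| < d -> `|eps| < d ->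
      `|rem u mu eps| <=
        C * (`|u ^+ 4| + `|u ^+ 2 * mu| + `|u * mu ^+ 2|
             + `|u * eps| + `|mu * eps| + `|eps ^+ 2|).

Definition reaction (R : realType) (rem : R -> R -> R -> R) (lam u mu eps : R) : R :=
  mu * u - u ^+ 3 + eps * lam + rem u mu eps.

Definition ode_solution (R : realType) (rem : R -> R -> R -> R) (lam eps : R)
    (J : set R) (p m : R -> R) : Prop :=
  forall t : R, J t ->
    is_derive t 1 p (reaction rem lam (p t) (m t) eps) /\ is_derive t 1 m eps.

(* {(phi mu eps, mu) : a <= mu <= b}, 0 < eps < e1, is a family of attracting
   slow manifolds with phi = s * sqrt mu + O(mu, eps), s = 1 or s = -1.
   - Since mu' = eps, the manifold is (locally) invariant when it is the orbit
     t |-> (phi (eps * t) eps, eps * t); the system is autonomous, so fixing the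
     origin of time is no restriction.
   - Attracting: the linearization in the fast direction is negative.
   - The constant C of the O-term is a parameter: on a fixed interval [a, b]
     with 0 < a, an O(mu, eps) bound with a constant depending on a would not
     distinguish the branches s = 1 and s = -1. *)
Record slow_manifold (R : realType) (rem : R -> R -> R -> R) (lam : R) (k : nat)
    (s C a b e1 : R) (phi : R -> R -> R) : Prop := {
  sm_smooth :
    Ck_on k [set p : (R * R)%type | a <= p.1 <= b /\ 0 < p.2 < e1]
      (fun p => phi p.1 p.2);
  sm_invariant : forall eps : R, 0 < eps < e1 ->
    ode_solution rem lam eps [set t | a < eps * t < b]
      (fun t => phi (eps * t) eps) (fun t => eps * t);
  sm_attracting : forall mu eps : R, a <= mu <= b -> 0 < eps < e1 ->
    derive1 (fun p : R => reaction rem lam p mu eps) (phi mu eps) < 0;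
  sm_expansion : forall mu eps : R, a <= mu <= b -> 0 < eps < e1 ->
    `|phi mu eps - s * Num.sqrt mu| <= C * (`|mu| + `|eps|)
}.

(* Solutions of the PDE-ODE system on the time interval [0, T], with u t x the
   value at time t and position x: t |-> u t takes values in Ztilde, is
   continuous into C^0_{b,unif} up to t = 0 and t = T, and satisfies the
   equation classically for 0 < t < T.  Continuity in the norm of Ztilde is not
   required: the heat semigroup is not strongly continuous on Ztilde at t = 0. *)
Record pde_solution (R : realType) (rem : R -> R -> R -> R) (lam eps T : R)
    (u : R -> R -> R) (m : R -> R) : Prop := {
  pde_space : forall t : R, 0 <= t <= T -> Ztilde (u t);
  pde_continuous : forall t : R, 0 <= t <= T -> forall e : R, 0 < e ->
    exists2 d : R, 0 < d & forall s : R, 0 <= s <= T -> `|s - t| < d ->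
      (supnorm (fun x => u s x - u t x)%R < e%:E)%E;
  pde_equation : forall t x : R, 0 < t < T ->
    is_derive t 1 (fun s => u s x)
      (derive1n 2 (u t) x + reaction rem lam (u t x) (m t) eps);
  pde_mu_continuous : {within `[0, T], continuous m};
  pde_mu : forall t : R, 0 < t < T -> is_derive t 1 m eps
}.

(* Main.v *)
(* The solution operator is never used: everything rests on the parabolic
   maximum principle on the line and on an explicit difference scheme.

   Existence: the scheme
     u_(n+1) (x) = the mean of (u_n + h f(nh, u_n)) at x + l and x - l, l^2 = 2h,
   preserves a box |u| <= d and keeps u_x, u_xx bounded and equicontinuous, so an
   ultralimit as h -> 0 is a classical solution.

   Attraction for lam > 0 (the other sign follows by u -> -u): the forcing
   eps lam lifts u to 0 by the time mu = 0, and a subsolution that is piecewise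
   linear in mu then gives u >= sqrt (mu / 2) for mu >= rho / 4.  Hence the slope
   of the reaction, about mu - 3 u^2, is at most mu up to mu = rho / 4 and negative
   afterwards, so that its integral over the passage is at most - rho^2 / (100 eps)
   up to a constant.  Linearising by first and second difference quotients in x and
   comparing them with multiples of 1 / (1 + s^2 x^2) yields the decay of the
   weighted derivatives.  Finally, on [a, rho] both u and phi stay above
   sqrt (mu / 2), where the reaction contracts at the rate a / 5, so u - phi
   decays as well. *)
Require Import Defs.
From HB Require Import structures.
From mathcomp Require Import all_boot all_order all_algebra.
From mathcomp Require Import all_classical all_reals all_analysis.
From mathcomp Require Import ring lra.
Import Order.TTheory GRing.Theory Num.Theory.
Import numFieldNormedType.Exports.
Local Open Scope classical_set_scope.
Local Open Scope ring_scope.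

(** Solutions are only twice differentiable in x, so [u_x] and [u_xx] satisfy no equation that can
    be used pointwise. Differences with a step of length at most 1 do satisfy linear differential
    inequalities, to which the maximum principle applies, and the bounds pass to the limit as the
    step tends to 0. The source in the inequality for second differences is the square of a first
    difference; it is of size [e^(2E)], hence at most a constant times [e^E], and costs only a
    factor t, which is paid for with half of the available exponent. Between mu = 0 and mu = rho /
    4, where no good lower bound for u is at hand, differences may grow; the decay accumulated since
    mu = - rho outweighs this. The argument needs the slope of the reaction to be mu - 3 u^2 up to a
    small relative error. The remainder allows it because its third u-derivative vanishes at the
    origin, a consequence of its order, and because its first u-derivative is interpolated between
    the remainder and that third derivative. *)

Section Calculus.
Context {R : realType}.
Implicit Types (f g df dg ddf : R -> R) (a b c d e x y z M : R).

Lemma absE x : 0 <= x -> `|x| = x.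
Proof. exact: ger0_norm. Qed.
Lemma absNE x : x <= 0 -> `|x| = - x.
Proof. exact: ler0_norm. Qed.

(** Division by y - x is avoided, so the inequality can be proved for approximations with a uniform
    radius and then passed to the limit; this is how the limits of the scheme are differentiated. *)
Lemma is_deriveP f x d : is_derive x 1 f d <->
  (forall e, 0 < e -> exists2 r : R, 0 < r & forall y, `|y - x| < r ->
     `|f y - f x - d * (y - x)| <= e * `|y - x|).
Proof.
rewrite is_derive1_caratheodory; split.
- move=> [g [gE gc gx]] e e0.
  have /cvgrPdist_lt /(_ e e0) /nbhs_ballP [r /= r0 gr] := gc.
  exists r => // y yx.
  rewrite gE -mulrBl normrM ler_wpM2r // -gx distrC ltW //.
  by apply: gr; rewrite /ball /= distrC.
- move=> H.
  exists (fun z => if z == x then d else (f z - f x) / (z - x)); split.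
  + move=> z; case: eqP => [->|/eqP zx]; first by rewrite !subrr mulr0.
    by rewrite divfK // subr_eq0.
  + apply/cvgrPdist_le => e e0; have [r r0 Hr] := H e e0.
    apply/nbhs_ballP; exists r => //= y; rewrite /ball /= distrC => yx.
    rewrite eqxx; case: eqP => [_|/eqP nyx]; first by rewrite subrr normr0 ltW.
    have yx0 : y - x != 0 by rewrite subr_eq0.
    rewrite -(ler_pM2r (x := `|y - x|)) ?normr_gt0 // -normrM mulrBl divfK //.
    by rewrite distrC Hr.
  + by rewrite eqxx.
Qed.

Lemma derE {f x d d'} : is_derive x 1 f d -> d = d' -> is_derive x 1 f d'.
Proof. by move=> ? <-. Qed.
Lemma der_ext {f g x d} : f =1 g -> is_derive x 1 f d -> is_derive x 1 g d.
Proof. by move=> /funext ->. Qed.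
Lemma der_cst c x : is_derive x 1 (fun=> c) 0.
Proof. exact: is_derive_cst. Qed.
Lemma der_id x : is_derive x 1 (fun y => y) 1.
Proof. exact: is_derive_id. Qed.
Lemma derD {f g x a b} : is_derive x 1 f a -> is_derive x 1 g b ->
  is_derive x 1 (fun y => f y + g y) (a + b).
Proof. by move=> fa gb; exact: (is_deriveD fa gb). Qed.
Lemma derN {f x a} : is_derive x 1 f a -> is_derive x 1 (fun y => - f y) (- a).
Proof. by move=> fa; exact: (is_deriveN fa). Qed.
Lemma derB {f g x a b} : is_derive x 1 f a -> is_derive x 1 g b ->
  is_derive x 1 (fun y => f y - g y) (a - b).
Proof. by move=> fa gb; exact: (is_deriveB fa gb). Qed.
Lemma derM {f g x a b} : is_derive x 1 f a -> is_derive x 1 g b ->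
  is_derive x 1 (fun y => f y * g y) (a * g x + f x * b).
Proof.
move=> fa gb; apply: (derE (is_deriveM fa gb)).
by rewrite /GRing.scale /=; ring.
Qed.
Lemma derZ {f x a} c : is_derive x 1 f a -> is_derive x 1 (fun y => c * f y) (c * a).
Proof. by move=> fa; apply: (derE (derM (der_cst c x) fa)); rewrite mul0r add0r. Qed.
Lemma derX {f x a} n : is_derive x 1 f a ->
  is_derive x 1 (fun y => f y ^+ n) (n%:R * f x ^+ n.-1 * a).
Proof.
move=> fa; elim: n => [|n IH].
  by rewrite !mul0r; apply: der_ext (der_cst 1 x) => y; rewrite expr0.
have E : (fun y => f y ^+ n.+1) =1 (fun y => f y * f y ^+ n) by move=> y; rewrite exprS.
apply: (der_ext (fun y => esym (E y))).
apply: (derE (derM fa IH)) => /=.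
case: n {IH E} => [|n]; first by rewrite expr0 /=; ring.
by rewrite /= exprS -!natr1; ring.
Qed.
Lemma der_comp {f g x a b} : is_derive (g x) 1 f a -> is_derive x 1 g b ->
  is_derive x 1 (fun y => f (g y)) (a * b).
Proof. by move=> fa gb; exact: is_derive1_comp. Qed.
Lemma derV {f x a} : f x != 0 -> is_derive x 1 f a ->
  is_derive x 1 (fun y => (f y)^-1) (- a / f x ^+ 2).
Proof.
move=> f0 fa; apply: (derE (is_deriveV f0 fa)).
by rewrite /GRing.scale /= !mulNr mulrC.
Qed.
Lemma der_shift {f x a} c : is_derive (x + c) 1 f a -> is_derive x 1 (fun y => f (y + c)) a.
Proof.
move=> fa; apply: (derE (der_comp (g := fun y => y + c) (b := 1) fa _)); last by rewrite mulr1.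
by apply: (derE (derD (der_id x) (der_cst c x))); rewrite addr0.
Qed.
Lemma der_expR {f x a} : is_derive x 1 f a ->
  is_derive x 1 (fun y => expR (f y)) (a * expR (f x)).
Proof. by move=> fa; apply: (derE (der_comp (is_derive_expR _) fa)); rewrite mulrC. Qed.
Lemma der_cont {f x a} : is_derive x 1 f a -> {for x, continuous f}.
Proof.
by move=> [fd _]; apply: differentiable_continuous; apply/derivable1_diffP.
Qed.
Lemma der_uniq {f x a b} : is_derive x 1 f a -> is_derive x 1 f b -> a = b.
Proof. by move=> [_ <-] [_ <-]. Qed.

Lemma MVT_lt f df a b : a < b ->
  (forall x, a <= x <= b -> is_derive x 1 f (df x)) ->
  exists2 c, a < c < b & f b - f a = df c * (b - a).
Proof.
move=> ab fd; have [||c cab E] := MVT (f := f) (df := df) ab.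
- by move=> x; rewrite in_itv /= => /andP[/ltW ax /ltW xb]; apply: fd; rewrite ax xb.
- apply: continuous_in_subspaceT => z; rewrite inE /= in_itv /= => zxy.
  exact: der_cont (fd z zxy).
by exists c => //; move: cab; rewrite in_itv.
Qed.

(** The endpoints are unordered because they will often be values of the solution at two points. *)
Lemma MVT_btw f df a b :
  (forall x, Num.min a b <= x <= Num.max a b -> is_derive x 1 f (df x)) ->
  exists2 c, Num.min a b <= c <= Num.max a b & f b - f a = df c * (b - a).
Proof.
move=> fd; case: (ltgtP a b) fd => [ab|ba|->] fd.
- by have [c /andP[/ltW ac /ltW cb] E] := MVT_lt f df a b ab fd;
    exists c; rewrite ?ac.
- have [c /andP[/ltW ac /ltW cb] E] := MVT_lt f df b a ba fd.
  by exists c; rewrite ?ac // -opprB E -mulrN opprB.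
- by exists b; rewrite ?lexx // !subrr mulr0.
Qed.

Lemma btw_dist a b c : Num.min a b <= c <= Num.max a b -> `|c - a| <= `|b - a|.
Proof.
have [ab|/ltW ba] := leP a b => /andP[].
  by move=> ac cb; rewrite !ger0_norm ?subr_ge0 ?lerD2r // (le_trans ac).
by move=> bc ca; rewrite !ler0_norm ?subr_le0 // lerN2 lerD2r.
Qed.

Lemma der_lip f df M a b :
  (forall x, Num.min a b <= x <= Num.max a b -> is_derive x 1 f (df x)) ->
  (forall x, Num.min a b <= x <= Num.max a b -> `|df x| <= M) ->
  `|f b - f a| <= M * `|b - a|.
Proof.
move=> fd dfM; have [c cab ->] := MVT_btw _ _ _ _ fd.
by rewrite normrM ler_wpM2r // dfM.
Qed.

(** The second derivative exists at the minimum only. If [c < 0], the first derivative, which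
    vanishes at [x], is negative just to the right, and [f] drops below its minimum. *)
Lemma der2_min f df x c : (forall y, is_derive y 1 f (df y)) ->
  is_derive x 1 df c -> (exists2 r : R, 0 < r & forall y, `|y - x| < r -> f x <= f y) ->
  0 <= c.
Proof.
move=> fd dfc [r r0 fmin].
have dfx : df x = 0.
  apply: (der_uniq (fd x)).
  apply: (derive1_at_min (a := x - r) (b := x + r)).
  - by rewrite lerBlDr -addrA lerDl addr_ge0 // ltW.
  - by move=> t _; case: (fd t).
  - by rewrite in_itv /= ltrBlDr !ltrDl r0.
  - move=> t; rewrite in_itv /= => /andP[t1 t2]; apply: fmin.
    by rewrite ltr_norml; lra.
rewrite leNgt; apply/negP => c0.
have /is_deriveP /(_ (- c / 2)) [|s s0 Hs] := dfc; first lra.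
have [m [m0 mr ms]] : exists m : R, [/\ 0 < m, m <= r & m <= s].
  by exists (Num.min r s); rewrite lt_min r0 !ge_min !lexx orbT.
have xy : x < x + m / 2 by lra.
have [w /andP[xw wy] E] := MVT_lt f df x (x + m / 2) xy (fun z _ => fd z).
have dw : df w < 0.
  have ws : `|w - x| < s by (rewrite absE; lra).
  have := Hs w ws; rewrite dfx subr0 (absE (w - x)); last lra.
  by rewrite ler_norml => /andP[_]; nra.
have := fmin (x + m / 2); rewrite absE; last lra.
have -> : x + m / 2 - x < r by lra.
by move=> /(_ isT); nra.
Qed.

(* With c = 0 this bounds the second difference, with c = f'' x it says
   that the second difference approximates f''. *)
Lemma second_diff_le f df ddf x y c e :
  (forall z, is_derive z 1 f (df z)) -> (forall z, is_derive z 1 df (ddf z)) ->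
  (forall z, `|z - x| <= `|y| -> `|ddf z - c| <= e) ->
  `|f (x + y) - 2 * f x + f (x - y) - c * y ^+ 2| <= 2 * e * y ^+ 2.
Proof.
move=> fd dfd H.
wlog y0 : y H / 0 <= y => [WL|].
  have [|/ltW] := leP 0 y; first exact: WL.
  rewrite -oppr_ge0 => y0; have := WL (- y); rewrite normrN sqrrN opprK => /(_ H y0).
  by congr (`|_| <= _); ring.
rewrite (ger0_norm y0) in H.
have e0 : 0 <= e by apply: le_trans (H x _); rewrite ?subrr ?normr0.
(* The derivative of [k] is the increment of [df] over [x - s, x + s] less 2 c s, which the mean
   value theorem turns into 2 s (ddf w - c). One Lipschitz bound thus replaces integration. *)
pose k s := f (x + s) + f (x - s) - c * s ^+ 2.
pose dk s := df (x + s) - df (x - s) - 2 * c * s.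
have kd (s : R) : is_derive s 1 k (dk s).
  apply: (derE (derB (derD (der_comp (g := fun s => x + s) (fd _) (derD (der_cst x s) (der_id s)))
     (der_comp (g := fun s => x - s) (fd _) (derB (der_cst x s) (der_id s)))) (derZ c (derX 2 (der_id s))))).
  by rewrite /dk /= expr1; ring.
have -> : f (x + y) - 2 * f x + f (x - y) - c * y ^+ 2 = k y - k 0.
  by rewrite /k subr0 addr0; ring.
apply: (@le_trans _ _ (2 * e * y * `|y - 0|)); last by rewrite subr0 ger0_norm // -mulrA expr2.
apply: (der_lip _ dk _ _ _ (fun s _ => kd s)) => s.
rewrite (min_idPl y0) (max_idPr y0) => /andP[s0 sy].
have [w] := MVT_btw df ddf (x - s) (x + s) (fun z _ => dfd z).
have -> : Num.min (x - s) (x + s) = x - s by apply/min_idPl; lra.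
have -> : Num.max (x - s) (x + s) = x + s by apply/max_idPr; lra.
move=> /andP[w1 w2] E.
rewrite /dk E (_ : _ - _ = (ddf w - c) * (2 * s)); last by ring.
rewrite normrM (ger0_norm (_ : 0 <= 2 * s)); last by lra.
have : `|ddf w - c| <= e by apply: H; rewrite ler_norml; lra.
have := normr_ge0 (ddf w - c); nra.
Qed.

End Calculus.

(** * Parabolic maximum principle on the line *)

Section MaximumPrinciple.
Context {R : realType}.
Implicit Types (z : R -> R -> R) (t x : R).

(** Continuity relative to the closed strip: nothing is asked of [z] before [a] or after [b].
    [cont2P] identifies it with continuity on a subspace, which supplies sums and products. *)
Definition cont2 (a b : R) z := forall t x, a <= t <= b -> forall e, 0 < e ->
  exists2 d : R, 0 < d & forall s y, a <= s <= b -> `|s - t| < d -> `|y - x| < d ->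
     `|z s y - z t x| < e.

Lemma cont2P a b z : cont2 a b z <->
  {within `[a, b]%classic `*` [set: R], continuous (fun p : R * R => z p.1 p.2)}.
Proof.
split=> [zc|/subspace_continuousP zc].
  apply/subspace_continuousP => -[t x] [/=]; rewrite in_itv /= => tab _.
  apply/cvgrPdist_lt => e e0; have [d d0 Hd] := zc t x tab e e0.
  rewrite near_withinE; apply/nbhs_ballP; exists d => //= -[s y] [/= ts xy].
  move=> [/=]; rewrite in_itv /= => sab _; rewrite distrC.
  by apply: Hd => //; rewrite distrC.
move=> t x tab e e0; have /= := zc (t, x); rewrite in_itv /= => /(_ (conj tab Logic.I)).
move=> /cvgrPdist_lt /(_ e e0); rewrite near_withinE => /nbhs_ballP[d /= d0 Hd].
exists d => // s y sab st yx; have := Hd (s, y); rewrite /= /ball /= distrC; apply.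
  by split; rewrite /= /ball /= distrC.
by rewrite in_itv.
Qed.

Lemma cont2_cst a b c : cont2 a b (fun _ _ => c).
Proof. by move=> t x tab e e0; exists 1 => // s y _ _ _; rewrite subrr normr0. Qed.

Lemma cont2D a b z w : cont2 a b z -> cont2 a b w -> cont2 a b (fun t x => z t x + w t x).
Proof. by move=> /cont2P zc /cont2P wc; apply/cont2P => p; apply: cvgD; [exact: zc|exact: wc]. Qed.

Lemma cont2M a b z w : cont2 a b z -> cont2 a b w -> cont2 a b (fun t x => z t x * w t x).
Proof. by move=> /cont2P zc /cont2P wc; apply/cont2P => p; apply: cvgM; [exact: zc|exact: wc]. Qed.

Lemma cont2B a b z w : cont2 a b z -> cont2 a b w -> cont2 a b (fun t x => z t x - w t x).
Proof. by move=> /cont2P zc /cont2P wc; apply/cont2P => p; apply: cvgB; [exact: zc|exact: wc]. Qed.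

Lemma cont2_sub a b c d z : cont2 a b z -> a <= c -> d <= b -> cont2 c d z.
Proof.
move=> zc ac db t x /andP[ct td] e e0; have [|r r0 H] := zc t x _ e e0; first by lra.
by exists r => // s y /andP[cs sd]; apply: H; lra.
Qed.

Lemma cont2_shift a b c z : cont2 a b z -> cont2 a b (fun t x => z t (x + c)).
Proof.
move=> zc t x tab e e0; have [r r0 H] := zc t (x + c) tab e e0.
by exists r => // s y sab st yx; apply: H; rewrite // (_ : _ - _ = y - x) //; ring.
Qed.

Lemma cont2_time a b (k : R -> R) : {within `[a, b], continuous k} -> cont2 a b (fun t _ => k t).
Proof.
move=> /subspace_continuousP kc t x tab e e0.
have := kc t; rewrite /= in_itv /= => /(_ tab) /cvgrPdist_lt /(_ e e0).
rewrite near_withinE => /nbhs_ballP[d /= d0 Hd]; exists d => // s y sab st _.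
by rewrite distrC; apply: Hd; rewrite /ball /= ?in_itv // distrC.
Qed.

Lemma cont2_space a b (k : R -> R) : continuous k -> cont2 a b (fun _ x => k x).
Proof.
move=> kc t x tab e e0; have /cvgrPdist_lt /(_ e e0) := kc x.
move=> /nbhs_ballP[d /= d0 Hd]; exists d => // s y _ _ yx.
by rewrite distrC; apply: Hd; rewrite /ball /= distrC.
Qed.

Lemma cont2_min (a b L : R) z : a <= b -> 0 <= L -> cont2 a b z ->
  exists t x, [/\ a <= t <= b, - L <= x <= L &
    forall s y, a <= s <= b -> - L <= y <= L -> z t x <= z s y].
Proof.
move=> ab L0 zc.
pose A := `[a, b]%classic `*` `[- L, L]%classic : set (R * R).
have [||| [t x] txA H] := @compact_EVT_min _ R (fun p : R * R => z p.1 p.2) A.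
- by exists (a, 0); rewrite /A /=; split; rewrite /= in_itv /=; lra.
- by apply: compact_setX; exact: segment_compact.
- apply/subspace_continuousP => -[t x] [/=]; rewrite !in_itv /= => tab xL.
  apply/cvgrPdist_lt => e e0; have [d d0 Hd] := zc t x tab e e0.
  rewrite near_withinE; apply/nbhs_ballP; exists d => //= -[s y] [/= ts xy].
  move=> [/=]; rewrite !in_itv /= => sab yL; rewrite distrC.
  by apply: Hd => //; rewrite distrC.
exists t, x; move: txA; rewrite inE => -[/=]; rewrite !in_itv /= => tab xL.
split=> // s y sab yL; apply: (H (s, y)).
by rewrite inE; split; rewrite /= in_itv.
Qed.

Lemma cont2_le (a b t x c : R) z : cont2 a b z -> a < t -> t <= b ->
  (forall s, a <= s -> s < t -> c <= z s x) -> c <= z t x.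
Proof.
move=> zc at_ tb H; rewrite leNgt; apply/negP => ztc.
have tab : a <= t <= b by rewrite ltW.
have c0 : 0 < c - z t x by rewrite subr_gt0.
have [d d0 Hd] := zc t x tab _ c0.
have [m [m0 md mt]] : exists m : R, [/\ 0 < m, m <= d & m <= t - a].
  by exists (Num.min d (t - a)); rewrite lt_min d0 subr_gt0 !ge_min !lexx orbT.
have /H : a <= t - m / 2 by lra.
have -> : t - m / 2 < t by lra.
move=> /(_ isT) cz.
have tm : a <= t - m / 2 <= b by lra.
have tm' : `|t - m / 2 - t| < d by rewrite absNE; lra.
by have := Hd _ x tm tm'; rewrite subrr normr0 d0 => /(_ isT); rewrite ltr_norml; lra.
Qed.

(* Penalising z by r (1 + x^2) makes the minimum attained. *)
Lemma max_principle (a b K M : R) z : a <= b -> cont2 a b z ->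
  (forall t x, a <= t <= b -> - M <= z t x) ->
  (forall x, 0 <= z a x) ->
  (forall t x, a < t < b -> z t x < 0 -> exists (zt zxx : R) (zx : R -> R),
     [/\ is_derive t 1 (fun s => z s x) zt, forall y : R, is_derive y 1 (z t) (zx y),
         is_derive x 1 zx zxx & zxx + K * z t x <= zt]) ->
  forall t x, a <= t <= b -> 0 <= z t x.
Proof.
move=> ab zc zb z0 zeq.
(* The differential inequality holds at interior times only; the final time follows by
   continuity. *)
suff H t x : a <= t -> t < b -> 0 <= z t x.
  move=> t x /andP[at_ tb]; have [tb'|bt] := ltP t b; first exact: H.
  have := at_; rewrite le_eqVlt => /predU1P[<-//|at1].
  by apply: (cont2_le a b t x 0 z) => // s as_ st; apply: H => //; exact: lt_le_trans st tb.
move=> at_ tb; apply/ler_addgt0Pr => e e0.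
(* At a negative minimum of [q] one has [E z < - r]. The surplus 3 over [K] then yields a term below
   - 3 r, which the 2 r from the second derivative of the penalty cannot compensate. *)
pose k := K + 3.
pose E s := expR (- k * (s - a)).
have Ed (s : R) : is_derive s 1 E (- k * E s).
  apply: (derE (der_expR (derZ (- k) (derB (der_id s) (der_cst a s))))).
  by rewrite subr0 mulr1.
have E0 s : 0 < E s := expR_gt0 _.
(* With this [r], nonnegativity of [q] at (t, x) means exactly [z t x >= - e]. *)
pose r := e * E t / (1 + x ^+ 2).
have x1 : 0 < 1 + x ^+ 2 by rewrite ltr_pwDl // sqr_ge0.
have r0 : 0 < r by rewrite divr_gt0 // mulr_gt0.
pose q s y := E s * z s y + r * (1 + y ^+ 2).
suff q0 s y : a <= s <= t -> 0 <= q s y.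
  have := q0 t x; rewrite at_ lexx => /(_ isT); rewrite /q /r divfK ?gt_eqF //.
  by rewrite (mulrC e) -mulrDr pmulr_rge0.
have [N [N0 {}zb]] : exists N : R, 0 <= N /\ forall t x, a <= t <= b -> - N <= z t x.
  by exists `|M|; split=> // w v /(zb w v); apply: le_trans; rewrite lerN2 ler_norm.
have EB w : a <= w <= t -> E w <= expR (`|k| * (b - a)).
  move=> sat; rewrite /E ler_expR; apply: (@le_trans _ _ (`|k| * (w - a))).
    by apply: ler_wpM2r; [lra|rewrite -normrN ler_norm].
  by apply: ler_wpM2l => //; lra.
set EM := expR (`|k| * (b - a)) in EB.
have EM0 : 0 < EM := expR_gt0 _.
(* Beyond [L] the penalty exceeds the lower bound of the other term, so a negative minimum over the
   compact rectangle is interior in space; [L] also exceeds the absolute value of the point [y]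
   under test. *)
pose L := `|y| + 1 + EM * N / r.
have L1 : 1 + EM * N / r <= L by rewrite /L -addrA lerDr.
have EMM : 0 <= EM * N / r by apply: divr_ge0 (ltW r0); apply: mulr_ge0 N0; exact: ltW.
have far w v : a <= w <= t -> L <= `|v| -> 0 < q w v.
  move=> wt Lv; have H1 : - (EM * N) <= E w * z w v.
    have : - N <= z w v by apply: zb; lra.
    have := EB w wt; have := E0 w; nra.
  have H2 : EM * N < r * (1 + v ^+ 2).
    rewrite -(ltr_pdivrMl _ _ r0) [X in X < _]mulrC -(real_normK (num_real v)).
    have := le_trans L1 Lv; move: (`|v|) (EM * N / r) => V W.
    by have := sqr_ge0 (V - 1); have := sqr_ge0 V; nra.
  by rewrite /q; lra.
have qc : cont2 a t q.
  apply: cont2D; apply: cont2M.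
  - by apply: cont2_time; apply: continuous_subspaceT => w; exact: der_cont (Ed w).
  - by apply: (cont2_sub _ _ _ _ _ zc) => //; exact: ltW.
  - exact: cont2_cst.
  - apply: cont2_space => w.
    exact: (der_cont (derD (der_cst 1 w) (derX 2 (der_id w)))).
have L0 : 0 <= L by rewrite /L; have := normr_ge0 y; lra.
have [w [v [wt vL qmin]]] := cont2_min a t L q at_ L0 qc.
move=> sat; have yL : - L <= y <= L.
  by rewrite -ler_norml /L -addrA lerDl addr_ge0.
apply: (le_trans _ (qmin s y sat yL)); rewrite leNgt; apply/negP => qwv.
have aw : a < w.
  rewrite lt_neqAle; case/andP: (wt) => -> _; rewrite andbT; apply/eqP => aw.
  move: qwv; rewrite /q -aw /E subrr mulr0 expR0 mul1r; have := z0 v; have := sqr_ge0 v.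
  by have := r0; nra.
have vL' : `|v| < L by rewrite ltNge; apply/negP => /(far w v wt); rewrite ltNge (ltW qwv).
have awb : a < w < b by move: wt; lra.
have zneg : z w v < 0.
  have := E0 w; have : 0 <= r * (1 + v ^+ 2) by rewrite mulr_ge0 ?(ltW r0) // addr_ge0 // sqr_ge0.
  by move: qwv; rewrite /q; nra.
have [zt [zxx [zx [ztd zxd zxxd zle]]]] := zeq w v awb zneg.
have qxx : 0 <= E w * zxx + r * 2.
  apply: (der2_min (q w) (fun u => E w * zx u + r * (2 * u)) v).
  - move=> u; apply: (derE (derD (derZ (E w) (zxd u)) (derZ r (derD (der_cst 1 u) (derX 2 (der_id u)))))).
    by rewrite /= expr1; ring.
  - by apply: (derE (derD (derZ (E w) zxxd) (derZ r (derZ 2 (der_id v))))); ring.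
  - exists (L - `|v|); first by rewrite subr_gt0.
    move=> u uv; apply: qmin => //; rewrite -ler_norml.
    have := ler_normD (u - v) v; rewrite subrK; lra.
have qt : is_derive w 1 (fun s => q s v) (- k * E w * z w v + E w * zt).
  by apply: (derE (derD (derM (Ed w) ztd) (der_cst (r * (1 + v ^+ 2)) w))); rewrite addr0.
(* [w] may be the last time [t], so the minimum is compared with earlier times only; this gives a
   sign for the time derivative instead of its vanishing. *)
have qt0 : - k * E w * z w v + E w * zt <= 0.
  move: (- k * E w * z w v + E w * zt) qt => c qt; rewrite leNgt; apply/negP => c0.
  have /is_deriveP /(_ (c / 2)) [|d d0 Hd] := qt; first lra.
  have [m [m0 md mt]] : exists m : R, [/\ 0 < m, m <= d & m <= w - a].
    by exists (Num.min d (w - a)); rewrite lt_min d0 subr_gt0 !ge_min !lexx orbT.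
  have := Hd (w - m / 2); rewrite (_ : w - m / 2 - w = - (m / 2)); last by ring.
  rewrite normrN (absE (m / 2)); last lra.
  have -> : m / 2 < d by lra.
  move=> /(_ isT); rewrite ler_norml => /andP[_].
  have := qmin (w - m / 2) v; rewrite vL; have -> : a <= w - m / 2 <= t by move: wt; lra.
  move=> /(_ isT isT) /=; have := mulr_gt0 c0 m0; move: (q _ v) (q w v) => q1 q2.
  by nra.
have v0 := sqr_ge0 v.
have Ez : E w * z w v < - r.
  have := mulr_ge0 (ltW r0) v0; move: qwv; rewrite /q mulrDr mulr1.
  by move: (E w * z w v) (r * v ^+ 2) => A B; lra.
have : E w * zxx + K * (E w * z w v) <= E w * zt.
  by have := ler_wpM2l (ltW (E0 w)) zle; lra.
by move: qt0; rewrite /k; nra.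
Qed.

End MaximumPrinciple.

(** * Comparison with decaying weights *)

Section WeightedEstimates.
Context {R : realType}.
Implicit Types (t x y a b d : R) (q z : R -> R -> R).

Definition wgt d x : R := (1 + d ^+ 2 * x ^+ 2)^-1.

Lemma wgt_gt0 d x : 0 < wgt d x.
Proof. by rewrite invr_gt0 ltr_pwDl // mulr_ge0 // sqr_ge0. Qed.

Lemma wgt0 x : wgt 0 x = 1.
Proof. by rewrite /wgt expr0n /= mul0r addr0 invr1. Qed.

Lemma wgt_mul d x : wgt d x * (1 + d ^+ 2 * x ^+ 2) = 1.
Proof. by have := wgt_gt0 d x; rewrite /wgt invr_gt0 => h; rewrite mulVf // gt_eqF. Qed.

Lemma wgt_der d x : is_derive x 1 (wgt d) (- (2 * d ^+ 2 * x) * wgt d x ^+ 2).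
Proof.
have h : 1 + d ^+ 2 * x ^+ 2 != 0 by rewrite gt_eqF // ltr_pwDl // mulr_ge0 // sqr_ge0.
apply: (derE (derV (f := fun x => 1 + d ^+ 2 * x ^+ 2) h
  (derD (der_cst 1 x) (derZ (d ^+ 2) (derX 2 (der_id x)))))).
rewrite /wgt /= expr1 exprVn; move: (_ ^- 2) => i; ring.
Qed.

(** With g the weight and s = d^2, the second derivative is s g (6 g - 8 g^2), at most 6 s g. The
    weight is thus a supersolution of the heat equation up to the exponential rate 6 d^2, the price
    of localisation. *)
Lemma wgt_der2 d x : exists2 c, is_derive x 1 (fun x => - (2 * d ^+ 2 * x) * wgt d x ^+ 2) c
  & c <= 6 * d ^+ 2 * wgt d x.
Proof.
eexists; first exact: (derM (derN (derZ (2 * d ^+ 2) (der_id x))) (derX 2 (wgt_der d x))).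
have := wgt_mul d x; have := wgt_gt0 d x; set g := wgt d x; set s := d ^+ 2.
move=> g0 g1; rewrite /= expr1.
have s0 : 0 <= s by rewrite sqr_ge0.
have -> : - (2 * s * 1) * g ^+ 2 + - (2 * s * x) * (2%:R * g * (- (2 * s * x) * g ^+ 2))
   = s * g * (8 * (g * (s * x ^+ 2)) * g - 2 * g) by ring.
have -> : g * (s * x ^+ 2) = 1 - g by rewrite -[in RHS]g1; ring.
have -> : 6 * s * g = s * g * 6 by ring.
apply: ler_wpM2l; first by rewrite mulr_ge0 // ltW.
by nra.
Qed.

(** The bound in the conclusion is a supersolution: [E] pays for the growth [dE], the loss 6 d^2 in
    the hypothesis pays for the curvature of the weight, and the factor A + B (t - a) integrates the
    source. The inequality for [q] is asked only where [q > 0], since the comparison can fail only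
    there. For d = 0 the weight is 1. *)
Lemma weighted_growth (a b A B K M d : R) q (E dE : R -> R) :
  a <= b -> cont2 a b q -> (forall t x, a <= t <= b -> q t x <= M) ->
  E a = 0 -> (forall t : R, is_derive t 1 E (dE t)) ->
  (forall t, a < t < b -> dE t <= K) ->
  0 <= A -> 0 <= B -> (forall x, q a x <= A * wgt d x) ->
  (forall t x, a < t < b -> 0 < q t x -> exists (qt qxx : R) (qx : R -> R),
     [/\ is_derive t 1 (fun s => q s x) qt, forall y : R, is_derive y 1 (q t) (qx y),
         is_derive x 1 qx qxx &
         qt <= qxx + (dE t - 6 * d ^+ 2) * q t x + B * expR (E t) * wgt d x]) ->
  forall t x, a <= t <= b -> q t x <= (A + B * (t - a)) * expR (E t) * wgt d x.
Proof.
move=> ab qc qM Ea Ed EK A0 B0 q0 qeq t x tab.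
pose z t x := (A + B * (t - a)) * expR (E t) * wgt d x - q t x.
rewrite -subr_ge0 -/(z t x).
have AB s : a <= s <= b -> 0 <= A + B * (s - a).
  by move=> /andP[as_ _]; rewrite addr_ge0 // mulr_ge0 // subr_ge0.
have Psi s y : a <= s <= b -> 0 <= (A + B * (s - a)) * expR (E s) * wgt d y.
  by move=> sab; rewrite !mulr_ge0 ?AB ?expR_ge0 // ltW ?wgt_gt0.
apply: (max_principle a b K M z ab) t x tab.
- apply: cont2B => //; apply: cont2M.
    apply: cont2_time; apply: continuous_subspaceT => s.
    exact: (der_cont (derM (derD (der_cst A s) (derZ B (derB (der_id s) (der_cst a s))))
      (der_expR (Ed s)))).
  by apply: cont2_space => y; exact: (der_cont (wgt_der d y)).
- by move=> s y sab; rewrite /z; have := Psi s y sab; have := qM s y sab; lra.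
- by move=> y; rewrite /z subrr mulr0 addr0 Ea expR0 mulr1 subr_ge0.
move=> t x tab zneg.
have tab' : a <= t <= b by lra.
have [|qt [qxx [qx [qtd qxd qxxd qle]]]] := qeq t x tab.
  by have := Psi t x tab'; rewrite /z in zneg; lra.
have [c cd cle] := wgt_der2 d x.
pose P := (A + B * (t - a)) * expR (E t).
exists (B * expR (E t) * wgt d x + dE t * (P * wgt d x) - qt), (P * c - qxx),
  (fun y => P * (- (2 * d ^+ 2 * y) * wgt d y ^+ 2) - qx y).
have Pd := derM (derM (derD (der_cst A t) (derZ B (derB (der_id t) (der_cst a t))))
  (der_expR (Ed t))) (der_cst (wgt d x) t).
split.
- by apply: (derE (derB Pd qtd)); rewrite /P; ring.
- by move=> y; apply: (derB (derZ P (wgt_der d y)) (qxd y)).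
- by apply: (derB (derZ P cd) qxxd).
- have P0 : 0 <= P by rewrite mulr_ge0 ?AB ?expR_ge0.
  have := EK t tab; have := ler_wpM2l P0 cle; move: zneg qle; rewrite /z -/P.
  move: (wgt d x) (q t x) (dE t) (B * expR (E t) * wgt d x) => g Q e' W.
  by have := sqr_ge0 d; move: (d ^+ 2) => s; nra.
Qed.

End WeightedEstimates.

(** * Classical solutions and limits of difference quotients *)

Record classical_sol {R : realType} (f : R -> R -> R) (T : R) (u ux uxx : R -> R -> R) : Prop := {
  cs_d1 : forall t x : R, 0 <= t <= T -> is_derive x 1 (u t) (ux t x);
  cs_d2 : forall t x : R, 0 <= t <= T -> is_derive x 1 (ux t) (uxx t x);
  cs_cont : forall t : R, 0 <= t <= T -> forall e : R, 0 < e -> exists2 d : R, 0 < d &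
    forall s : R, 0 <= s <= T -> `|s - t| < d -> forall x : R, `|u s x - u t x| <= e;
  cs_eq : forall t x : R, 0 < t < T ->
    is_derive t 1 (fun s => u s x) (uxx t x + f t (u t x)) }.

Section DifferenceQuotients.
Context {R : realType}.
Implicit Types (v dv ddv : R -> R) (x y C : R).

Lemma der_sqr_le v x c C : is_derive x 1 v c ->
  (forall y, `|y| <= 1 -> (v (x + y) - v x) ^+ 2 <= C * y ^+ 2) -> c ^+ 2 <= C.
Proof.
move=> vd H; have C0 : 0 <= C.
  by have := H 1; rewrite normr1 expr1n mulr1 => /(_ (lexx _)); apply: le_trans; exact: sqr_ge0.
rewrite leNgt -(real_normK (num_real c)); apply/negP => Cc.
have c0 : 0 < `|c|.
  by rewrite lt_neqAle normr_ge0 andbT; apply/eqP => c0; rewrite -c0 expr0n /= in Cc; lra.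
(* Then (|c| - e)^2 >= |c|^2 - 2 e |c| > C, whereas the bound on the differences gives (|c| - e)^2
   <= C. *)
pose e := (`|c| ^+ 2 - C) / (4 * `|c|).
have e0 : 0 < e by rewrite divr_gt0 // ?subr_gt0 // mulr_gt0.
have eE : 4 * (e * `|c|) = `|c| ^+ 2 - C by rewrite /e; field; rewrite gt_eqF.
have /is_deriveP /(_ e e0) [r r0 Hr] := vd.
have [y [y0 yr y1]] : exists y : R, [/\ 0 < y, y < r & y <= 1].
  exists (Num.min r 1 / 2); have : 0 < Num.min r 1 by rewrite lt_min r0 ltr01.
  have : Num.min r 1 <= r by rewrite ge_min lexx.
  have : Num.min r 1 <= 1 by rewrite ge_min lexx orbT.
  by move: (Num.min r 1) => m; split; lra.
have := Hr (x + y); rewrite (_ : x + y - x = y); last by ring.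
rewrite (absE y) ?(ltW y0) // yr => /(_ isT).
have := H y; rewrite (absE y) ?(ltW y0) // y1 => /(_ isT); set D := v (x + y) - v x.
move=> DC Dc.
have : `|c| * y <= `|D| + e * y.
  rewrite -{1}(absE y) ?(ltW y0) // -normrM.
  have := ler_normB D (D - c * y); rewrite (_ : D - (D - c * y) = c * y); last by ring.
  lra.
rewrite -(real_normK (num_real D)) in DC.
move: (normr_ge0 D) (`|D|) DC => _ A DC A1.
have ec : e <= `|c| / 4 by nra.
have : 0 <= (`|c| - e) * y by rewrite mulr_ge0 ?(ltW y0) //; lra.
have y20 : 0 < y ^+ 2 by rewrite exprn_gt0.
move=> p0; have : ((`|c| - e) * y) ^+ 2 <= A ^+ 2.
  rewrite ler_sqr ?nnegrE //; [lra|].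
  by apply: le_trans p0 _; lra.
rewrite exprMn => h; have : (`|c| - e) ^+ 2 <= C by rewrite -(ler_pM2r y20); exact: le_trans DC.
by have := sqr_ge0 e; nra.
Qed.

Lemma der2_abs_le v dv ddv x C : (forall y, is_derive y 1 v (dv y)) ->
  (forall y, is_derive y 1 dv (ddv y)) -> {for x, continuous ddv} ->
  (forall y, `|y| <= 1 -> `|v (x + y) - 2 * v x + v (x - y)| <= C * y ^+ 2) ->
  `|ddv x| <= C.
Proof.
move=> vd dvd ddvc H; apply/ler_addgt0Pr => e e0.
have e2 : 0 < e / 2 by lra.
have /cvgrPdist_lt /(_ _ e2) /nbhs_ballP[r /= r0 Hr] := ddvc.
have [y [y0 yr y1]] : exists y : R, [/\ 0 < y, y < r & y <= 1].
  exists (Num.min r 1 / 2); have : 0 < Num.min r 1 by rewrite lt_min r0 ltr01.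
  have : Num.min r 1 <= r by rewrite ge_min lexx.
  have : Num.min r 1 <= 1 by rewrite ge_min lexx orbT.
  by move: (Num.min r 1) => m; split; lra.
have := second_diff_le v dv ddv x y (ddv x) (e / 2) vd dvd.
have h z : `|z - x| <= `|y| -> `|ddv z - ddv x| <= e / 2.
  rewrite (absE y) ?(ltW y0) // => zx; rewrite ltW // distrC; apply: Hr.
  by rewrite /ball /= distrC (le_lt_trans zx).
move=> /(_ h) {h}; have := H y; rewrite (absE y) ?(ltW y0) // y1 => /(_ isT).
have y20 : 0 < y ^+ 2 by rewrite exprn_gt0.
set D := v _ - _ + _ => DC Dd; rewrite -(ler_pM2r y20) -{1}(absE (y ^+ 2)) ?(ltW y20) // -normrM.
have := ler_normB D (D - ddv x * y ^+ 2).
by rewrite (_ : D - (D - ddv x * y ^+ 2) = ddv x * y ^+ 2); [lra|ring].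
Qed.

End DifferenceQuotients.

(** * Weighted growth of first and second differences of a solution *)

Section DifferenceEstimates.
Context {R : realType}.
Implicit Types (t x y p q s v w c e : R).
Variables (f f1 : R -> R -> R) (T r K K2 chi d EM : R) (u ux uxx : R -> R -> R) (E dE : R -> R).
Hypotheses (T0 : 0 <= T) (usol : classical_sol f T u ux uxx).

Lemma cs_cont2 : cont2 0 T u.
Proof.
move=> t x tT e e0.
have e2 : 0 < e / 2 by lra.
have [d1 d10 H1] := cs_cont _ _ _ _ _ usol t tT _ e2.
have /cvgrPdist_lt /(_ _ e2) /nbhs_ballP[d2 /= d20 H2] := der_cont (cs_d1 _ _ _ _ _ usol t x tT).
exists (Num.min d1 d2); first by rewrite lt_min d10.
move=> s y sT; rewrite !lt_min => /andP[st _] /andP[_ yx].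
have h1 := H1 s sT st y.
have h2 : `|u t x - u t y| < e / 2 by apply: H2; rewrite /ball /= distrC.
have -> : u s y - u t x = (u s y - u t y) - (u t x - u t y) by ring.
by have := ler_normB (u s y - u t y) (u t x - u t y); lra.
Qed.

(** [dE - 6 d^2] dominates the slope of [f] at every value between two values of the solution,
    because the mean value theorem produces such an intermediate value; the 6 d^2 is reserved for
    the weight. *)
Hypotheses (box : forall t x, 0 <= t <= T -> `|u t x| <= r)
  (fd : forall t p, 0 < t < T -> `|p| <= r -> is_derive p 1 (f t) (f1 t p))
  (f1lip : forall t p q, 0 < t < T -> `|p| <= r -> `|q| <= r ->
     `|f1 t p - f1 t q| <= K2 * `|p - q|)
  (E0 : E 0 = 0) (Ed : forall t : R, is_derive t 1 E (dE t))
  (EK : forall t, 0 < t < T -> dE t <= K)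
  (HE : forall t x y p, 0 < t < T ->
     Num.min (u t x) (u t y) <= p <= Num.max (u t x) (u t y) -> f1 t p <= dE t - 6 * d ^+ 2)
  (d01 : 0 <= d <= 1) (chi0 : 0 <= chi) (K20 : 0 <= K2)
  (i1 : forall x, `|ux 0 x| * (1 + `|x|) <= chi)
  (i2 : forall x, `|uxx 0 x| * (1 + x ^+ 2) <= chi)
  (EEM : forall t, 0 <= t <= T -> expR (E t) <= EM).

Let T00 : 0 <= (0 : R) <= T. Proof. by rewrite lexx. Qed.

Lemma btw_box t x y p : 0 <= t <= T ->
  Num.min (u t x) (u t y) <= p <= Num.max (u t x) (u t y) -> `|p| <= r.
Proof.
move=> tT; have := box t x tT; have := box t y tT; rewrite !ler_norml.
by have [_|_] := leP (u t x) (u t y); lra.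
Qed.

(** The two sides differ by (2 x + 3 c)^2 / 2 + 2 - 3 c^2 / 2. Steps are limited to length 1 so that
    the weights at nearby points remain comparable in this way. *)
Lemma shift_bound c x : `|c| <= 1 -> 1 + x ^+ 2 <= 3 * (1 + (x + c) ^+ 2).
Proof.
rewrite ler_norml => c1; have := sqr_ge0 (2 * x + 3 * c); have : c ^+ 2 <= 1 by nra.
by nra.
Qed.

Lemma wgt_ge1 x : 1 <= (1 + x ^+ 2) * wgt d x.
Proof.
rewrite -[X in X <= _](wgt_mul d x) mulrC; apply: ler_wpM2r; first exact/ltW/wgt_gt0.
have : d ^+ 2 <= 1 by case/andP: d01 => d0 d1; rewrite expr_le1.
by move=> d1; rewrite lerD2l ler_piMl ?sqr_ge0.
Qed.

Lemma first_difference y : `|y| <= 1 -> forall t x, 0 <= t <= T ->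
  (u t (x + y) - u t x) ^+ 2 <= 6 * chi ^+ 2 * y ^+ 2 * expR (2 * E t) * wgt d x.
Proof.
move=> y1; pose z t x := u t (x + y) - u t x; pose q t x := z t x * z t x.
move=> t x tT; rewrite expr2 -/(z t x) -/(q t x).
have E2d s : is_derive s 1 (fun s => 2 * E s) (2 * dE s) by exact: derZ.
have zc : cont2 0 T z by apply: cont2B; [apply: cont2_shift|]; exact: cs_cont2.
have -> : 6 * chi ^+ 2 * y ^+ 2 * expR (2 * E t) * wgt d x =
  (6 * chi ^+ 2 * y ^+ 2 + 0 * (t - 0)) * expR (2 * E t) * wgt d x by rewrite mul0r addr0.
apply: (weighted_growth 0 T _ 0 (2 * K) (4 * r ^+ 2) d q (fun s => 2 * E s)
  (fun s => 2 * dE s) T0) => //.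
- exact: cont2M.
- move=> s w sT; rewrite /q /z; have := box s w sT; have := box s (w + y) sT; rewrite !ler_norml.
  by nra.
- by rewrite E0 mulr0.
- by move=> s sT; have := EK s sT; lra.
- by apply: mulr_ge0 (sqr_ge0 y); apply: mulr_ge0 (sqr_ge0 chi).
- move=> w; rewrite /q /z.
  have [c cb ->] := MVT_btw (u 0) (ux 0) w (w + y) (fun v _ => cs_d1 _ _ _ _ _ usol 0 v T00).
  have cw : `|c - w| <= 1 by apply: le_trans (btw_dist _ _ _ cb) _; rewrite addrC addKr.
  have -> : ux 0 c * (w + y - w) * (ux 0 c * (w + y - w)) = ux 0 c ^+ 2 * y ^+ 2 by ring.
  have H : ux 0 c ^+ 2 * (1 + c ^+ 2) <= chi ^+ 2.
    have := i1 c; rewrite -(real_normK (num_real (ux 0 c))) -(real_normK (num_real c)).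
    move: (normr_ge0 (ux 0 c)) (normr_ge0 c); move: `|ux 0 c| `|c| => U C U0 C0 UC.
    have : (U * (1 + C)) ^+ 2 <= chi ^+ 2 by rewrite ler_sqr ?nnegrE // mulr_ge0 // addr_ge0.
    by have := mulr_ge0 (sqr_ge0 U) C0; nra.
  have := shift_bound (c - w) w cw; rewrite (addrC w) subrK => sb.
  have wg := wgt_ge1 w; have g0 := wgt_gt0 d w.
  have : ux 0 c ^+ 2 <= 6 * chi ^+ 2 * wgt d w.
    have U0 := sqr_ge0 (ux 0 c); move: (ux 0 c ^+ 2) U0 H => U U0 H.
    have : U * 1 <= U * ((1 + w ^+ 2) * wgt d w) by exact: ler_wpM2l.
    have : U * wgt d w * (1 + w ^+ 2) <= U * wgt d w * (3 * (1 + c ^+ 2)).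
      by apply: ler_wpM2l => //; rewrite mulr_ge0 // ltW.
    have := ler_wpM2r (ltW g0) H; have := mulr_ge0 (sqr_ge0 chi) (ltW g0).
    by nra.
  by have := sqr_ge0 y; nra.
- move=> s w sT _; have sT' : 0 <= s <= T by lra.
  pose zx v := ux s (v + y) - ux s v; pose zxx := uxx s (w + y) - uxx s w.
  have zd v : is_derive v 1 (z s) (zx v).
    exact: (derB (der_shift y (cs_d1 _ _ _ _ _ usol s (v + y) sT')) (cs_d1 _ _ _ _ _ usol s v sT')).
  have zxd : is_derive w 1 zx zxx.
    exact: (derB (der_shift y (cs_d2 _ _ _ _ _ usol s (w + y) sT')) (cs_d2 _ _ _ _ _ usol s w sT')).
  have ztd := derB (cs_eq _ _ _ _ _ usol s (w + y) sT) (cs_eq _ _ _ _ _ usol s w sT).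
  eexists; eexists; exists (fun v => zx v * z s v + z s v * zx v); split.
  + exact: (derM ztd ztd).
  + by move=> v; exact: derM.
  + exact: (derD (derM zxd (zd w)) (derM (zd w) zxd)).
  have [p pb fE] := MVT_btw (f s) (f1 s) (u s w) (u s (w + y))
    (fun p pb => fd s p sT (btw_box s w (w + y) p sT' pb)).
  have := HE s w (w + y) p sT pb; rewrite mul0r mul0r addr0.
  have -> : uxx s (w + y) + f s (u s (w + y)) - (uxx s w + f s (u s w))
     = zxx + f1 s p * z s w by rewrite /z -fE /zxx; ring.
  rewrite /q -/(z s w); have := sqr_ge0 (zx w); have := sqr_ge0 d.
  have : 0 <= z s w * z s w by rewrite -expr2 sqr_ge0.
  move: (zx w) (z s w) (dE s) (f1 s p) (zxx) (d ^+ 2) => X Z e F Y D Z0 D0 X0 FE.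
  have : (e - 6 * D - F) * (Z * Z) >= 0 by rewrite mulr_ge0 // subr_ge0.
  by nra.
Qed.

(** The equation of the second difference has a source: expanding [f] about [u t x] leaves [f1]
    times the second difference and two Taylor errors, each at most [K2] times the square of a first
    difference. The constant 12 is twice the 6 of [first_difference], and the two signs are treated
    separately. *)
Lemma second_difference y : `|y| <= 1 -> forall t x, 0 <= t <= T ->
  `|u t (x + y) - 2 * u t x + u t (x - y)| <=
    (6 * chi * y ^+ 2 + 12 * K2 * chi ^+ 2 * y ^+ 2 * EM * t) * expR (E t) * wgt d x.
Proof.
move=> y1; pose z t x := u t (x + y) - 2 * u t x + u t (x - y).
have zc : cont2 0 T z.
  apply: cont2D; last by apply: cont2_shift; exact: cs_cont2.
  apply: cont2B; first by apply: cont2_shift; exact: cs_cont2.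
  by apply: cont2M; [exact: cont2_cst|exact: cs_cont2].
have EM0 : 0 <= EM by apply: le_trans (EEM 0 T00); exact: expR_ge0.
suff H (sg : R) : sg = 1 \/ sg = -1 -> forall t x, 0 <= t <= T -> sg * z t x <=
    (6 * chi * y ^+ 2 + 12 * K2 * chi ^+ 2 * y ^+ 2 * EM * (t - 0)) * expR (E t) * wgt d x.
  move=> t x tT; rewrite -/(z t x) ler_norml.
  have := H 1 (or_introl erefl) t x tT; have := H (-1) (or_intror erefl) t x tT.
  by rewrite subr0; lra.
move=> sgE.
apply: (weighted_growth 0 T _ _ K (4 * `|r|) d (fun t x => sg * z t x) E dE T0) => //.
- by apply: cont2M => //; exact: cont2_cst.
- move=> s w sT; have := box s w sT; have := box s (w + y) sT; have := box s (w - y) sT.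
  by rewrite /z !ler_norml => ? ? ?; have := ler_norm r; case: sgE => ->; lra.
- by apply: mulr_ge0 (sqr_ge0 y); apply: mulr_ge0.
- apply: mulr_ge0 EM0; apply: mulr_ge0 (sqr_ge0 y); apply: mulr_ge0 (sqr_ge0 chi).
  by apply: mulr_ge0 K20.
- move=> w.
  have H : `|z 0 w| <= 2 * (3 * chi * wgt d w) * y ^+ 2.
    have := @second_diff_le R (u 0) (ux 0) (uxx 0) w y 0 (3 * chi * wgt d w)
      (fun v => cs_d1 _ _ _ _ _ usol 0 v T00) (fun v => cs_d2 _ _ _ _ _ usol 0 v T00).
    rewrite mul0r subr0; apply => v vw; rewrite subr0.
    have := shift_bound (v - w) w (le_trans vw y1); rewrite (addrC w) subrK => sb.
    have wg := wgt_ge1 w; have g0 := wgt_gt0 d w.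
    have := i2 v; have := normr_ge0 (uxx 0 v); move: `|uxx 0 v| => U U0 H.
    have : U * 1 <= U * ((1 + w ^+ 2) * wgt d w) by exact: ler_wpM2l.
    have : U * wgt d w * (1 + w ^+ 2) <= U * wgt d w * (3 * (1 + v ^+ 2)).
      by apply: ler_wpM2l => //; rewrite mulr_ge0 // ltW.
    by have := ler_wpM2r (ltW g0) H; nra.
  by move: H; rewrite ler_norml; case: sgE => ->; lra.
- move=> s w sT zpos; have sT' : 0 <= s <= T by lra.
  pose zx v := ux s (v + y) - 2 * ux s v + ux s (v - y).
  have zd v : is_derive v 1 (z s) (zx v).
    exact: (derD (derB (der_shift y (cs_d1 _ _ _ _ _ usol s (v + y) sT'))
      (derZ 2 (cs_d1 _ _ _ _ _ usol s v sT'))) (der_shift (- y) (cs_d1 _ _ _ _ _ usol s (v - y) sT'))).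
  have zxd := (derD (derB (der_shift y (cs_d2 _ _ _ _ _ usol s (w + y) sT'))
      (derZ 2 (cs_d2 _ _ _ _ _ usol s w sT'))) (der_shift (- y) (cs_d2 _ _ _ _ _ usol s (w - y) sT'))).
  have ztd := derD (derB (cs_eq _ _ _ _ _ usol s (w + y) sT)
     (derZ 2 (cs_eq _ _ _ _ _ usol s w sT))) (cs_eq _ _ _ _ _ usol s (w - y) sT).
  eexists; eexists; exists (fun v => sg * zx v); split.
  + exact: (derZ sg ztd).
  + by move=> v; exact: derZ.
  + exact: (derZ sg zxd).
  have taylor c : `|c| <= 1 -> `|f s (u s (w + c)) - f s (u s w) - f1 s (u s w) * (u s (w + c) - u s w)|
      <= K2 * (u s (w + c) - u s w) ^+ 2.
    move=> _; have [p pb ->] := MVT_btw (f s) (f1 s) (u s w) (u s (w + c))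
      (fun p pb => fd s p sT (btw_box s w (w + c) p sT' pb)).
    rewrite -mulrBl normrM -(real_normK (num_real (u s (w + c) - u s w))) expr2.
    rewrite mulrA ler_wpM2r //; apply: le_trans (f1lip s p (u s w) sT (btw_box s w _ p sT' pb) (box s w sT')) _.
    by rewrite ler_wpM2l // btw_dist.
  (* The exponential of 2 E is split: one factor becomes the constant [EM], the other matches the
     source allowed by [weighted_growth]. *)
  have fdd c : `|c| <= 1 -> K2 * (u s (w + c) - u s w) ^+ 2 <=
      6 * K2 * chi ^+ 2 * c ^+ 2 * EM * expR (E s) * wgt d w.
    move=> c1; have := first_difference c c1 s w sT'.
    have -> : expR (2 * E s) = expR (E s) * expR (E s) by rewrite mulr_natl mulr2n expRD.
    move=> H; have := ler_wpM2l K20 H.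
    have : 0 <= K2 * chi ^+ 2 * c ^+ 2 * expR (E s) * wgt d w.
      apply: mulr_ge0 (ltW (wgt_gt0 d w)); apply: mulr_ge0 (expR_ge0 _).
      by apply: mulr_ge0 (sqr_ge0 c); apply: mulr_ge0 K20 (sqr_ge0 chi).
    by have := EEM s sT'; nra.
  have := taylor y y1; have := taylor (- y); have := fdd y y1; have := fdd (- y).
  rewrite normrN sqrrN => /(_ y1) a1 a2 /(_ y1) a3 a4.
  have fE := HE s w w (u s w) sT; rewrite minxx maxxx lexx in fE.
  have {}fE := fE isT; move: zpos.
  move: a1 a2 a3 a4; rewrite /z !ler_norml; set G := K2 * _ ^+ 2; set G' := K2 * _ ^+ 2.
  move=> a1 a2 a3 a4 zpos.
  have : 0 <= (dE s - 6 * d ^+ 2 - f1 s (u s w)) * (sg * (u s (w + y) - 2 * u s w + u s (w - y))).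
    by rewrite mulr_ge0 ?(ltW zpos) // subr_ge0.
  by case: sgE => ->; lra.
Qed.


(** The estimates hold for all small steps, so letting the step tend to 0 bounds the derivatives. As
    d^2 (1 + x^2) times the weight is at most 1, returning to the weights of the norm costs 1 / d
    and 1 / d^2. The 4 comes from 2 * 6 <= 4^2, the 2 being that of (1 + |x|)^2 <= 2 (1 + x^2). *)
Lemma weighted_derivatives t x : 0 < d -> 0 <= t <= T -> {for x, continuous (uxx t)} ->
  `|(1 + `|x|) * ux t x| <= 4 * chi * expR (E t) / d /\
  `|(1 + x ^+ 2) * uxx t x| <= (6 * chi + 12 * K2 * chi ^+ 2 * EM * t) * expR (E t) / d ^+ 2.
Proof.
move=> d0 tT uxxc; have e0 := expR_gt0 (E t); have g0 := wgt_gt0 d x.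
have d2 : d ^+ 2 <= 1 by case/andP: d01 => ? ?; rewrite expr_le1.
have d20 : 0 < d ^+ 2 by rewrite exprn_gt0.
have EM0 : 0 <= EM by apply: le_trans (EEM 0 T00); exact: expR_ge0.
have wx : d ^+ 2 * ((1 + x ^+ 2) * wgt d x) <= 1.
  rewrite -[leRHS](wgt_mul d x) mulrA mulrC ler_wpM2l ?(ltW g0) //.
  by have := sqr_ge0 x; nra.
split.
  have H : ux t x ^+ 2 <= 6 * chi ^+ 2 * expR (2 * E t) * wgt d x.
    apply: (der_sqr_le (u t)); first exact: (cs_d1 _ _ _ _ _ usol).
    by move=> y y1; apply: le_trans (first_difference y y1 t x tT) _; lra.
  have Hx : (1 + `|x|) ^+ 2 <= 2 * (1 + x ^+ 2).
    by rewrite -(real_normK (num_real x)); have := sqr_ge0 (1 - `|x|); nra.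
  rewrite normrM ler_pdivlMr // -ler_sqr ?nnegrE; last 2 first.
  - by rewrite mulr_ge0 // ltW.
  - by rewrite !mulr_ge0 // ltW.
  rewrite (absE (1 + `|x|)); last by rewrite addr_ge0.
  have -> : (4 * chi * expR (E t)) ^+ 2 = 16 * chi ^+ 2 * expR (2 * E t).
    by rewrite [2 * E t]mulr_natl mulr2n expRD; ring.
  rewrite !exprMn (real_normK (num_real _)).
  have e20 := expR_gt0 (2 * E t).
  have c0 := sqr_ge0 chi.
  have : (1 + `|x|) ^+ 2 * ux t x ^+ 2 <=
      2 * (1 + x ^+ 2) * (6 * chi ^+ 2 * expR (2 * E t) * wgt d x).
    by apply: ler_pM => //; exact: sqr_ge0.
  have : 0 <= chi ^+ 2 * expR (2 * E t) by rewrite mulr_ge0 // ltW.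
  move: ((1 + `|x|) ^+ 2 * ux t x ^+ 2) => X c20 XH.
  have : X * d ^+ 2 <= 2 * (1 + x ^+ 2) * (6 * chi ^+ 2 * expR (2 * E t) * wgt d x) * d ^+ 2.
    by rewrite ler_wpM2r // ltW.
  have := ler_wpM2l c20 wx.
  by lra.
have H : `|uxx t x| <= (6 * chi + 12 * K2 * chi ^+ 2 * EM * t) * expR (E t) * wgt d x.
  apply: (der2_abs_le (u t) (ux t)) => //.
  - by move=> y; exact: (cs_d1 _ _ _ _ _ usol).
  - by move=> y; exact: (cs_d2 _ _ _ _ _ usol).
  by move=> y y1; apply: le_trans (second_difference y y1 t x tT) _; lra.
have C0 : 0 <= (6 * chi + 12 * K2 * chi ^+ 2 * EM * t) * expR (E t).
  apply: mulr_ge0 (ltW e0); apply: addr_ge0; first exact: mulr_ge0.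
  case/andP: tT => t0 _; apply: mulr_ge0 t0; apply: mulr_ge0 EM0.
  by apply: mulr_ge0 (sqr_ge0 chi); apply: mulr_ge0 K20.
have x0 : 0 <= 1 + x ^+ 2 by rewrite addr_ge0 // sqr_ge0.
rewrite normrM (absE (1 + x ^+ 2)) // ler_pdivlMr //.
move: (_ * expR (E t)) C0 H => C C0 H.
have := ler_wpM2l x0 H; have := ler_wpM2l C0 wx.
move: (`|uxx t x|) => U CH UH.
have : (1 + x ^+ 2) * U * d ^+ 2 <= (1 + x ^+ 2) * (C * wgt d x) * d ^+ 2.
  by rewrite ler_wpM2r // ltW.
by lra.
Qed.

End DifferenceEstimates.

(** * Invariant boxes, lower barriers and contraction towards a homogeneous orbit *)

Section Barriers.
Context {R : realType}.
Implicit Types (t x y p q s v w c e a b : R).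
Variables (f f1 : R -> R -> R) (T r : R) (u ux uxx : R -> R -> R).
Hypotheses (T0 : 0 <= T) (usol : classical_sol f T u ux uxx).

(** The sign of [f] is known only for r0 <= |p| <= r1, so the maximum principle applies only while
    |u| <= r1. At the infimum [ts] of the exit times |u| <= r0 still holds; continuity in time,
    uniform in x, keeps |u| <= r1 a little longer, and there the smaller box is recovered. *)
Lemma invariant_box (r0 r1 : R) : r0 < r1 -> (forall x, `|u 0 x| <= r0) ->
  (forall t p, 0 < t < T -> r0 <= p <= r1 -> f t p <= 0) ->
  (forall t p, 0 < t < T -> - r1 <= p <= - r0 -> 0 <= f t p) ->
  forall t x, 0 <= t <= T -> `|u t x| <= r0.
Proof.
move=> r01 u0 fr fNr.
have uc : cont2 0 T u := cs_cont2 _ _ _ _ _ usol.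
have step b : 0 <= b <= T -> (forall t x, 0 <= t <= b -> `|u t x| <= r1) ->
    forall t x, 0 <= t <= b -> `|u t x| <= r0.
  move=> /andP[b0 bT] ur1; have ucb : cont2 0 b u by exact: cont2_sub uc _ bT.
  suff H sg : sg = 1 \/ sg = -1 -> forall t x, 0 <= t <= b -> 0 <= r0 - sg * u t x.
    move=> t x tb; have := H 1 (or_introl erefl) t x tb.
    by have := H (-1) (or_intror erefl) t x tb; rewrite ler_norml; lra.
  move=> sgE; apply: (max_principle 0 b 0 (r1 - r0) (fun t x => r0 - sg * u t x) b0).
  - by apply: cont2B; [exact: cont2_cst|apply: cont2M => //; exact: cont2_cst].
  - by move=> t x /(ur1 t x); rewrite ler_norml; case: sgE => ->; lra.
  - by move=> x; have := u0 x; rewrite ler_norml; case: sgE => ->; lra.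
  move=> t x tb zneg; have tT : 0 < t < T by lra.
  have tT' : 0 <= t <= T by lra.
  exists (0 - sg * (uxx t x + f t (u t x))), (0 - sg * uxx t x), (fun y => 0 - sg * ux t y).
  split.
  - exact: (derB (der_cst r0 t) (derZ sg (cs_eq _ _ _ _ _ usol t x tT))).
  - by move=> y; exact: (derB (der_cst r0 y) (derZ sg (cs_d1 _ _ _ _ _ usol t y tT'))).
  - exact: (derB (der_cst 0 x) (derZ sg (cs_d2 _ _ _ _ _ usol t x tT'))).
  - have tb' : 0 <= t <= b by lra.
    have := ur1 t x tb'; rewrite ler_norml; move: zneg; case: sgE => -> zneg ub.
    + have h : f t (u t x) <= 0 by (apply: fr => //; lra).
      by lra.
    + have h : 0 <= f t (u t x) by (apply: fNr => //; lra).
      by lra.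
move=> t x tT; rewrite leNgt; apply/negP => bad.
pose S := [set t | 0 <= t <= T /\ exists x, r0 < `|u t x|]%classic.
have Snz : S !=set0 by exists t; split=> //; exists x.
have Slb : has_lbound S by exists 0 => s [/andP[]].
have infS : has_inf S by [].
pose ts := inf S.
have ts0 : 0 <= ts by apply: lb_le_inf => // s [/andP[]].
have tst : ts <= t by apply: (ge_inf Slb); split=> //; exists x.
have tsT : 0 <= ts <= T by lra.
have tsT1 : ts <= T by lra.
have below s y : 0 <= s -> s < ts -> `|u s y| <= r0.
  move=> s0 sts; rewrite leNgt; apply/negP => sy.
  have : S s by split; [lra|exists y].
  by move=> /(ge_inf Slb); rewrite -/ts; lra.
have at_ts y : `|u ts y| <= r0.
  have [->|tsn0] := eqVneq ts 0; first exact: u0.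
  have tspos : 0 < ts by rewrite lt_neqAle eq_sym tsn0.
  rewrite ler_norml; apply/andP; split.
    by apply: (cont2_le 0 T ts y (- r0) u uc) => // s s0 /(below s y s0); rewrite ler_norml => /andP[].
  rewrite -lerN2 -[X in _ <= X]mulN1r; apply: (cont2_le 0 T ts y (- r0) (fun t x => -1 * u t x)) => //; last first.
    by move=> s s0 /(below s y s0); rewrite ler_norml; lra.
  by apply: cont2M => //; exact: cont2_cst.
have r10 : 0 < r1 - r0 by lra.
have [d d0 Hd] := cs_cont _ _ _ _ _ usol ts tsT _ r10.
(* [b] stays within the time of continuity d after [ts], yet reaches far enough to contain exit
   times close to their infimum. *)
have [b [bT tsb bd be]] : exists b : R, [/\ 0 <= b <= T, ts <= b, b < ts + d &
    forall s, s <= T -> s < ts + d / 2 -> s <= b].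
  exists (Num.min T (ts + d / 2)); have [Tb|bT] := leP T (ts + d / 2).
    by split; try lra; move=> s; lra.
  by split; try lra; move=> s; lra.
have ub s y : 0 <= s <= b -> `|u s y| <= r1.
  move=> sb; have [sts|tss] := ltP s ts.
    by apply: le_trans (below s y _ sts) _; lra.
  have st : `|s - ts| < d by (rewrite absE; lra).
  have sT : 0 <= s <= T by lra.
  have := Hd s sT st y; have := at_ts y; rewrite !ler_norml; lra.
have d2 : 0 < d / 2 by lra.
have [s [sT [y sy]] sd] := inf_adherent d2 infS.
have sb : 0 <= s <= b by rewrite be ?andbT //; lra.
by have := step b bT ub s y sb; lra.
Qed.

Hypotheses (box : forall t x, 0 <= t <= T -> `|u t x| <= r)
  (fd : forall t p, 0 < t < T -> `|p| <= r -> is_derive p 1 (f t) (f1 t p)).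

Lemma secant_box t p q w : Num.min p q <= w <= Num.max p q ->
  `|p| <= r -> `|q| <= r -> `|w| <= r.
Proof. by rewrite !ler_norml; have [_|_] := leP p q; lra. Qed.

(** The barrier is constant in x, so only its speed has to be compared with the reaction along it.
    Where u lies below, the mean value theorem bounds the difference of the reactions by [L] times
    the gap. *)
Lemma lower_barrier (L a b p0 sg : R) : 0 <= a -> a <= b -> b <= T ->
  (forall t p, 0 < t < T -> `|p| <= r -> f1 t p <= L) ->
  (forall t, a < t < b -> `|p0 + sg * (t - a)| <= r /\ sg <= f t (p0 + sg * (t - a))) ->
  (forall x, p0 <= u a x) ->
  forall t x, a <= t <= b -> p0 + sg * (t - a) <= u t x.
Proof.
move=> a0 ab bT f1L pf pa t x tab; rewrite -subr_ge0.
pose P t := p0 + sg * (t - a).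
have Pd s : is_derive s 1 P sg.
  apply: (derE (derD (der_cst p0 s) (derZ sg (derB (der_id s) (der_cst a s))))); ring.
apply: (max_principle a b L (r + (`|p0| + `|sg| * (b - a))) (fun t x => u t x - P t) ab) => //.
- apply: cont2B; first exact: cont2_sub (cs_cont2 _ _ _ _ _ usol) a0 bT.
  by apply: cont2_time; apply: continuous_subspaceT => s; exact: der_cont (Pd s).
- move=> s y sab; have sT : 0 <= s <= T by lra.
  have := box s y sT; rewrite ler_norml /P => ub.
  have h1 := ler_norm p0.
  have : sg * (s - a) <= `|sg| * (b - a).
    apply: (@le_trans _ _ (`|sg| * (s - a))).
      by apply: ler_wpM2r; [lra|exact: ler_norm].
    by apply: ler_wpM2l => //; lra.
  by lra.
- by move=> y; rewrite /P subrr mulr0 addr0 subr_ge0.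
move=> s y sab zneg; have sT : 0 < s < T by lra.
have sT' : 0 <= s <= T by lra.
exists (uxx s y + f s (u s y) - sg), (uxx s y - 0), (fun w => ux s w - 0); split.
- exact: (derB (cs_eq _ _ _ _ _ usol s y sT) (Pd s)).
- by move=> w; exact: (derB (cs_d1 _ _ _ _ _ usol s w sT') (der_cst (P s) w)).
- exact: (derB (cs_d2 _ _ _ _ _ usol s y sT') (der_cst 0 y)).
have [Pb Pf] := pf s sab; rewrite -/(P s) in Pb Pf.
have [w wb] := MVT_btw (f s) (f1 s) (P s) (u s y)
  (fun w wb => fd s w sT (secant_box s _ _ w wb Pb (box s y sT'))).
have := f1L s w sT (secant_box s _ _ w wb Pb (box s y sT')).
move: zneg Pf; move: (f1 s w) (u s y) (P s) => F U Q zneg Pf FL fE.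
have : 0 <= (L - F) * (Q - U) by rewrite mulr_ge0 //; lra.
by lra.
Qed.

(** The square of u - phi is compared with the weight for d = 0, that is, without localisation. The
    slope is bounded between the two values being compared, where the mean value theorem evaluates
    it. *)
Lemma contraction (a b kap : R) (phi : R -> R) : 0 <= a -> a <= b -> b <= T ->
  (forall t, a <= t <= b -> is_derive t 1 phi (f t (phi t)) /\ `|phi t| <= r) ->
  (forall t x p, a < t < b -> Num.min (phi t) (u t x) <= p <= Num.max (phi t) (u t x) ->
     f1 t p <= - kap) ->
  forall t x, a <= t <= b -> `|u t x - phi t| <= 2 * r * expR (- kap * (t - a)).
Proof.
move=> a0 ab bT phid f1k t x tab.
have aT : 0 <= a <= T by lra.
have r0 : 0 <= r by apply: le_trans (box a 0 aT).
rewrite -(ler_sqr (x := `|_|)) ?nnegrE ?mulr_ge0 ?expR_ge0 //.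
rewrite real_normK ?num_real //.
pose z t x := u t x - phi t; pose q t x := z t x * z t x.
pose E s := 2 * (- kap) * (s - a).
have Ed s : is_derive s 1 E (2 * (- kap)).
  apply: (derE (derZ (2 * (- kap)) (derB (der_id s) (der_cst a s)))); ring.
have -> : (2 * r * expR (- kap * (t - a))) ^+ 2 =
    (4 * r ^+ 2 + 0 * (t - a)) * expR (E t) * wgt 0 x.
  have -> : E t = - kap * (t - a) + - kap * (t - a) by rewrite /E; ring.
  by rewrite wgt0 expRD; ring.
have zc : cont2 a b z.
  apply: cont2B; first exact: cont2_sub (cs_cont2 _ _ _ _ _ usol) a0 bT.
  apply: cont2_time; apply: continuous_in_subspaceT => s; rewrite inE /= in_itv /= => sab.
  by have [+ _] := phid s sab; exact: der_cont.
have q4 s y : a <= s <= b -> q s y <= 4 * r ^+ 2.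
  move=> sab; have sT : 0 <= s <= T by lra.
  have := box s y sT; have [_] := phid s sab; rewrite /q /z !ler_norml.
  by move: (u s y) (phi s) => U P; nra.
rewrite expr2 -/(z t x) -/(q t x).
apply: (weighted_growth a b _ 0 (2 * (- kap)) (4 * r ^+ 2) 0 q E (fun=> 2 * (- kap)) ab) => //.
- exact: cont2M.
- by rewrite /E subrr mulr0.
- by apply: mulr_ge0 (sqr_ge0 r).
- by move=> y; rewrite wgt0 mulr1; apply: q4; rewrite lexx.
move=> s y sab _; have sT : 0 < s < T by lra.
have sT' : 0 <= s <= T by lra.
have sab' : a <= s <= b by lra.
have [phis phib] := phid s sab'.
have zd w : is_derive w 1 (z s) (ux s w - 0).
  exact: (derB (cs_d1 _ _ _ _ _ usol s w sT') (der_cst (phi s) w)).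
have zxd : is_derive y 1 (fun w => ux s w - 0) (uxx s y - 0).
  exact: (derB (cs_d2 _ _ _ _ _ usol s y sT') (der_cst 0 y)).
have ztd := derB (cs_eq _ _ _ _ _ usol s y sT) phis.
eexists; eexists; exists (fun v => (ux s v - 0) * z s v + z s v * (ux s v - 0)); split.
- exact: (derM ztd ztd).
- by move=> v; exact: derM.
- exact: (derD (derM zxd (zd y)) (derM (zd y) zxd)).
have [w wb fE] := MVT_btw (f s) (f1 s) (phi s) (u s y)
  (fun w wb => fd s w sT (secant_box s _ _ w wb phib (box s y sT'))).
have := f1k s y w sab wb; rewrite mul0r mul0r addr0 expr0n /= !subr0 mulr0 subr0.
have -> : uxx s y + f s (u s y) - f s (phi s) = uxx s y + f1 s w * z s y.
  by rewrite /z -fE; ring.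
rewrite /q -/(z s y); have := sqr_ge0 (ux s y).
have : 0 <= z s y * z s y by rewrite -expr2 sqr_ge0.
move: (ux s y) (z s y) (f1 s w) (uxx s y) => X Z F Y Z0 X0 FE.
have : (- kap - F) * (Z * Z) >= 0 by rewrite mulr_ge0 // subr_ge0.
by lra.
Qed.

End Barriers.

(** * The explicit difference scheme and its uniform estimates *)

Record regular_reaction {R : realType} (f f1 f2 : R -> R -> R) (T r L : R) : Prop := {
  rr_d1 : forall t p : R, 0 <= t <= T -> `|p| <= r -> is_derive p 1 (f t) (f1 t p);
  rr_d2 : forall t p : R, 0 <= t <= T -> `|p| <= r -> is_derive p 1 (f1 t) (f2 t p);
  rr_b : forall t p : R, 0 <= t <= T -> `|p| <= r -> `|f t p| <= L;
  rr_b1 : forall t p : R, 0 <= t <= T -> `|p| <= r -> `|f1 t p| <= L;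
  rr_b2 : forall t p : R, 0 <= t <= T -> `|p| <= r -> `|f2 t p| <= L;
  rr_lip2 : forall t p q : R, 0 <= t <= T -> `|p| <= r -> `|q| <= r ->
     `|f2 t p - f2 t q| <= L * `|p - q|;
  rr_time : forall t s p : R, 0 <= t <= T -> 0 <= s <= T -> `|p| <= r ->
     `|f t p - f s p| <= L * `|t - s|;
  rr_top : forall t : R, 0 <= t <= T -> f t r <= 0;
  rr_bot : forall t : R, 0 <= t <= T -> 0 <= f t (- r) }.

Record regular_data {R : realType} (u0 v0 w0 : R -> R) (r V0 W0 : R) : Prop := {
  rd_d1 : forall x : R, is_derive x 1 u0 (v0 x);
  rd_d2 : forall x : R, is_derive x 1 v0 (w0 x);
  rd_b : forall x : R, `|u0 x| <= r;
  rd_b1 : forall x : R, `|v0 x| <= V0;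
  rd_b2 : forall x : R, `|w0 x| <= W0 }.

Section Scheme.
Context {R : realType}.
Implicit Types (t x y z s e a b : R) (n m k : nat).

Definition avg (l : R) (v : R -> R) (x : R) : R := (v (x + l) + v (x - l)) / 2.

Lemma avg_der l v dv x : (forall y, is_derive y 1 v (dv y)) ->
  is_derive x 1 (avg l v) (avg l dv x).
Proof.
move=> vd; have H := derZ 2^-1 (derD (der_shift l (vd (x + l))) (der_shift (- l) (vd (x - l)))).
apply: (derE (der_ext _ H)); last by rewrite /avg mulrC.
by move=> y; rewrite /avg mulrC.
Qed.

Lemma avg_abs l v M x : (forall y, `|v y| <= M) -> `|avg l v x| <= M.
Proof.
move=> vM; have := vM (x + l); have := vM (x - l); rewrite /avg !ler_norml; lra.
Qed.

Lemma avgB_abs l v w M x : (forall y, `|v y - w y| <= M) -> `|avg l v x - avg l w x| <= M.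
Proof.
move=> H; rewrite (_ : _ - _ = avg l (fun y => v y - w y) x); first exact: avg_abs.
by rewrite /avg; field.
Qed.

Variables (f f1 f2 : R -> R -> R) (h : R) (u0 v0 w0 : R -> R).

Fixpoint schU n : R -> R :=
  if n is n.+1 then avg (Num.sqrt (2 * h)) (fun y => schU n y + h * f (n%:R * h) (schU n y))
  else u0.

(** [schV] and [schW] come from differentiating the recursion for [schU] once and twice in x. They
    are its exact derivatives, so that derivatives are bounded by recursion instead of by difference
    quotients. *)
Fixpoint schV n : R -> R :=
  if n is n.+1 then avg (Num.sqrt (2 * h)) (fun y => (1 + h * f1 (n%:R * h) (schU n y)) * schV n y)
  else v0.

Fixpoint schW n : R -> R :=
  if n is n.+1 then avg (Num.sqrt (2 * h)) (fun y => (1 + h * f1 (n%:R * h) (schU n y)) * schW n y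
     + h * (f2 (n%:R * h) (schU n y) * schV n y ^+ 2))
  else w0.

Lemma schUS n : schU n.+1 = avg (Num.sqrt (2 * h)) (fun y => schU n y + h * f (n%:R * h) (schU n y)).
Proof. by []. Qed.
Lemma schVS n : schV n.+1 =
  avg (Num.sqrt (2 * h)) (fun y => (1 + h * f1 (n%:R * h) (schU n y)) * schV n y).
Proof. by []. Qed.
Lemma schWS n : schW n.+1 =
  avg (Num.sqrt (2 * h)) (fun y => (1 + h * f1 (n%:R * h) (schU n y)) * schW n y
     + h * (f2 (n%:R * h) (schU n y) * schV n y ^+ 2)).
Proof. by []. Qed.

Variables (T r L V0 W0 : R).
Hypotheses (T0 : 0 <= T) (r0 : 0 <= r) (L0 : 0 <= L) (h0 : 0 < h) (hL : h * L <= 1)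
  (reg : regular_reaction f f1 f2 T r L) (dat : regular_data u0 v0 w0 r V0 W0).

Let fd1 := rr_d1 _ _ _ _ _ _ reg.
Let fd2 := rr_d2 _ _ _ _ _ _ reg.
Let fb := rr_b _ _ _ _ _ _ reg.
Let f1b := rr_b1 _ _ _ _ _ _ reg.
Let f2b := rr_b2 _ _ _ _ _ _ reg.
Let f2lip := rr_lip2 _ _ _ _ _ _ reg.
Let ftime := rr_time _ _ _ _ _ _ reg.
Let fr := rr_top _ _ _ _ _ _ reg.
Let fNr := rr_bot _ _ _ _ _ _ reg.
Let ud := rd_d1 _ _ _ _ _ _ dat.
Let vd := rd_d2 _ _ _ _ _ _ dat.
Let v0b := rd_b1 _ _ _ _ _ _ dat.
Let w0b := rd_b2 _ _ _ _ _ _ dat.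

Let l := Num.sqrt (2 * h).

Lemma sch_l2 : l ^+ 2 = 2 * h.
Proof. by rewrite sqr_sqrtr // mulr_ge0 // ltW. Qed.

Lemma sch_time n : n%:R * h <= T -> 0 <= n%:R * h <= T.
Proof. by move=> ->; rewrite andbT mulr_ge0 // ltW. Qed.

Lemma sch_timeS n : n.+1%:R * h <= T -> n%:R * h <= T.
Proof. by apply: le_trans; rewrite ler_wpM2r ?(ltW h0) // ler_nat. Qed.

Lemma gbox t p q w : Num.min p q <= w <= Num.max p q ->
  `|p| <= r -> `|q| <= r -> `|w| <= r.
Proof. by rewrite !ler_norml; have [_|_] := leP p q; lra. Qed.

Lemma f_lip t p q : 0 <= t <= T -> `|p| <= r -> `|q| <= r -> `|f t p - f t q| <= L * `|p - q|.
Proof.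
move=> tT pr qr; apply: (der_lip _ (f1 t)) => w wb; first by apply: fd1 => //; exact: gbox wb _ _.
by apply: f1b => //; exact: gbox wb _ _.
Qed.

Lemma f1_lip t p q : 0 <= t <= T -> `|p| <= r -> `|q| <= r -> `|f1 t p - f1 t q| <= L * `|p - q|.
Proof.
move=> tT pr qr; apply: (der_lip _ (f2 t)) => w wb; first by apply: fd2 => //; exact: gbox wb _ _.
by apply: f2b => //; exact: gbox wb _ _.
Qed.

(** The condition h L <= 1 makes p + h f(t, p) nondecreasing in p. Invariance of the box then has to
    be checked only at its two ends, where the sign of [f] is known. *)
Lemma step_ge0 t p : 0 <= t <= T -> `|p| <= r -> 0 <= 1 + h * f1 t p <= 1 + h * L.
Proof.
move=> tT pr; have := f1b t p tT pr; rewrite ler_norml => /andP[H1 H2].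
have := ler_wpM2l (ltW h0) H1; have := ler_wpM2l (ltW h0) H2.
by have := hL; rewrite mulrN; move: (h * f1 t p) (h * L) => X Y; lra.
Qed.

Lemma step_box t p : 0 <= t <= T -> `|p| <= r -> `|p + h * f t p| <= r.
Proof.
move=> tT pr.
have mono q w : q <= w -> `|q| <= r -> `|w| <= r -> q + h * f t q <= w + h * f t w.
  move=> qw qr wr; have [c cb fE] := MVT_btw (f t) (f1 t) q w
    (fun c cb => fd1 t c tT (gbox t q w c cb qr wr)).
  have /andP[H _] := step_ge0 t c tT (gbox t q w c cb qr wr).
  rewrite -subr_ge0 (_ : _ - _ = (1 + h * f1 t c) * (w - q)).
    by rewrite mulr_ge0 // subr_ge0.
  by rewrite mulrDl mul1r -mulrA -fE; ring.
have rr : `|r| <= r by rewrite absE.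
have Nrr : `|- r| <= r by rewrite normrN absE.
have := pr; rewrite !ler_norml => /andP[p1 p2].
have := mono _ _ p1 Nrr pr; have := mono _ _ p2 pr rr.
have : h * f t r <= 0 by rewrite mulr_ge0_le0 ?fr // ltW.
have : 0 <= h * f t (- r) by rewrite mulr_ge0 ?fNr // ltW.
by lra.
Qed.

Lemma schU_box n : n%:R * h <= T -> forall x, `|schU n x| <= r.
Proof.
elim: n => [_|n IH nT x]; first exact: (rd_b _ _ _ _ _ _ dat).
rewrite schUS; have nT' := sch_timeS n nT.
by apply: avg_abs => y; apply: step_box; [exact: sch_time|exact: IH].
Qed.

Lemma sch_der n : n%:R * h <= T -> forall x, is_derive x 1 (schU n) (schV n x) /\
  is_derive x 1 (schV n) (schW n x).
Proof.
elim: n => [_ x|n IH nT x]; first by split; [exact: ud|exact: vd].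
have nT' := sch_timeS n nT; have tT := sch_time n nT'.
have Ud y := (IH nT' y).1; have Vd y := (IH nT' y).2.
rewrite schUS schVS schWS; split; apply: avg_der => y.
- apply: (derE (derD (Ud y) (derZ h (der_comp (fd1 _ _ tT (schU_box n nT' y)) (Ud y))))).
  by ring.
- apply: (derE (derM (derD (der_cst 1 y) (derZ h (der_comp (fd2 _ _ tT (schU_box n nT' y)) (Ud y)))) (Vd y))).
  by ring.
Qed.

(** The discrete Gronwall majorant for a_(n+1) <= (1 + h L) a_n + h b, written in terms of the time
    n h so that [gro_le] bounds it independently of h. *)
Definition gro a b n : R := (a + n%:R * h * b) * expR (L * (n%:R * h)).

Lemma groS a b n : 0 <= a -> 0 <= b -> (1 + h * L) * gro a b n + h * b <= gro a b n.+1.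
Proof.
move=> a0 b0; rewrite /gro.
have hh : 0 <= n%:R * h by rewrite mulr_ge0 // ltW.
have -> : L * (n.+1%:R * h) = h * L + L * (n%:R * h) by rewrite -natr1; ring.
have -> : a + n.+1%:R * h * b = (a + n%:R * h * b) + h * b by rewrite -natr1; ring.
rewrite expRD; have E1 := expR_ge1Dx (h * L).
have E2 : 1 <= expR (L * (n%:R * h)).
  by rewrite -[X in X <= _]expR0 ler_expR; exact: mulr_ge0.
have hL0 : 0 <= h * L by rewrite mulr_ge0 // ltW.
have A0 : 0 <= a + n%:R * h * b by rewrite addr_ge0 // mulr_ge0.
have B0 : 0 <= h * b by rewrite mulr_ge0 // ltW.
move: (expR (h * L)) (expR (L * (n%:R * h))) (a + _) (h * b) E1 E2 A0 B0 => e1 e2 A B E1 E2 A0 B0.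
have e11 : 1 <= e1 by lra.
have e21 : 1 <= e1 * e2 by exact: mulr_ege1.
have : (1 + h * L) * (A * e2) <= e1 * (A * e2) by apply: ler_wpM2r => //; apply: mulr_ge0 => //; lra.
have : B * 1 <= B * (e1 * e2) by exact: ler_wpM2l.
by lra.
Qed.

Lemma gro_le a b n : n%:R * h <= T -> 0 <= a -> 0 <= b -> gro a b n <= (a + T * b) * expR (L * T).
Proof.
move=> nT a0 b0; have /andP[n0 _] := sch_time n nT.
apply: ler_pM; [|exact: expR_ge0| |].
- by apply: addr_ge0 => //; exact: mulr_ge0.
- by rewrite lerD2l ler_wpM2r.
- by rewrite ler_expR ler_wpM2l.
Qed.

Definition bndV := V0 * expR (L * T).
Definition bndW := (W0 + T * (L * bndV ^+ 2)) * expR (L * T).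

Let V00 : 0 <= V0. Proof. exact: le_trans (v0b 0). Qed.
Let W00 : 0 <= W0. Proof. exact: le_trans (w0b 0). Qed.
Lemma bndV_ge0 : 0 <= bndV. Proof. by rewrite mulr_ge0 // expR_ge0. Qed.
Let LV0 : 0 <= L * bndV ^+ 2. Proof. by rewrite mulr_ge0 // sqr_ge0. Qed.
Lemma bndW_ge0 : 0 <= bndW. Proof. by rewrite mulr_ge0 ?expR_ge0 // addr_ge0 // mulr_ge0. Qed.

Lemma schV_le n : n%:R * h <= T -> forall x, `|schV n x| <= bndV.
Proof.
suff H : n%:R * h <= T -> forall x, `|schV n x| <= gro V0 0 n.
  by move=> nT x; apply: le_trans (H nT x) _; apply: le_trans (gro_le V0 0 n nT _ _) _;
    rewrite // mulr0 addr0.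
elim: n => [_ x|n IH nT x]; last rewrite schVS.
  by rewrite /gro !mul0r mulr0 expR0 mulr1 addr0.
have nT' := sch_timeS n nT; have tT := sch_time n nT'.
apply: le_trans (groS V0 0 n V00 _) => //; rewrite mulr0 addr0.
apply: avg_abs => y; have /andP[s0 s1] := step_ge0 _ _ tT (schU_box n nT' y).
rewrite normrM (absE _ s0); apply: ler_pM => //; exact: IH.
Qed.

Lemma schW_le n : n%:R * h <= T -> forall x, `|schW n x| <= bndW.
Proof.
suff H : n%:R * h <= T -> forall x, `|schW n x| <= gro W0 (L * bndV ^+ 2) n.
  by move=> nT x; apply: le_trans (H nT x) _; exact: gro_le.
elim: n => [_ x|n IH nT x]; last rewrite schWS.
  by rewrite /gro !mul0r mulr0 expR0 mulr1 addr0.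
have nT' := sch_timeS n nT; have tT := sch_time n nT'.
apply: le_trans (groS W0 _ n W00 LV0).
apply: avg_abs => y; have /andP[s0 s1] := step_ge0 _ _ tT (schU_box n nT' y).
apply: le_trans (ler_normD _ _) _; apply: lerD.
  by rewrite normrM (absE _ s0); apply: ler_pM => //; exact: IH.
rewrite normrM (absE h) ?(ltW h0) // ler_wpM2l ?(ltW h0) // normrM.
apply: ler_pM => //; first exact: f2b (schU_box n nT' y).
by rewrite normrX ler_sqr ?nnegrE ?bndV_ge0 //; exact: schV_le.
Qed.

Lemma schU_lip n : n%:R * h <= T -> forall x y, `|schU n y - schU n x| <= bndV * `|y - x|.
Proof.
move=> nT x y; apply: (der_lip _ (schV n)) => w _; first exact: (sch_der n nT w).1.
exact: schV_le.
Qed.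

Lemma schV_lip n : n%:R * h <= T -> forall x y, `|schV n y - schV n x| <= bndW * `|y - x|.
Proof.
move=> nT x y; apply: (der_lip _ (schW n)) => w _; first exact: (sch_der n nT w).2.
exact: schW_le.
Qed.

(** Lipschitz constant, with respect to a shift in x, of the inhomogeneous part of the recursion for
    [schW]: L V W from the variation of [f1], L V^3 from that of [f2], and 2 L V W from that of
    V^2. *)
Definition bndM := 3 * L * bndV * bndW + L * bndV ^+ 3.

Lemma bndM_ge0 : 0 <= bndM.
Proof.
have := bndV_ge0; have := bndW_ge0 => w v; apply: addr_ge0; last by apply: mulr_ge0 => //; exact: exprn_ge0.
by apply: mulr_ge0 => //; apply: mulr_ge0 => //; apply: mulr_ge0.
Qed.

(** The data have no third derivative, so the modulus of continuity of [w0] itself is propagated,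
    with an error linear in the shift. *)
Lemma schW_mod n z e : n%:R * h <= T -> 0 <= e -> (forall x, `|w0 (x + z) - w0 x| <= e) ->
  forall x, `|schW n (x + z) - schW n x| <= (e + T * (bndM * `|z|)) * expR (L * T).
Proof.
move=> nT e0 w0z; have M0 : 0 <= bndM * `|z| by rewrite mulr_ge0 // bndM_ge0.
suff H : n%:R * h <= T -> forall x, `|schW n (x + z) - schW n x| <= gro e (bndM * `|z|) n.
  by move=> x; apply: le_trans (H nT x) _; exact: gro_le.
elim: n {nT} => [_ x|n IH nT x]; last rewrite schWS.
  by rewrite /gro !mul0r mulr0 expR0 mulr1 addr0.
have nT' := sch_timeS n nT; have tT := sch_time n nT'.
apply: le_trans (groS e _ n e0 M0).
rewrite -/l {1}/avg (_ : x + z + l = x + l + z); last by ring.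
rewrite (_ : x + z - l = x - l + z); last by ring.
set a := (fun y => _).
apply: (avgB_abs l (fun y => a (y + z)) a) => y; rewrite /a {a}.
set t := n%:R * h in tT *.
have Uy := schU_box n nT' y; have Uyz := schU_box n nT' (y + z).
have /andP[s0 s1] := step_ge0 t _ tT Uyz.
have Wd := IH nT' y; have yz : `|y + z - y| = `|z| by congr `|_|; ring.
have Ud := schU_lip n nT' y (y + z); have Vd := schV_lip n nT' y (y + z).
rewrite yz in Ud Vd.
have F1 := f1_lip t _ _ tT Uyz Uy; have F2 := f2lip t _ _ tT Uyz Uy.
have F2b := f2b t _ tT Uy; have Wy := schW_le n nT' y.
have Vy := schV_le n nT' y; have Vyz := schV_le n nT' (y + z).
move: (schU n y) (schU n (y + z)) (schV n y) (schV n (y + z)) (schW n y) (schW n (y + z))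
  Uy Uyz s0 s1 Wd Ud Vd F1 F2 F2b Wy Vy Vyz => U U' V V' W W' Uy Uyz s0 s1 Wd Ud Vd F1 F2 F2b Wy Vy Vyz.
have v0' := bndV_ge0; have w0' := bndW_ge0.
have F1' : `|f1 t U' - f1 t U| <= L * (bndV * `|z|).
  by apply: le_trans F1 _; rewrite ler_wpM2l.
have F2' : `|f2 t U' - f2 t U| <= L * (bndV * `|z|).
  by apply: le_trans F2 _; rewrite ler_wpM2l.
rewrite (_ : _ - _ = (1 + h * f1 t U') * (W' - W) + h * ((f1 t U' - f1 t U) * W
   + ((f2 t U' - f2 t U) * V' ^+ 2 + f2 t U * ((V' - V) * (V' + V))))); last by ring.
apply: le_trans (ler_normD _ _) _; apply: lerD.
  by rewrite normrM (absE _ s0); exact: ler_pM.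
rewrite normrM (absE h) ?(ltW h0) // ler_wpM2l ?(ltW h0) //.
have -> : bndM * `|z| = L * (bndV * `|z|) * bndW + (L * (bndV * `|z|) * bndV ^+ 2 + L * ((bndW * `|z|) * (bndV + bndV))).
  by rewrite /bndM; ring.
apply: le_trans (ler_normD _ _) _; apply: lerD; first by rewrite normrM; exact: ler_pM.
apply: le_trans (ler_normD _ _) _; apply: lerD; rewrite normrM; apply: ler_pM => //.
  by rewrite normrX ler_sqr ?nnegrE.
rewrite normrM; apply: ler_pM => //.
by apply: le_trans (ler_normD _ _) _; exact: lerD.
Qed.

(** Lipschitz constant of the scheme in time: half a second difference of step l is at most W l^2 =
    2 h W, and the reaction adds h L. *)
Definition bndC := 2 * bndW + L.

(** Averaging at distance l adds half a second difference, and l^2 = 2 h makes this h times the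
    second derivative. The two errors are the oscillations of [schW] and of the reaction over a
    distance l. *)
Lemma sch_step n x e : n.+1%:R * h <= T ->
  (forall y, `|y - x| <= l -> `|schW n y - schW n x| <= e) ->
  `|schU n.+1 x - schU n x - h * (schW n x + f (n%:R * h) (schU n x))|
    <= h * (2 * e + L * (bndV * l)).
Proof.
move=> nT He; have nT' := sch_timeS n nT; have tT := sch_time n nT'.
have l0 : 0 <= l by exact: sqrtr_ge0.
have H := second_diff_le (schU n) (schV n) (schW n) x l (schW n x) e
  (fun y => (sch_der n nT' y).1) (fun y => (sch_der n nT' y).2).
rewrite (absE l) // in H; have {H} := H He; rewrite sch_l2 => H.
have fl y : `|y - x| <= l -> `|f (n%:R * h) (schU n y) - f (n%:R * h) (schU n x)| <= L * (bndV * l).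
  move=> yx; apply: le_trans (f_lip _ _ _ tT (schU_box n nT' y) (schU_box n nT' x)) _.
  rewrite ler_wpM2l //; apply: le_trans (schU_lip n nT' x y) _.
  by rewrite ler_wpM2l ?bndV_ge0.
have := fl (x + l); have := fl (x - l); rewrite (_ : x + l - x = l); last by ring.
rewrite (_ : x - l - x = - l); last by ring.
rewrite normrN (absE l) // lexx => /(_ isT) f1' /(_ isT) f2'.
rewrite schUS /avg -/l.
move: f1' f2' H; set F := f _ (schU n x); set Fp := f _ _; set Fm := f _ _ => f1' f2' H.
rewrite (_ : _ - _ - _ = (schU n (x + l) - 2 * schU n x + schU n (x - l) - schW n x * (2 * h)) / 2
   + h * ((Fm - F + (Fp - F)) / 2)); last by field.
apply: le_trans (ler_normD _ _) _; rewrite mulrDr; apply: lerD.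
  rewrite normrM (absE 2^-1) ?invr_ge0 // ler_pdivrMr //; lra.
rewrite normrM (absE h) ?(ltW h0) // ler_wpM2l ?(ltW h0) //.
move: f1' f2'; rewrite !ler_norml; lra.
Qed.

Lemma sch_step_lip n x : n.+1%:R * h <= T -> `|schU n.+1 x - schU n x| <= h * bndC.
Proof.
move=> nT; have nT' := sch_timeS n nT; have tT := sch_time n nT'.
have H := second_diff_le (schU n) (schV n) (schW n) x l 0 bndW
  (fun y => (sch_der n nT' y).1) (fun y => (sch_der n nT' y).2).
have {H} : `|schU n (x + l) - 2 * schU n x + schU n (x - l) - 0 * l ^+ 2| <= 2 * bndW * l ^+ 2.
  by apply: H => y _; rewrite subr0; exact: schW_le.
rewrite sch_l2 mul0r subr0 => H.
have F1 := fb _ _ tT (schU_box n nT' (x + l)).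
have F2 := fb _ _ tT (schU_box n nT' (x - l)).
rewrite schUS /avg -/l; move: F1 F2 H; set Fp := f _ _; set Fm := f _ _ => F1 F2 H.
rewrite (_ : _ - _ = (schU n (x + l) - 2 * schU n x + schU n (x - l)) / 2
   + h * ((Fm + Fp) / 2)); last by field.
apply: le_trans (ler_normD _ _) _; rewrite mulrDr; apply: lerD.
  rewrite normrM (absE 2^-1) ?invr_ge0 // ler_pdivrMr //; lra.
rewrite normrM (absE h) ?(ltW h0) // ler_wpM2l ?(ltW h0) //.
move: F1 F2; rewrite !ler_norml; lra.
Qed.

Lemma telescope_le (a : nat -> R) g e n m : (n <= m)%N ->
  (forall i, (n <= i < m)%N -> `|a i.+1 - a i - h * g| <= h * e) ->
  `|a m - a n - (m%:R * h - n%:R * h) * g| <= (m%:R * h - n%:R * h) * e.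
Proof.
elim: m => [|m IH].
  by rewrite leqn0 => /eqP -> _; rewrite !subrr !mul0r subrr normr0.
rewrite leq_eqVlt => /predU1P[-> _|]; first by rewrite !subrr !mul0r subrr normr0.
rewrite ltnS => nm H.
have := IH nm (fun i => _); have := H m; rewrite nm ltnSn => /(_ isT) Hm IH'.
have {}IH' := IH' (fun i hi => H i _).
have : `|a m - a n - (m%:R * h - n%:R * h) * g| <= (m%:R * h - n%:R * h) * e.
  by apply: IH => // i /andP[ni im]; apply: H; rewrite ni (ltn_trans im).
rewrite -natr1; move: Hm; rewrite !ler_norml; lra.
Qed.

Lemma sch_time_lip n m x : (n <= m)%N -> m%:R * h <= T ->
  `|schU m x - schU n x| <= (m%:R * h - n%:R * h) * bndC.
Proof.
move=> nm mT; have H i : (n <= i < m)%N -> `|schU i.+1 x - schU i x - h * 0| <= h * bndC.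
  move=> /andP[_ im]; rewrite mulr0 subr0; apply: sch_step_lip.
  by apply: le_trans mT; rewrite ler_wpM2r ?(ltW h0) // ler_nat.
by have := telescope_le (fun k => schU k x) 0 bndC n m nm H; rewrite mulr0 subr0.
Qed.

Lemma sch_dist n m x : n%:R * h <= T -> m%:R * h <= T ->
  `|schU m x - schU n x| <= `|m%:R * h - n%:R * h| * bndC.
Proof.
wlog nm : n m / (n <= m)%N => [WL nT mT|nT mT].
  have [/WL|/ltnW/WL] := leqP n m; first exact.
  by rewrite distrC (distrC (m%:R * h)); exact.
rewrite (absE (m%:R * h - _)); first exact: sch_time_lip.
by rewrite subr_ge0 ler_wpM2r ?(ltW h0) // ler_nat.
Qed.

(* Interpolation: W is close to the second difference quotient of U at scale s,
   and U is Lipschitz in time. *)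
Lemma schW_time n m x e s : n%:R * h <= T -> m%:R * h <= T -> 0 < s ->
  (forall k y, k%:R * h <= T -> `|y - x| <= s -> `|schW k y - schW k x| <= e) ->
  4 * bndC * `|m%:R * h - n%:R * h| <= e * s ^+ 2 ->
  `|schW m x - schW n x| <= 5 * e.
Proof.
move=> nT mT s0 osc H.
have D k : k%:R * h <= T ->
    `|schU k (x + s) - 2 * schU k x + schU k (x - s) - schW k x * s ^+ 2| <= 2 * e * s ^+ 2.
  move=> kT; apply: (second_diff_le (schU k) (schV k) (schW k) x s (schW k x) e
    (fun y => (sch_der k kT y).1) (fun y => (sch_der k kT y).2)).
  by move=> z; rewrite (absE s) ?(ltW s0) //; exact: osc.
have s20 : 0 < s ^+ 2 by rewrite exprn_gt0.
rewrite -(ler_pM2r s20) -{1}(absE (s ^+ 2)) ?(ltW s20) // -normrM.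
have := D n nT; have := D m mT.
have := sch_dist n m (x + s) nT mT; have := sch_dist n m x nT mT; have := sch_dist n m (x - s) nT mT.
rewrite mulrBl; move: (schW m x * _) (schW n x * _) => Wm Wn.
move: H; move: (`|m%:R * h - _|) => d H.
rewrite !ler_norml; lra.
Qed.

Lemma sch_consistent n m x e s (tau : R) : n%:R * h <= T -> m%:R * h <= T -> 0 < s -> l <= s ->
  (forall k y, k%:R * h <= T -> `|y - x| <= s -> `|schW k y - schW k x| <= e) ->
  `|m%:R * h - n%:R * h| <= tau ->
  4 * bndC * tau <= e * s ^+ 2 -> L * (1 + bndC) * tau <= e -> L * (bndV * l) <= e ->
  `|schU m x - schU n x - (m%:R * h - n%:R * h) * (schW n x + f (n%:R * h) (schU n x))|
     <= `|m%:R * h - n%:R * h| * (9 * e).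
Proof.
move=> nT mT s0 ls osc nmt H1 H2 H3.
have bndC_ge0 : 0 <= bndC by have := bndW_ge0; rewrite /bndC; move: L0; lra.
have step i : i.+1%:R * h <= T -> `|i%:R * h - n%:R * h| <= tau ->
    `|schU i.+1 x - schU i x - h * (schW n x + f (n%:R * h) (schU n x))| <= h * (9 * e).
  move=> iT int; have iT' := sch_timeS i iT; have tn := sch_time n nT; have ti := sch_time i iT'.
  have S1 := sch_step i x e iT (fun y yl => osc i y iT' (le_trans yl ls)).
  have S2 : `|schW i x - schW n x| <= 5 * e.
    apply: (schW_time n i x e s nT iT' s0 osc); apply: le_trans H1.
    by rewrite ler_wpM2l // mulr_ge0.
  have S3 : `|f (i%:R * h) (schU i x) - f (n%:R * h) (schU n x)| <= e.
    apply: le_trans H2; rewrite -(subrKA (f (n%:R * h) (schU i x))).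
    apply: le_trans (ler_normD _ _) _.
    have -> : L * (1 + bndC) * tau = L * tau + L * (tau * bndC) by ring.
    apply: lerD.
      by apply: le_trans (ftime _ _ _ ti tn (schU_box i iT' x)) _; rewrite ler_wpM2l.
    apply: le_trans (f_lip _ _ _ tn (schU_box i iT' x) (schU_box n nT x)) _.
    rewrite ler_wpM2l //; apply: le_trans (sch_dist n i x nT iT') _.
    by rewrite ler_wpM2r.
  rewrite (_ : _ - _ - _ = (schU i.+1 x - schU i x - h * (schW i x + f (i%:R * h) (schU i x)))
     + h * ((schW i x - schW n x) + (f (i%:R * h) (schU i x) - f (n%:R * h) (schU n x)))); last by ring.
  apply: le_trans (ler_normD _ _) _.
  (* 3 e come from [sch_step], 5 e from the change of W in time, and e from the change of the
     reaction. *)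
  have -> : h * (9 * e) = h * (2 * e + e) + h * (5 * e + e) by ring.
  apply: lerD.
    by apply: le_trans S1 _; rewrite ler_wpM2l ?(ltW h0) // lerD2l.
  rewrite normrM (absE h) ?(ltW h0) // ler_wpM2l ?(ltW h0) //.
  by apply: le_trans (ler_normD _ _) _; exact: lerD.
have mono i j : (i <= j)%N -> i%:R * h <= j%:R * h by move=> ij; rewrite ler_wpM2r ?(ltW h0) // ler_nat.
(* The time derivative is two-sided, so m < n is covered as well; the base point of the expansion
   remains n. *)
have [nm|/ltnW mn] := leqP n m.
  have nm' := mono _ _ nm; rewrite (absE (m%:R * h - _)) ?subr_ge0 // in nmt *.
  apply: (telescope_le (fun k => schU k x)) => // i /andP[ni im]; apply: step.
    exact: le_trans (mono _ _ im) mT.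
  have := mono _ _ ni; have := mono _ _ (ltnW im) => ? ?; rewrite absE; lra.
have mn' := mono _ _ mn; rewrite (absNE (m%:R * h - _)) ?subr_le0 // opprB in nmt *.
rewrite -normrN (_ : - (_ - _ - _) = schU n x - schU m x -
  (n%:R * h - m%:R * h) * (schW n x + f (n%:R * h) (schU n x))); last by ring.
apply: (telescope_le (fun k => schU k x)) => // i /andP[mi im]; apply: step.
  exact: le_trans (mono _ _ im) nT.
have := mono _ _ mi; have := mono _ _ (ltnW im) => ? ?; rewrite absNE; lra.
Qed.

End Scheme.

(** A single ultrafilter makes every bounded sequence converge, so the approximations converge at
    all space-time points at once, without extraction of subsequences. *)
Lemma ultralimit_nat (R : realType) : exists G : set_system nat,
  [/\ ProperFilter G, forall J, G [set j | (J <= j)%N] &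
   forall (a : nat -> R) (M : R), G [set j | `|a j| <= M] ->
     exists c : R, forall e : R, 0 < e -> G [set j | `|a j - c| < e]].
Proof.
have [G [GU sG]] := @ultraFilterLemma _ (\oo : set_system nat) _.
exists G; split; first exact: ultra_proper.
  by move=> J; apply: sG; exists J.
move=> a M aM.
have /(_ (a @ G)) := @segment_compact R (- M) M.
have sub : G (a @^-1` `[- M, M]%classic).
  by apply: filterS aM => j /=; rewrite in_itv /= ler_norml.
move=> /(_ _ sub) [c [_ cc]]; exists c => e e0.
have [//|Hn] := in_ultra_setVsetC [set j | `|a j - c| < e] GU.
have GS : G (a @^-1` (a @` (~` [set j | `|a j - c| < e]))).
  by apply: filterS Hn => j Hj; exists j.
have [y [/= [j Hj <-]]] := cc _ _ GS (nbhsx_ballx c e e0).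
by rewrite /ball /= distrC.
Qed.

(** * Existence for the semilinear equation by an ultralimit of the scheme *)

Section Existence.
Context {R : realType}.
Implicit Types (t x y z s e a b : R) (j J n m k : nat).
Variables (f f1 f2 : R -> R -> R) (T r L : R) (u0 v0 w0 : R -> R) (V0 W0 : R).
Hypotheses (T0 : 0 <= T) (r0 : 0 <= r) (L0 : 0 <= L)
  (reg : regular_reaction f f1 f2 T r L) (dat : regular_data u0 v0 w0 r V0 W0)
  (w0uc : forall e, 0 < e -> exists2 d : R, 0 < d & forall x y, `|y - x| <= d -> `|w0 y - w0 x| <= e).

Let h j : R := j.+1%:R^-1.
Let idx j t : nat := Num.truncn (t * j.+1%:R).
Let tau j t : R := (idx j t)%:R * h j.
Let U j t x := schU f (h j) u0 (idx j t) x.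
Let V j t x := schV f f1 (h j) u0 v0 (idx j t) x.
Let W j t x := schW f f1 f2 (h j) u0 v0 w0 (idx j t) x.
Let VB := bndV T L V0.
Let WB := bndW T L V0 W0.
Let CB := bndC T L V0 W0.

Let h_gt0 j : 0 < h j. Proof. by rewrite invr_gt0. Qed.

Let h_small e : 0 < e -> exists J, forall j, (J <= j)%N -> h j < e.
Proof.
move=> e0; exists (Num.bound e^-1) => j Jj; rewrite /h -[e]invrK ltf_pV2 ?posrE ?invr_gt0 //.
apply: (lt_le_trans (archi_boundP _)); first by rewrite invr_ge0 ltW.
by rewrite ler_nat ltnW.
Qed.

Let l_small e : 0 < e -> exists J, forall j, (J <= j)%N -> Num.sqrt (2 * h j) <= e.
Proof.
move=> e0; have [|J HJ] := h_small (e ^+ 2 / 2); first by rewrite divr_gt0 // exprn_gt0.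
have E : Num.sqrt (e ^+ 2) = e by rewrite sqrtr_sqr absE // ltW.
by exists J => j /HJ hj; rewrite -E ler_wsqrtr //; lra.
Qed.

Let hL_ev : exists J, forall j, (J <= j)%N -> h j * L <= 1.
Proof.
have L1 : 0 < L + 1 by rewrite ltr_wpDl.
have [|J HJ] := h_small (L + 1)^-1; first by rewrite invr_gt0.
exists J => j /HJ hj; apply: (@le_trans _ _ ((L + 1)^-1 * (L + 1))).
  by apply: ler_pM; rewrite ?(ltW hj) ?(ltW (h_gt0 j)) // lerDl.
by rewrite mulVf // gt_eqF.
Qed.

Let tau_itv j t : 0 <= t -> tau j t <= t /\ `|tau j t - t| <= h j.
Proof.
move=> t0; have J0 : 0 < j.+1%:R :> R by [].
have /andP[] : (idx j t)%:R <= t * j.+1%:R < (idx j t).+1%:R.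
  by apply: truncn_itv; rewrite mulr_ge0.
rewrite -(ler_pdivrMr _ _ J0) -/(h j) -(ltr_pdivlMr _ _ J0) -/(h j) -natr1 mulrDl mul1r.
by rewrite -/(tau j t) => h1 h2; split=> //; rewrite absNE; lra.
Qed.

Let tauT j t : 0 <= t <= T -> tau j t <= T.
Proof. by move=> /andP[t0 tT]; apply: le_trans tT; exact: (tau_itv j t t0).1. Qed.

Let Wmod e : 0 < e -> exists2 d : R, 0 < d & forall j n x y, h j * L <= 1 -> n%:R * h j <= T ->
  `|y - x| <= d ->
  `|schW f f1 f2 (h j) u0 v0 w0 n y - schW f f1 f2 (h j) u0 v0 w0 n x| <= e.
Proof.
move=> e0; have E0 := expR_gt0 (L * T); set E := expR (L * T) in E0.
have e1 : 0 < e / 2 / E by rewrite !divr_gt0.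
have [d d0 Hd] := w0uc _ e1.
have M0 : 0 <= bndM T L V0 W0 := bndM_ge0 u0 v0 w0 T r L V0 W0 T0 L0 dat.
set M := bndM _ _ _ _ in M0.
have D0 : 0 < (T * M + 1) * E by rewrite mulr_gt0 // ltr_wpDl // mulr_ge0.
(* Half of e serves the initial modulus and half the error linear in |y - x|, each divided by the
   growth factor. *)
exists (Num.min d (e / 2 / ((T * M + 1) * E))).
  by rewrite lt_min d0 divr_gt0 // divr_gt0.
move=> j n x y hL nT; rewrite le_min => /andP[yd ye].
have Hz z : `|w0 (z + (y - x)) - w0 z| <= e / 2 / E.
  by apply: Hd; rewrite addrC addKr.
have := schW_mod f f1 f2 (h j) u0 v0 w0 T r L V0 W0 T0 r0 L0 (h_gt0 j) hL reg dat n (y - x)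
  _ nT (ltW e1) Hz x.
rewrite [x + (y - x)]addrC subrK; move/le_trans; apply; rewrite -/M -/E mulrDl divfK ?gt_eqF //.
suff : T * (M * `|y - x|) * E <= e / 2 by lra.
move: ye; rewrite ler_pdivlMr // => ye; apply: le_trans ye.
have := normr_ge0 (y - x); move: (`|y - x|) => z z0.
have : 0 <= z * E by rewrite mulr_ge0 // ltW.
by lra.
Qed.

Let G := sval (cid (ultralimit_nat R)).
Let GF : ProperFilter G. Proof. by rewrite /G; case: cid => g []. Qed.
Let GI A B : G A -> G B -> G (A `&` B). Proof. exact: (@filterI _ G (@filter_filter _ _ GF)). Qed.
Let Gtail J : G [set j | (J <= j)%N].
Proof. by rewrite /G; case: cid => g /= [_ + _]; exact. Qed.
Let Gcvg (a : nat -> R) (M : R) : (exists J, forall j, (J <= j)%N -> `|a j| <= M) ->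
  exists c : R, forall e, 0 < e -> G [set j | `|a j - c| < e].
Proof.
move=> [J HJ]; rewrite /G; case: cid => g /= [gF gt gc]; apply: (gc a M).
by apply: filterS (gt J).
Qed.

(** The default 0 matters only where the limit does not exist; for 0 <= t <= T the uniform bounds
    provide it. *)
Let u t x : R := xget 0 [set c | forall e, 0 < e -> G [set j | `|U j t x - c| < e]].
Let v t x : R := xget 0 [set c | forall e, 0 < e -> G [set j | `|V j t x - c| < e]].
Let w t x : R := xget 0 [set c | forall e, 0 < e -> G [set j | `|W j t x - c| < e]].

Let U_le j t x : h j * L <= 1 -> 0 <= t <= T -> `|U j t x| <= r.
Proof. by move=> hL tT; apply: (schU_box f f1 f2 (h j) u0 v0 w0 T r L V0 W0) => //; exact: tauT. Qed.
Let V_le j t x : h j * L <= 1 -> 0 <= t <= T -> `|V j t x| <= VB.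
Proof. by move=> hL tT; apply: (schV_le f f1 f2 (h j) u0 v0 w0 T r L V0 W0) => //; exact: tauT. Qed.
Let W_le j t x : h j * L <= 1 -> 0 <= t <= T -> `|W j t x| <= WB.
Proof. by move=> hL tT; apply: (schW_le f f1 f2 (h j) u0 v0 w0 T r L V0 W0) => //; exact: tauT. Qed.

Let u_lim t x e : 0 <= t <= T -> 0 < e -> G [set j | `|U j t x - u t x| < e].
Proof.
move=> tT e0; have [|c Pc] := Gcvg (fun j => U j t x) r.
  by have [J HJ] := hL_ev; exists J => j /HJ hL; exact: U_le.
exact: (@xgetI _ 0 [set c | forall e, 0 < e -> G [set j | `|U j t x - c| < e]] c Pc e e0).
Qed.
Let v_lim t x e : 0 <= t <= T -> 0 < e -> G [set j | `|V j t x - v t x| < e].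
Proof.
move=> tT e0; have [|c Pc] := Gcvg (fun j => V j t x) VB.
  by have [J HJ] := hL_ev; exists J => j /HJ hL; exact: V_le.
exact: (@xgetI _ 0 [set c | forall e, 0 < e -> G [set j | `|V j t x - c| < e]] c Pc e e0).
Qed.
Let w_lim t x e : 0 <= t <= T -> 0 < e -> G [set j | `|W j t x - w t x| < e].
Proof.
move=> tT e0; have [|c Pc] := Gcvg (fun j => W j t x) WB.
  by have [J HJ] := hL_ev; exists J => j /HJ hL; exact: W_le.
exact: (@xgetI _ 0 [set c | forall e, 0 < e -> G [set j | `|W j t x - c| < e]] c Pc e e0).
Qed.

(** Each property of the limit involves at most two space-time points, so one late index that is
    accurate there for U, V and W is enough. *)
Let pickj t x s y e J : 0 <= t <= T -> 0 <= s <= T -> 0 < e -> exists j,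
  [/\ (J <= j)%N, h j * L <= 1, `|U j t x - u t x| < e /\ `|U j s y - u s y| < e,
      `|V j t x - v t x| < e /\ `|V j s y - v s y| < e &
      `|W j t x - w t x| < e /\ `|W j s y - w s y| < e].
Proof.
move=> tT sT e0; have [J' HJ'] := hL_ev.
have A := GI _ _ (Gtail J) (Gtail J').
have {}A := GI _ _ A (GI _ _ (u_lim t x e tT e0) (u_lim s y e sT e0)).
have {}A := GI _ _ A (GI _ _ (v_lim t x e tT e0) (v_lim s y e sT e0)).
have {}A := GI _ _ A (GI _ _ (w_lim t x e tT e0) (w_lim s y e sT e0)).
have [j [[[[Jj J'j] [a1 a2]] [b1 b2]] [c1 c2]]] := @filter_ex _ G GF _ A.
by exists j; split=> //; exact: HJ'.
Qed.

Let u_le t x : 0 <= t <= T -> `|u t x| <= r.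
Proof.
move=> tT; apply/ler_addgt0Pr => e e0.
have [j [_ hL [a _] _ _]] := pickj t x t x e 0%N tT tT e0.
by have := U_le j t x hL tT; move: a; rewrite ltr_norml !ler_norml; lra.
Qed.
Let v_le t x : 0 <= t <= T -> `|v t x| <= VB.
Proof.
move=> tT; apply/ler_addgt0Pr => e e0.
have [j [_ hL _ [a _] _]] := pickj t x t x e 0%N tT tT e0.
by have := V_le j t x hL tT; move: a; rewrite ltr_norml !ler_norml; lra.
Qed.
Let w_le t x : 0 <= t <= T -> `|w t x| <= WB.
Proof.
move=> tT; apply/ler_addgt0Pr => e e0.
have [j [_ hL _ _ [a _]]] := pickj t x t x e 0%N tT tT e0.
by have := W_le j t x hL tT; move: a; rewrite ltr_norml !ler_norml; lra.
Qed.

Let w_uc e : 0 < e -> exists2 d : R, 0 < d & forall t x y, 0 <= t <= T -> `|y - x| <= d ->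
  `|w t y - w t x| <= e.
Proof.
move=> e0; have [d d0 Hd] := Wmod e e0; exists d => // t x y tT yx.
apply/ler_addgt0Pr => eta eta0; have eta2 : 0 < eta / 2 by lra.
have [j [_ hL _ _ [a b]]] := pickj t x t y _ 0%N tT tT eta2.
have := Hd j (idx j t) x y hL (tauT j t tT) yx; rewrite -/(W j t x) -/(W j t y).
by move: a b; rewrite !ltr_norml !ler_norml; lra.
Qed.

Let sder j n x : h j * L <= 1 -> n%:R * h j <= T ->
  is_derive x 1 (schU f (h j) u0 n) (schV f f1 (h j) u0 v0 n x) /\
  is_derive x 1 (schV f f1 (h j) u0 v0 n) (schW f f1 f2 (h j) u0 v0 w0 n x).
Proof. by move=> hL nT; apply: (sch_der f f1 f2 (h j) u0 v0 w0 T r L V0 W0). Qed.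

(** The scheme satisfies the inequality of [is_deriveP] with a radius independent of j; for a fixed
    y the passage to the limit costs an arbitrary eta. *)
Let u_der t x : 0 <= t <= T -> is_derive x 1 (u t) (v t x).
Proof.
move=> tT; apply/is_deriveP => e e0.
have WB0 : 0 <= WB by apply: le_trans (w_le t x tT).
exists (e / (WB + 1)); first by rewrite divr_gt0 // ltr_wpDl.
move=> y yx; apply/ler_addgt0Pr => eta eta0.
(* [c] splits eta among three errors: two values of U, and one value of V multiplied by |y - x|. *)
pose c := 2 + `|y - x|; have c0 : 0 < c by rewrite ltr_pwDl.
have [j [_ hL [a1 a2] [b1 _] _]] := pickj t x t y (eta / c) 0%N tT tT (divr_gt0 eta0 c0).
have [z zb E] := MVT_btw (schU f (h j) u0 (idx j t)) (schV f f1 (h j) u0 v0 (idx j t)) x y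
  (fun z _ => (sder j (idx j t) z hL (tauT j t tT)).1).
have Vl : `|V j t z - V j t x| <= WB * `|z - x|.
  by apply: (schV_lip f f1 f2 (h j) u0 v0 w0 T r L V0 W0) => //; exact: tauT.
have zx := btw_dist _ _ _ zb.
rewrite -/(U j t x) -/(U j t y) -/(V j t z) in E.
have H : `|U j t y - U j t x - V j t x * (y - x)| <= e * `|y - x|.
  rewrite E -mulrBl normrM ler_wpM2r //; apply: le_trans Vl _.
  move: yx; rewrite ltr_pdivlMr ?ltr_wpDl // => yx.
  by have := ler_wpM2l WB0 zx; have := normr_ge0 (y - x); lra.
rewrite (_ : u t y - u t x - v t x * (y - x) = (U j t y - U j t x - V j t x * (y - x))
  + (- (U j t y - u t y) + (U j t x - u t x) + (V j t x - v t x) * (y - x))); last by ring.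
apply: le_trans (ler_normD _ _) _; apply: lerD => //.
have -> : eta = eta / c + eta / c + eta / c * `|y - x| by rewrite /c; field; rewrite gt_eqF.
apply: le_trans (ler_normD _ _) _; apply: lerD; last by rewrite normrM ler_wpM2r // ltW.
by apply: le_trans (ler_normD _ _) _; rewrite normrN; apply: lerD; exact: ltW.
Qed.

Let v_der t x : 0 <= t <= T -> is_derive x 1 (v t) (w t x).
Proof.
move=> tT; apply/is_deriveP => e e0; have [d d0 Hd] := Wmod e e0.
exists d => // y yx; apply/ler_addgt0Pr => eta eta0.
pose c := 2 + `|y - x|; have c0 : 0 < c by rewrite ltr_pwDl.
have [j [_ hL _ [a1 a2] [b1 _]]] := pickj t x t y (eta / c) 0%N tT tT (divr_gt0 eta0 c0).
have [z zb E] := MVT_btw (schV f f1 (h j) u0 v0 (idx j t)) (schW f f1 f2 (h j) u0 v0 w0 (idx j t)) x y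
  (fun z _ => (sder j (idx j t) z hL (tauT j t tT)).2).
have zx := btw_dist _ _ _ zb.
have Wl := Hd j (idx j t) x z hL (tauT j t tT) (le_trans zx (ltW yx)).
rewrite -/(V j t x) -/(V j t y) -/(W j t z) in E.
have H : `|V j t y - V j t x - W j t x * (y - x)| <= e * `|y - x|.
  by rewrite E -mulrBl normrM ler_wpM2r.
rewrite (_ : v t y - v t x - w t x * (y - x) = (V j t y - V j t x - W j t x * (y - x))
  + (- (V j t y - v t y) + (V j t x - v t x) + (W j t x - w t x) * (y - x))); last by ring.
apply: le_trans (ler_normD _ _) _; apply: lerD => //.
have -> : eta = eta / c + eta / c + eta / c * `|y - x| by rewrite /c; field; rewrite gt_eqF.
apply: le_trans (ler_normD _ _) _; apply: lerD; last by rewrite normrM ler_wpM2r // ltW.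
by apply: le_trans (ler_normD _ _) _; rewrite normrN; apply: lerD; exact: ltW.
Qed.

Let CB0 : 0 <= CB.
Proof. by have := bndW_ge0 u0 v0 w0 T r L V0 W0 T0 L0 dat; rewrite /CB /bndC; move: L0; lra. Qed.

Let u_time t s x : 0 <= t <= T -> 0 <= s <= T -> `|u s x - u t x| <= CB * `|s - t|.
Proof.
move=> tT sT; apply/ler_addgt0Pr => eta eta0.
have C1 : 0 < CB + 1 by rewrite ltr_wpDl.
pose eta1 := eta / (2 * (CB + 1)); have eta10 : 0 < eta1 by rewrite divr_gt0 // mulr_gt0.
have etaE : eta = 2 * eta1 + 2 * CB * eta1 by rewrite /eta1; field; rewrite gt_eqF.
have [J HJ] := h_small eta1 eta10.
have [j [/HJ hj hL [a1 a2] _ _]] := pickj t x s x eta1 J tT sT eta10.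
have H : `|U j s x - U j t x| <= `|tau j s - tau j t| * CB.
  by apply: (sch_dist f f1 f2 (h j) u0 v0 w0 T r L V0 W0) => //; exact: tauT.
have t0 : 0 <= t by case/andP: tT. have s0 : 0 <= s by case/andP: sT.
have [_ k1] := tau_itv j t t0; have [_ k2] := tau_itv j s s0.
have : `|tau j s - tau j t| <= `|s - t| + 2 * eta1.
  rewrite (_ : tau j s - tau j t = (s - t) + ((tau j s - s) - (tau j t - t))); last by ring.
  apply: le_trans (ler_normD _ _) _; rewrite lerD2l.
  by apply: le_trans (ler_normB _ _) _; lra.
move/(ler_wpM2l CB0) => H2.
rewrite (_ : u s x - u t x = (U j s x - U j t x) + ((U j t x - u t x) - (U j s x - u s x))); last by ring.
apply: le_trans (ler_normD _ _) _; have := ler_normB (U j t x - u t x) (U j s x - u s x); lra.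
Qed.

Let u_eq t x : 0 < t < T -> is_derive t 1 (fun s => u s x) (w t x + f t (u t x)).
Proof.
move=> tT; have tT' : 0 <= t <= T by lra.
apply/is_deriveP => e e0.
have e9 : 0 < e / 9 by lra.
have [s s0 Hs] := Wmod _ e9.
(* The two smallness conditions of [sch_consistent] on the time span: one controls the change of W,
   the other that of the reaction. The 9 is the factor lost there. *)
pose tau0 := Num.min (e / 9 * s ^+ 2 / (4 * CB + 1)) (e / 9 / (L * (1 + CB) + 1)).
have C41 : 0 < 4 * CB + 1 by rewrite ltr_wpDl // mulr_ge0.
have L41 : 0 < L * (1 + CB) + 1 by rewrite ltr_wpDl // mulr_ge0 // addr_ge0.
have tau00 : 0 < tau0 by rewrite lt_min !divr_gt0 // mulr_gt0 // exprn_gt0.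
have T1 : 4 * CB * tau0 <= e / 9 * s ^+ 2.
  have : tau0 <= e / 9 * s ^+ 2 / (4 * CB + 1) by rewrite ge_min lexx.
  by rewrite ler_pdivlMr //; lra.
have T2 : L * (1 + CB) * tau0 <= e / 9.
  have : tau0 <= e / 9 / (L * (1 + CB) + 1) by rewrite ge_min lexx orbT.
  by rewrite ler_pdivlMr //; lra.
have [d [d0 dt dT dtau]] : exists d : R, [/\ 0 < d, d <= t, d <= T - t & d <= tau0 / 2].
  exists (Num.min (tau0 / 2) (Num.min t (T - t))).
  by rewrite !lt_min !ge_min !lexx !orbT; split=> //; lra.
exists d => // y yt.
have yT : 0 <= y <= T by move: yt; rewrite ltr_norml; lra.
apply/ler_addgt0Pr => eta eta0.
have VB0 : 0 <= VB by apply: le_trans (v_le t x tT').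
have WB0 : 0 <= WB by apply: le_trans (w_le t x tT').
(* [c] collects the coefficients of eta1 in the final estimate: two values of U, the rounding of the
   times in the consistency error and in front of the drift, and the error of the drift over a time
   at most T. *)
pose c := 2 + 2 * e + 2 * (WB + L) + T * (1 + 2 * L).
have c0 : 0 < c by rewrite /c; have := T0; have := L0; nra.
have ec0 : 0 < eta / c by rewrite divr_gt0.
(* Rounding moves each time by at most eta1, so eta1 <= tau0 / 4 and d <= tau0 / 2 keep the two
   discrete times within tau0 of each other. *)
pose eta1 := Num.min (eta / c) (tau0 / 4).
have eta10 : 0 < eta1 by rewrite lt_min ec0; lra.
have eta1t : eta1 <= tau0 / 4 by rewrite ge_min lexx orbT.
have eta1c : c * eta1 <= eta by rewrite mulrC -ler_pdivlMr // ge_min lexx.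
have [J1 HJ1] := h_small eta1 eta10.
have [J2 HJ2] := l_small s s0.
have LV : 0 < L * VB + 1 by rewrite ltr_wpDl // mulr_ge0.
have [J3 HJ3] := l_small (e / 9 / (L * VB + 1)) (divr_gt0 e9 LV).
have [j [Jj hL [a1 a2] _ [b1 _]]] := pickj t x y x eta1 (maxn J1 (maxn J2 J3)) tT' yT eta10.
move: Jj; rewrite !geq_max => /andP[/HJ1 hj /andP[/HJ2 lj /HJ3 lj']].
have t0 : 0 <= t by lra. have y0 : 0 <= y by lra.
have [_ k1] := tau_itv j t t0; have [_ k2] := tau_itv j y y0.
have D : `|(tau j y - tau j t) - (y - t)| <= 2 * eta1.
  rewrite (_ : _ - _ - _ = (tau j y - y) - (tau j t - t)); last by ring.
  by apply: le_trans (ler_normB _ _) _; lra.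
have Dt : `|tau j y - tau j t| <= `|y - t| + 2 * eta1.
  rewrite (_ : tau j y - tau j t = (y - t) + ((tau j y - tau j t) - (y - t))); last by ring.
  by apply: le_trans (ler_normD _ _) _; rewrite lerD2l.
have T3 : L * (VB * Num.sqrt (2 * h j)) <= e / 9.
  move: lj'; rewrite ler_pdivlMr // => lj'; apply: le_trans lj'.
  by have := sqrtr_ge0 (2 * h j); lra.
have Dt0 : `|tau j y - tau j t| <= tau0 by lra.
have H := sch_consistent f f1 f2 (h j) u0 v0 w0 T r L V0 W0 T0 r0 L0 (h_gt0 j) hL reg dat
  (idx j t) (idx j y) x (e / 9) s tau0 (tauT j t tT') (tauT j y yT) s0 lj
  (fun k z kT zx => Hs j k x z hL kT zx) Dt0 T1 T2 T3.
rewrite -/(tau j t) -/(tau j y) -/(U j t x) -/(U j y x) -/(W j t x) in H.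
have E9 : 9 * (e / 9) = e by field.
rewrite E9 in H.
have tjT : 0 <= tau j t <= T by rewrite tauT // andbT mulr_ge0 // ltW.
have F1 : `|f (tau j t) (U j t x) - f t (u t x)| <= 2 * L * eta1.
  rewrite -(subrKA (f (tau j t) (u t x))).
  apply: le_trans (ler_normD _ _) _.
  have q1 : `|f (tau j t) (U j t x) - f (tau j t) (u t x)| <= L * eta1.
    apply: le_trans (f_lip f f1 f2 T r L reg _ _ _ tjT (U_le j t x hL tT') (u_le t x tT')) _.
    by rewrite ler_wpM2l // ltW.
  have q2 : `|f (tau j t) (u t x) - f t (u t x)| <= L * eta1.
    apply: le_trans (rr_time _ _ _ _ _ _ reg _ _ _ tjT tT' (u_le t x tT')) _.
    by rewrite ler_wpM2l //; lra.
  by rewrite -mulrA mulr_natl mulr2n; exact: lerD.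
have F2 : `|w t x + f t (u t x)| <= WB + L.
  apply: le_trans (ler_normD _ _) _; apply: lerD; first exact: w_le.
  exact: (rr_b _ _ _ _ _ _ reg _ _ tT' (u_le t x tT')).
have F3 : `|tau j y - tau j t| <= T.
  have tyT : 0 <= tau j y <= T by rewrite tauT // andbT mulr_ge0 // ltW.
  by rewrite ler_norml; lra.
rewrite (_ : u y x - u t x - (w t x + f t (u t x)) * (y - t) =
  (U j y x - U j t x - (tau j y - tau j t) * (W j t x + f (tau j t) (U j t x)))
  + ((U j t x - u t x) - (U j y x - u y x)
  + ((tau j y - tau j t) * ((W j t x - w t x) + (f (tau j t) (U j t x) - f t (u t x)))
  + ((tau j y - tau j t) - (y - t)) * (w t x + f t (u t x))))); last by ring.
apply: (@le_trans _ _ (e * (`|y - t| + 2 * eta1) + (2 * eta1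
   + (T * (eta1 + 2 * L * eta1) + 2 * eta1 * (WB + L))))); last first.
  by move: eta1c; rewrite /c; lra.
apply: le_trans (ler_normD _ _) _; apply: lerD.
  by apply: le_trans H _; rewrite mulrC ler_wpM2l // ltW.
apply: le_trans (ler_normD _ _) _; apply: lerD.
  by apply: le_trans (ler_normB _ _) _; lra.
apply: le_trans (ler_normD _ _) _; apply: lerD; rewrite normrM; apply: ler_pM => //.
by apply: le_trans (ler_normD _ _) _; apply: lerD => //; exact: ltW.
Qed.

Lemma semilinear_existence : exists u ux uxx : R -> R -> R,
  [/\ classical_sol f T u ux uxx, u 0 = u0, forall t x, 0 <= t <= T -> `|u t x| <= r,
   exists M : R, forall t x, 0 <= t <= T -> `|ux t x| <= M /\ `|uxx t x| <= M &
   forall e, 0 < e -> exists2 d : R, 0 < d & forall t x y, 0 <= t <= T -> `|y - x| <= d ->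
     `|uxx t y - uxx t x| <= e].
Proof.
exists u, v, w; split.
- split=> [t x|t x|t tT e e0|t x]; [exact: u_der|exact: v_der| |exact: u_eq].
  have C1 : 0 < CB + 1 by rewrite ltr_wpDl.
  exists (e / (CB + 1)); first by rewrite divr_gt0.
  move=> s sT st x; apply: le_trans (u_time t s x tT sT) _.
  by move: st; rewrite ltr_pdivlMr //; have := normr_ge0 (s - t); lra.
- apply/funext => x; apply/eqP; rewrite -subr_eq0 -normr_le0; apply/ler_addgt0Pr => e e0.
  have T00 : 0 <= (0 : R) <= T by rewrite lexx.
  have [j [_ _ [+ _] _ _]] := pickj 0 x 0 x e 0%N T00 T00 e0.
  by rewrite /U /idx mul0r truncn0 /= distrC add0r => /ltW.
- exact: u_le.
- exists (VB + WB) => t x tT; have := v_le t x tT; have := w_le t x tT.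
  by have := normr_ge0 (v t x); have := normr_ge0 (w t x); split; lra.
- exact: w_uc.
Qed.

End Existence.

(** * Third-order Taylor estimates *)

Section Taylor.
Context {R : realType}.
Implicit Types (x y z c e C : R).

(** [c] is any constant that approximates [g3] up to e: its value at the centre in one use, 0 in
    another. Three Lipschitz estimates replace integration, whence e and not e / 6. *)
Lemma taylor3 (g g1 g2 g3 : R -> R) x y c e :
  (forall z, `|z - x| <= `|y| -> is_derive z 1 g (g1 z)) ->
  (forall z, `|z - x| <= `|y| -> is_derive z 1 g1 (g2 z)) ->
  (forall z, `|z - x| <= `|y| -> is_derive z 1 g2 (g3 z)) ->
  (forall z, `|z - x| <= `|y| -> `|g3 z - c| <= e) ->
  `|g (x + y) - (g x + g1 x * y + g2 x / 2 * y ^+ 2 + c / 6 * y ^+ 3)| <= e * `|y| ^+ 3.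
Proof.
move=> d1 d2 d3 b3.
have btw z w : `|z - x| <= `|y| -> Num.min x z <= w <= Num.max x z ->
    `|w - x| <= `|z - x| /\ `|w - x| <= `|y|.
  by move=> zy /btw_dist wz; split=> //; exact: le_trans zy.
pose p2 z := g2 z - (g2 x + c * (z - x)).
pose p1 z := g1 z - (g1 x + g2 x * (z - x) + c / 2 * (z - x) ^+ 2).
pose p0 z := g z - (g x + g1 x * (z - x) + g2 x / 2 * (z - x) ^+ 2 + c / 6 * (z - x) ^+ 3).
have did z : is_derive z 1 (fun z => z - x) 1.
  by apply: (derE (derB (der_id z) (der_cst x z))); rewrite subr0.
have B2 z : `|z - x| <= `|y| -> `|p2 z| <= e * `|z - x|.
  move=> zy; have -> : p2 z = p2 z - p2 x by rewrite /p2 subrr mulr0 addr0 subrr subr0.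
  apply: (der_lip p2 (fun w => g3 w - c)) => w /(btw z w zy) [_ wy]; last exact: b3.
  apply: (derE (derB (d3 w wy) (derD (der_cst (g2 x) w) (derZ c (did w))))).
  by rewrite add0r mulr1.
have B1 z : `|z - x| <= `|y| -> `|p1 z| <= e * `|z - x| ^+ 2.
  move=> zy; have -> : p1 z = p1 z - p1 x by rewrite /p1 subrr expr0n /= !mulr0 !addr0 subrr subr0.
  rewrite expr2 mulrA; apply: (der_lip p1 p2) => w /(btw z w zy) [wz wy].
    apply: (derE (derB (d2 w wy) (derD (derD (der_cst (g1 x) w) (derZ (g2 x) (did w)))
      (derZ (c / 2) (derX 2 (did w)))))).
    by rewrite /p2 /= expr1; field.
  apply: le_trans (B2 w wy) _; rewrite ler_wpM2l //.
  by apply: le_trans (b3 x _); rewrite ?subrr ?normr0.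
have e0 : 0 <= e by apply: le_trans (b3 x _); rewrite ?subrr ?normr0.
have yy : `|x + y - x| = `|y| by congr `|_|; ring.
have yyl : `|x + y - x| <= `|y| by rewrite yy.
have -> : g (x + y) - (g x + g1 x * y + g2 x / 2 * y ^+ 2 + c / 6 * y ^+ 3) = p0 (x + y) - p0 x.
  rewrite /p0 subrr !expr0n /= !mulr0 !addr0 subrr subr0 (_ : x + y - x = y) //; ring.
rewrite exprSr mulrA -[X in _ * X]yy; apply: (der_lip p0 p1) => w.
  move=> /(btw _ w yyl) [wz wy].
  apply: (derE (derB (d1 w wy) (derD (derD (derD (der_cst (g x) w) (derZ (g1 x) (did w)))
    (derZ (g2 x / 2) (derX 2 (did w)))) (derZ (c / 6) (derX 3 (did w)))))).
  by rewrite /p1 /= expr1; field.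
move=> /(btw _ w yyl) [wz wy]; apply: le_trans (B1 w wy) _; rewrite ler_wpM2l // ler_sqr ?nnegrE //.
Qed.

(* The third symmetric difference of g at scale s is 2 g'''(0) s^3 + o(s^3). *)
Lemma der3_eq0 (g g1 g2 g3 : R -> R) (d : R) C : 0 < d ->
  (forall z, `|z| < d -> is_derive z 1 g (g1 z)) ->
  (forall z, `|z| < d -> is_derive z 1 g1 (g2 z)) ->
  (forall z, `|z| < d -> is_derive z 1 g2 (g3 z)) ->
  {for 0, continuous g3} -> (forall z, `|z| < d -> `|g z| <= C * z ^+ 4) -> g3 0 = 0.
Proof.
move=> d0 d1 d2 d3 g3c gC.
have C0 : 0 <= C.
  have := gC (d / 2); rewrite (absE (d / 2)); last lra.
  have -> : d / 2 < d by lra.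
  move=> /(_ isT) /(le_trans (normr_ge0 _)); rewrite pmulr_lge0 // exprn_gt0 //; lra.
apply/eqP; rewrite -normr_le0; apply/ler_addgt0Pr => e e0; rewrite add0r.
have e20 : 0 < e / 20 by lra.
have /cvgrPdist_lt /(_ _ e20) /nbhs_ballP[r /= r0 Hr] := g3c.
(* With this s the fourth-order bound adds at most e / 20 to the relative error, as much as the
   oscillation of [g3]; d / 4 and r / 4 leave room for the points at distance 2 s. *)
pose s := Num.min (d / 4) (Num.min (r / 4) (e / (40 * (C + 1)))).
have C1 : 0 < 40 * (C + 1) by rewrite mulr_gt0 // ltr_wpDl.
have [s0 sd sr sC] : [/\ 0 < s, s <= d / 4, s <= r / 4 & s <= e / (40 * (C + 1))].
  by rewrite /s !lt_min !ge_min !lexx !orbT !divr_gt0.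
have H y : `|y| <= 2 * s ->
    `|g1 0 * y + g2 0 / 2 * y ^+ 2 + g3 0 / 6 * y ^+ 3 + g 0| <= (e / 20 + 2 * C * s) * `|y| ^+ 3.
  move=> ys.
  have loc z : `|z - 0| <= `|y| -> `|z| < d /\ `|z| < r by rewrite subr0; lra.
  have := taylor3 g g1 g2 g3 0 y (g3 0) (e / 20) (fun z h => d1 z (loc z h).1)
    (fun z h => d2 z (loc z h).1) (fun z h => d3 z (loc z h).1).
  have b3 z : `|z - 0| <= `|y| -> `|g3 z - g3 0| <= e / 20.
    move=> h; rewrite ltW // distrC; apply: Hr; rewrite /ball /= sub0r normrN.
    by case: (loc z h).
  move=> /(_ b3); rewrite add0r => T3.
  have yd : `|y| < d by lra.
  have := gC y yd; have -> : y ^+ 4 = `|y| ^+ 4 by rewrite -normrX ger0_norm // exprn_even_ge0.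
  rewrite exprS => G4; rewrite mulrDl.
  have G5 : C * (`|y| * `|y| ^+ 3) <= 2 * C * s * `|y| ^+ 3.
    rewrite mulrA ler_wpM2r ?exprn_ge0 //.
    by have := ler_wpM2l C0 ys; lra.
  move: T3 G4 G5; rewrite !ler_norml; lra.
have s20 : 0 <= s by lra.
have s3 : 0 < s ^+ 3 by rewrite exprn_gt0.
have e1 : `|s| = s by rewrite absE.
have e2 : `|2 * s| = 2 * s by rewrite absE // mulr_ge0.
(* In g(2s) - 2 g(s) + 2 g(-s) - g(-2s) all Taylor terms cancel except 2 g3(0) s^3. The errors have
   weights 8 + 2 + 2 + 8 = 20, so they amount to 2 e s^3. *)
have := H (2 * s); have := H (- (2 * s)); have := H s; have := H (- s).
rewrite !normrN e1 e2 lexx; have -> : s <= 2 * s by lra.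
move=> /(_ isT) a1 /(_ isT) a2 /(_ isT) a3 /(_ isT) a4.
have sC' : 40 * C * s <= e.
  move: sC; rewrite ler_pdivlMr //; have := s0; lra.
rewrite -(ler_pM2r s3) -{1}(absE (s ^+ 3)) ?(ltW s3) // -normrM.
move: a1 a2 a3 a4; rewrite !ler_norml.
have X1 : (e / 20 + 2 * C * s) * s ^+ 3 <= e / 10 * s ^+ 3 by rewrite ler_wpM2r ?(ltW s3) //; lra.
by lra.
Qed.

End Taylor.

(** The remainder on a cube about the origin, as it is used later. The decisive field is [lr_small]:
    thanks to the factor 1 / 100 the slope of the reaction is mu - 3 u^2 up to one percent, and the
    large constant multiplies eps only. *)
Record local_remainder {R : realType} (rem R1 R2 : R -> R -> R -> R) (r K : R) : Prop := {
  lr_d1 : forall u mu eps : R, `|u| <= r -> `|mu| <= r -> `|eps| <= r ->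
    is_derive u 1 (fun u => rem u mu eps) (R1 u mu eps);
  lr_d2 : forall u mu eps : R, `|u| <= r -> `|mu| <= r -> `|eps| <= r ->
    is_derive u 1 (fun u => R1 u mu eps) (R2 u mu eps);
  lr_b2 : forall u mu eps : R, `|u| <= r -> `|mu| <= r -> `|eps| <= r -> `|R2 u mu eps| <= K;
  lr_lip2 : forall u v mu eps : R, `|u| <= r -> `|v| <= r -> `|mu| <= r -> `|eps| <= r ->
    `|R2 u mu eps - R2 v mu eps| <= K * `|u - v|;
  lr_mu : forall u mu nu eps : R, `|u| <= r -> `|mu| <= r -> `|nu| <= r -> `|eps| <= r ->
    `|rem u mu eps - rem u nu eps| <= K * `|mu - nu|;
  lr_order : forall u mu eps : R, `|u| <= r -> `|mu| <= r -> `|eps| <= r ->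
    `|rem u mu eps| <= K * (`|u| ^+ 4 + `|u| ^+ 2 * `|mu| + `|u| * `|mu| ^+ 2
       + `|u| * `|eps| + `|mu| * `|eps| + `|eps| ^+ 2);
  lr_small : forall u mu eps : R, `|u| <= r -> `|mu| <= r -> `|eps| <= r ->
    `|R1 u mu eps| <= (`|mu| + u ^+ 2) / 100 + K * `|eps| }.

(** * Local estimates for the remainder *)

Section LocalRemainder.
Context {R : realType}.

Lemma partial_line (F : R * R * R -> R) (p v : R * R * R) (g : R -> R) (x : R) :
  (forall h : R, F (h *: v + p) = g (h + x)) -> derivable F p v -> is_derive x 1 g ('D_v F p).
Proof.
move=> Fg Fd.
have E : (fun h : R => h^-1 *: ((F \o shift p) (h *: v) - F p)) =
         (fun h => h^-1 *: ((g \o shift x) (h *: 1) - g x)).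
  apply/funext => h /=; rewrite Fg [h *: 1]mulr1.
  by have := Fg 0; rewrite scale0r !add0r => ->.
by split; [move: Fd; rewrite /derivable E|rewrite /derive E].
Qed.

(** In g(x + s) - g(x - s) the even Taylor terms cancel, so the first derivative is controlled by
    the sizes of [g] and [g3], whatever the size of [g2]. *)
Lemma central_difference (g g1 g2 g3 : R -> R) (x s e M : R) : 0 < s ->
  (forall z, `|z - x| <= s -> is_derive z 1 g (g1 z)) ->
  (forall z, `|z - x| <= s -> is_derive z 1 g1 (g2 z)) ->
  (forall z, `|z - x| <= s -> is_derive z 1 g2 (g3 z)) ->
  (forall z, `|z - x| <= s -> `|g3 z| <= e) -> (forall z, `|z - x| <= s -> `|g z| <= M) ->
  `|g1 x| <= M / s + e * s ^+ 2.
Proof.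
move=> s0 d1 d2 d3 b3 gM.
have sE : `|s| = s by rewrite absE ?ltW.
have T (y : R) : `|y| = s -> `|g (x + y) - (g x + g1 x * y + g2 x / 2 * y ^+ 2 + 0 / 6 * y ^+ 3)|
    <= e * s ^+ 3.
  move=> ys; rewrite -[in X in _ <= X]ys; apply: (taylor3 g g1 g2 g3 x y 0 e); rewrite ys //.
  by move=> z zs; rewrite subr0; exact: b3.
have := T s sE; have := T (- s); rewrite normrN => /(_ sE).
have h1 : `|x + s - x| <= s by rewrite (_ : x + s - x = s) ?sE //; ring.
have h2 : `|x - s - x| <= s by rewrite (_ : x - s - x = - s) ?normrN ?sE //; ring.
have := gM _ h1; have := gM _ h2.
have MsE : M / s * s = M by rewrite divfK // gt_eqF.
move=> a1 a2 a3 a4.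
have H : `|g1 x * s| <= (M / s + e * s ^+ 2) * s.
  by rewrite (mulrDl (M / s)) MsE; move: a1 a2 a3 a4; rewrite !ler_norml; lra.
by move: H; rewrite normrM sE ler_pM2r.
Qed.

Lemma sum3_le (a b c : R) : 0 <= a -> 0 <= b -> 0 <= c ->
  [/\ a <= a + b + c, b <= a + b + c & c <= a + b + c].
Proof. by move=> a0 b0 c0; split; lra. Qed.

Lemma abs_le_near (a b : R) : `|a - b| < 1 -> `|a| <= `|b| + 1.
Proof. by have := ler_normD (a - b) b; rewrite subrK; lra. Qed.

Lemma min_btw_abs (u v w c : R) : `|u| <= c -> `|v| <= c ->
  Num.min u v <= w <= Num.max u v -> `|w| <= c.
Proof. by rewrite !ler_norml; have [_|_] := leP u v; lra. Qed.

(** The natural scaling of the pitchfork: u of size s, mu and eps of size s^2. The term th keeps s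
    positive at the origin and is made arbitrarily small afterwards. *)
Lemma scale_exists (t0 u mu eps th : R) : 0 < t0 -> t0 <= 1 / 4 ->
  `|u| <= t0 ^+ 2 -> `|mu| <= t0 ^+ 2 -> `|eps| <= t0 ^+ 2 -> 0 < th -> th <= t0 ^+ 2 ->
  exists s : R, [/\ 0 < s, s <= 2 * t0, `|u| <= s, `|mu| <= s ^+ 2 /\ `|eps| <= s ^+ 2 &
    s ^+ 2 = `|mu| + u ^+ 2 + `|eps| + th].
Proof.
move=> t00 t04 h1 h2 h3 th0 thr; set S := _ + th.
have u20 := sqr_ge0 u; have m0 := normr_ge0 mu; have e0 := normr_ge0 eps.
have S0 : 0 < S by rewrite /S; lra.
have sS : Num.sqrt S ^+ 2 = S by rewrite sqr_sqrtr // ltW.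
have s0 : 0 < Num.sqrt S by rewrite sqrtr_gt0.
have ur : u ^+ 2 <= t0 ^+ 2.
  rewrite -(real_normK (num_real u)) lerXn2r ?nnegrE ?(ltW t00) //.
  by apply: le_trans h1 _; nra.
exists (Num.sqrt S); split=> //.
- rewrite -ler_sqr ?nnegrE ?(ltW s0) //; last lra.
  by rewrite sS exprMn /S; lra.
- rewrite -ler_sqr ?nnegrE ?(ltW s0) // sS real_normK ?num_real // /S.
  by lra.
- by rewrite sS /S; split; lra.
Qed.

(** In this scaling every term is of order s^4 or s eps, with 22 = 16 + 4 + 2 and 4 = 2 + 1 + 1. The
    2 in Z <= 2 s allows u to move by s. *)
Lemma order_bound (K0 s Z M E : R) : 0 <= K0 -> 0 < s -> s <= 1 ->
  0 <= Z -> 0 <= M -> 0 <= E -> Z <= 2 * s -> M <= s ^+ 2 -> E <= s ^+ 2 ->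
  K0 * (Z ^+ 4 + Z ^+ 2 * M + Z * M ^+ 2 + Z * E + M * E + E ^+ 2)
    <= K0 * (22 * s ^+ 4 + 4 * (s * E)).
Proof.
move=> K00 s0 s1 Z0 M0 E0 ZS MS ES; apply: ler_wpM2l => //.
have s20' := sqr_ge0 s.
have z4 : Z ^+ 4 <= 16 * s ^+ 4.
  have -> : 16 * s ^+ 4 = (2 * s) ^+ 4 by ring.
  by rewrite lerXn2r ?nnegrE // mulr_ge0 // ltW.
have zsq : Z ^+ 2 <= 4 * s ^+ 2.
  have -> : 4 * s ^+ 2 = (2 * s) ^+ 2 by ring.
  by rewrite lerXn2r ?nnegrE // mulr_ge0 // ltW.
have zm : Z ^+ 2 * M <= 4 * s ^+ 4.
  have -> : 4 * s ^+ 4 = 4 * s ^+ 2 * s ^+ 2 by ring.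
  by apply: ler_pM => //; exact: sqr_ge0.
have m2 : M ^+ 2 <= s ^+ 4.
  have -> : s ^+ 4 = (s ^+ 2) ^+ 2 by ring.
  by rewrite lerXn2r ?nnegrE.
have zmm : Z * M ^+ 2 <= 2 * s ^+ 4.
  have : Z * M ^+ 2 <= 2 * s * s ^+ 4 by apply: ler_pM => //; exact: sqr_ge0.
  have : s * s ^+ 4 <= 1 * s ^+ 4 by rewrite ler_wpM2r // exprn_ge0 // ltW.
  by lra.
have zE : Z * E <= 2 * s * E by rewrite ler_wpM2r.
have s2s : s ^+ 2 <= s by rewrite expr2 ler_piMl // ltW.
have mE : M * E <= s * E by rewrite ler_wpM2r // (le_trans MS).
have EE : E ^+ 2 <= s * E by rewrite expr2 ler_wpM2r // (le_trans ES).
lra.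
Qed.

Lemma small_bound (K0 K t0 s m u2 E th : R) : 0 <= K0 -> 4 * K0 + 1 <= K -> 0 < s ->
  s <= 2 * t0 -> t0 * (20 * (900 * (K0 + 1))) <= 1 -> 0 <= t0 -> 0 <= m -> 0 <= u2 -> 0 <= E -> 0 < th ->
  s ^+ 2 = m + u2 + E + th ->
  K0 * (22 * s ^+ 4 + 4 * (s * E)) / s + 400^-1 * s ^+ 2 <= (m + u2) / 100 + K * E + th.
Proof.
move=> K00 K1 s0 st tK t00 m0 u20 E0 th0 sS.
have -> : K0 * (22 * s ^+ 4 + 4 * (s * E)) / s = 22 * (K0 * s) * s ^+ 2 + 4 * K0 * E.
  by field; rewrite gt_eqF.
have Ks : 22 * (K0 * s) <= 400^-1.
  have : K0 * s <= K0 * (2 * t0) by rewrite ler_wpM2l.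
  by move: tK; lra.
have := ler_wpM2r (sqr_ge0 s) Ks; rewrite sS.
have := ler_wpM2r E0 K1; lra.
Qed.

(** The third condition forces 22 K0 s <= 1 / 400 for s <= 2 t0; the fourth keeps u and its shifts
    by s inside the domain. *)
Lemma scale_bound_exists (r0 K0 : R) : 0 < r0 -> 0 <= K0 -> exists t0 : R,
  [/\ 0 < t0, t0 <= 1 / 4, t0 * (20 * (900 * (K0 + 1))) <= 1, t0 ^+ 2 + 2 * t0 < r0 &
    t0 ^+ 2 <= 1].
Proof.
move=> r00 K00.
have [Kt [Kt0 KtE]] : exists Kt : R, 0 < Kt /\ Kt = 20 * (900 * (K0 + 1)).
  by eexists; split; [|reflexivity]; lra.
have k1 : 0 < r0 / 4 by lra.
have k2 : 0 < 1 / 4 :> R by lra.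
have k3 : 0 < 1 / Kt by rewrite divr_gt0.
have [t0 [t00 tr t4 tK]] : exists t0 : R, [/\ 0 < t0, t0 <= r0 / 4, t0 <= 1 / 4 & t0 * Kt <= 1].
  exists (Num.min (r0 / 4) (Num.min (1 / 4) (1 / Kt))).
  by rewrite -ler_pdivlMr // !lt_min !ge_min !lexx !orbT k1 k2 k3.
have h : t0 ^+ 2 <= t0 / 4 by rewrite expr2; nra.
by exists t0; rewrite -KtE; split=> //; lra.
Qed.

(** For [lr_small], [central_difference] is applied at the scale s of the pitchfork: the remainder
    is O(s^4 + s eps) and its third u-derivative is below 1 / 400, so the first is a small multiple
    of s^2 plus a multiple of eps. *)
Lemma local_remainder_exists (rem : R -> R -> R -> R) :
  smooth_near0 3 rem -> remainder_order rem ->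
  exists (r K : R) (R1 R2 : R -> R -> R -> R),
    [/\ 0 < r, r <= 1, 1 <= K & local_remainder rem R1 R2 r K].
Proof.
move=> [U [[Uo U0] CkF]] [C [d [d0 remO]]].
pose F p := rem p.1.1 p.1.2 p.2 : R.
pose e1 : R * R * R := (1, 0, 0); pose e2 : R * R * R := (0, 1, 0).
pose G1 p := 'D_e1 F p; pose G2 p := 'D_e1 G1 p; pose G3 p := 'D_e1 G2 p.
pose H1 p := 'D_e2 F p.
case: CkF => _ /= CkF.
have [F1 [_ CkF1]] := CkF e1; have [F2 [H1c _]] := CkF e2.
have [G1d [G2c CkG1]] := CkF1 e1; have [G2d [G3c _]] := CkG1 e1.
have /nbhs_ballP [d' /= d'0 Ud'] : nbhs (0 : R, 0 : R, 0 : R) U by exact: open_nbhs_nbhs.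
have Uin (u mu eps : R) : `|u| < d' -> `|mu| < d' -> `|eps| < d' -> U (u, mu, eps).
  by move=> ? ? ?; apply: Ud'; split; [split|]; rewrite /ball /= sub0r normrN.
have U00 : U (0, 0, 0) := U0.
have bdd (f : R * R * R -> R) (e : R) : 0 < e -> {for (0, 0, 0), continuous f} ->
    exists2 s : R, 0 < s & forall u mu eps : R, `|u| < s -> `|mu| < s -> `|eps| < s ->
      `|f (u, mu, eps) - f (0, 0, 0)| < e.
  move=> e0 /cvgrPdist_lt /(_ e e0) /nbhs_ballP [s /= s0 Hs]; exists s => // u mu eps us ms es.
  by rewrite distrC; apply: Hs; split; [split|]; rewrite /ball /= sub0r normrN.
have shift1 (h u mu eps : R) : h *: e1 + (u, mu, eps) = (h + u, mu, eps).
  by rewrite -[LHS]/(h * 1 + u, h * 0 + mu, h * 0 + eps) mulr1 mulr0 !add0r.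
have L1 (u mu eps : R) : U (u, mu, eps) -> is_derive u 1 (fun u => rem u mu eps) (G1 (u, mu, eps)).
  move=> Up; apply: (partial_line F _ e1) => [h|]; last exact: F1.
  by rewrite /F /= !scaler0 !add0r [h *: 1]mulr1.
have L2 (u mu eps : R) : U (u, mu, eps) -> is_derive u 1 (fun u => G1 (u, mu, eps)) (G2 (u, mu, eps)).
  move=> Up; apply: (partial_line G1 _ e1) => [h|]; last exact: G1d.
  by rewrite shift1.
have L3 (u mu eps : R) : U (u, mu, eps) -> is_derive u 1 (fun u => G2 (u, mu, eps)) (G3 (u, mu, eps)).
  move=> Up; apply: (partial_line G2 _ e1) => [h|]; last exact: G2d.
  by rewrite shift1.
have LH (u mu eps : R) : U (u, mu, eps) -> is_derive mu 1 (fun mu => rem u mu eps) (H1 (u, mu, eps)).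
  move=> Up; apply: (partial_line F _ e2) => [h|]; last exact: F2.
  by rewrite /F /= !scaler0 !add0r [h *: 1]mulr1.
(* On the line mu = eps = 0 the order condition leaves only u^4. *)
have G30 : G3 (0, 0, 0) = 0.
  pose dd := Num.min d d'; have dd0 : 0 < dd by rewrite lt_min d0.
  have ddd : dd <= d by rewrite ge_min lexx.
  have ddd' : dd <= d' by rewrite ge_min lexx orbT.
  have z0 : `|0 : R| < d' by rewrite normr0.
  have Uz (z : R) : `|z| < dd -> U (z, 0, 0) by move=> zd; apply: Uin => //; exact: lt_le_trans ddd'.
  have a1 (z : R) (h : `|z| < dd) := L1 z 0 0 (Uz z h).
  have a2 (z : R) (h : `|z| < dd) := L2 z 0 0 (Uz z h).
  have a3 (z : R) (h : `|z| < dd) := L3 z 0 0 (Uz z h).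
  have a4 : {for 0, continuous (fun u => G3 (u, 0, 0))}.
    apply/cvgrPdist_lt => e e0; have [s s0 Hs] := bdd G3 e e0 (G3c _ U00).
    apply/nbhs_ballP; exists s => //= z; rewrite /ball /= sub0r normrN => zs.
    by rewrite distrC; apply: Hs; rewrite ?normr0.
  have a5 (z : R) : `|z| < dd -> `|rem z 0 0| <= C * z ^+ 4.
    move=> zd; have := remO z 0 0 (lt_le_trans zd ddd); rewrite normr0 => /(_ d0 d0).
    by rewrite !(mulr0, expr0n) /= !normr0 !addr0 normrX -(absE (z ^+ 4)) ?exprn_even_ge0 // normrX.
  exact: (der3_eq0 (fun u => rem u 0 0) (fun u => G1 (u, 0, 0)) (fun u => G2 (u, 0, 0))
    (fun u => G3 (u, 0, 0)) dd C dd0 a1 a2 a3 a4 a5).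
have [s2 s20 B2] := bdd G2 1 ltr01 (G2c _ U00).
have e400 : 0 < 400^-1 :> R by lra.
have [s3 s30 B3] := bdd G3 400^-1 e400 (G3c _ U00).
have [sH sH0 BH] := bdd H1 1 ltr01 (H1c _ U00).
pose K0 := `|C|; have K00 : 0 <= K0 := normr_ge0 _.
have [r0 [r00 rd rd' r2 [r3 rH]]] : exists r0 : R,
    [/\ 0 < r0, r0 <= d, r0 <= d', r0 <= s2 & r0 <= s3 /\ r0 <= sH].
  exists (Num.min d (Num.min d' (Num.min s2 (Num.min s3 sH)))).
  by rewrite !lt_min !ge_min !lexx !orbT d0 d'0 s20 s30 sH0.
have [t0 [t00 t4 tK tr r1]] := scale_bound_exists r0 K0 r00 K00.
pose r := t0 ^+ 2; have r_gt0 : 0 < r by rewrite exprn_gt0.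
pose K := 4 * K0 + 1 + (`|G2 (0, 0, 0)| + 1) + (`|H1 (0, 0, 0)| + 1).
have [K1 K2 KH] : [/\ 4 * K0 + 1 <= K, `|G2 (0, 0, 0)| + 1 <= K & `|H1 (0, 0, 0)| + 1 <= K].
  by apply: sum3_le; rewrite addr_ge0 // mulr_ge0.
have rr0 : r < r0 by apply: le_lt_trans tr; rewrite lerDl mulr_ge0 // ltW.
have rlt (z : R) : `|z| <= r -> `|z| < r0 by move=> h; exact: le_lt_trans rr0.
have big (u mu eps : R) : `|u| < r0 -> `|mu| < r0 -> `|eps| < r0 -> U (u, mu, eps).
  by move=> ? ? ?; apply: Uin; exact: lt_le_trans rd'.
have G3b (u mu eps : R) : `|u| < r0 -> `|mu| < r0 -> `|eps| < r0 -> `|G3 (u, mu, eps)| <= 400^-1.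
  move=> h1 h2 h3; have := B3 u mu eps; rewrite G30 subr0 => /(_ _ _ _) H.
  by apply: ltW; apply: H; exact: lt_le_trans r3.
have remK (u mu eps : R) : `|u| < r0 -> `|mu| < r0 -> `|eps| < r0 ->
    `|rem u mu eps| <= K0 * (`|u| ^+ 4 + `|u| ^+ 2 * `|mu| + `|u| * `|mu| ^+ 2
       + `|u| * `|eps| + `|mu| * `|eps| + `|eps| ^+ 2).
  move=> h1 h2 h3; have := remO u mu eps (lt_le_trans h1 rd) (lt_le_trans h2 rd) (lt_le_trans h3 rd).
  rewrite !(normrX, normrM) => H; apply: le_trans H _; apply: ler_wpM2r; last exact: ler_norm.
  by rewrite !addr_ge0 ?mulr_ge0 ?exprn_ge0.
have e401 : 400^-1 <= K by move: K1 K00; clear; lra.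
have K01 : K0 <= K by move: K1 K00; clear; lra.
exists r, K, (fun u mu eps => G1 (u, mu, eps)), (fun u mu eps => G2 (u, mu, eps)).
split; [exact: r_gt0|exact: r1| |split].
- by move: K1 K00; clear; lra.
- by move=> u mu eps /rlt ? /rlt ? /rlt ?; apply: L1; exact: big.
- by move=> u mu eps /rlt ? /rlt ? /rlt ?; apply: L2; exact: big.
- move=> u mu eps /rlt h1 /rlt h2 /rlt h3; apply: le_trans K2.
  have := B2 u mu eps (lt_le_trans h1 r2) (lt_le_trans h2 r2) (lt_le_trans h3 r2).
  exact: abs_le_near.
- move=> u v mu eps h1 h1' /rlt h2 /rlt h3.
  have D w (h : Num.min v u <= w <= Num.max v u) := L3 w mu eps (big w mu eps (rlt _ (min_btw_abs v u w r h1' h1 h)) h2 h3).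
  apply: (der_lip _ _ _ _ _ D) => w /(min_btw_abs v u w r h1' h1) /rlt wr.
  by exact: le_trans (G3b _ _ _ wr h2 h3) e401.
- move=> u mu nu eps /rlt h1 h2 h2' /rlt h3.
  have D w (h : Num.min nu mu <= w <= Num.max nu mu) := LH u w eps (big u w eps h1 (rlt _ (min_btw_abs nu mu w r h2' h2 h)) h3).
  apply: (der_lip _ _ _ _ _ D) => w /(min_btw_abs nu mu w r h2' h2) /rlt wr.
  apply: le_trans KH.
  have := BH u w eps (lt_le_trans h1 rH) (lt_le_trans wr rH) (lt_le_trans h3 rH).
  exact: abs_le_near.
- move=> u mu eps /rlt h1 /rlt h2 /rlt h3; apply: le_trans (remK u mu eps h1 h2 h3) _.
  apply: ler_wpM2r; last exact: K01.
  by rewrite !addr_ge0 ?mulr_ge0 ?exprn_ge0.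
move=> u mu eps h1 h2 h3; apply/ler_addgt0Pr => e e0.
have [th [th0 the thr]] : exists th : R, [/\ 0 < th, th <= e & th <= r].
  by exists (Num.min e r); rewrite lt_min e0 r_gt0 !ge_min !lexx orbT.
have [s [s0 st us [mus es] sS]] := scale_exists t0 u mu eps th t00 t4 h1 h2 h3 th0 thr.
have s1 : s <= 1 by move: st t4; clear; lra.
have zr (z : R) : `|z - u| <= s -> `|z| <= 2 * s.
  by move=> zu; have := ler_normD (z - u) u; rewrite subrK; move: zu us; clear; lra.
have zr0 (z : R) (h : `|z - u| <= s) : `|z| < r0.
  have := ler_normD (z - u) u; rewrite subrK; move: h h1 st tr; rewrite /r; clear; lra.
have h2' := rlt _ h2; have h3' := rlt _ h3.
have := central_difference (fun u => rem u mu eps) (fun u => G1 (u, mu, eps))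
  (fun u => G2 (u, mu, eps)) (fun u => G3 (u, mu, eps)) u s 400^-1
  (K0 * (22 * s ^+ 4 + 4 * (s * `|eps|))) s0
  (fun z h => L1 z mu eps (big z mu eps (zr0 z h) h2' h3'))
  (fun z h => L2 z mu eps (big z mu eps (zr0 z h) h2' h3'))
  (fun z h => L3 z mu eps (big z mu eps (zr0 z h) h2' h3'))
  (fun z h => G3b z mu eps (zr0 z h) h2' h3').
have remz z : `|z - u| <= s -> `|rem z mu eps| <= K0 * (22 * s ^+ 4 + 4 * (s * `|eps|)).
  move=> zu; apply: le_trans (remK z mu eps (zr0 z zu) h2' h3') _.
  by apply: order_bound => //; exact: zr.
move=> /(_ remz) H; apply: le_trans H _; apply: (@le_trans _ _ ((`|mu| + u ^+ 2) / 100 + K * `|eps| + th)).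
  by apply: (small_bound K0 K t0 s) => //; rewrite ?sqr_ge0 ?(ltW t00).
by rewrite lerD2l.
Qed.

End LocalRemainder.

(** * From norms and the partial differential equation to classical solutions, and back *)

Section Bridge.
Context {R : realType}.
Implicit Types (v : R -> R) (x y t e M c : R).

Lemma supnorm_le v M : (forall x, `|v x| <= M) -> (supnorm v <= M%:E)%E.
Proof. by move=> vM; apply: ge_ereal_sup => _ [x _ <-]; rewrite lee_fin. Qed.

Lemma supnorm_ge v x : (`|v x|%:E <= supnorm v)%E.
Proof. by apply: ereal_sup_ubound; exists x. Qed.

Lemma supnorm_ge0 v : (0 <= supnorm v)%E.
Proof. by apply: le_trans (supnorm_ge v 0); rewrite lee_fin. Qed.

Lemma supnorm_leP v M x : (supnorm v <= M%:E)%E -> `|v x| <= M.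
Proof. by move=> /(le_trans (supnorm_ge v x)); rewrite lee_fin. Qed.

Lemma unif_continuousP v : unif_continuous v <->
  forall e, 0 < e -> exists2 d : R, 0 < d & forall x y, `|y - x| <= d -> `|v y - v x| <= e.
Proof.
split=> [vu e e0|H].
  have /vu : entourage [set p : R * R | `|p.1 - p.2| < e].
    by rewrite -entourage_ballE; exists e => //= -[p q].
  rewrite /= nbhs_simpl /= -entourage_ballE => -[d /= d0 Hd].
  exists (d / 2) => [|x y yx]; first exact: divr_gt0.
  rewrite ltW //; have := Hd (y, x); apply; rewrite /= /ball /=.
  by apply: le_lt_trans yx _; lra.
suff : forall A : set (R * R), entourage A -> entourage ((fun xy => (v xy.1, v xy.2)) @^-1` A) by [].
move=> A; rewrite -!entourage_ballE => -[e /= e0 eA].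
have [|d d0 Hd] := H (e / 2); first exact: divr_gt0.
exists d => //= -[x y] /= xy.
apply: eA; rewrite /= /ball /=; have := Hd y x; rewrite ltW // => /(_ isT) h.
by apply: le_lt_trans h _; lra.
Qed.

Lemma Znorm_le v A B D : (forall x, `|v x| <= A) -> (forall x, `|(1 + `|x|) * derive1 v x| <= B) ->
  (forall x, `|(1 + x ^+ 2) * derive1n 2 v x| <= D) -> (Znorm v <= (A + B + D)%:E)%E.
Proof. by move=> vA vB vD; rewrite !EFinD; apply: leeD; [apply: leeD|]; exact: supnorm_le. Qed.

Lemma Znorm_leP v c : (Znorm v <= c%:E)%E -> forall x,
  [/\ `|v x| <= c, `|(1 + `|x|) * derive1 v x| <= c & `|(1 + x ^+ 2) * derive1n 2 v x| <= c].
Proof.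
rewrite /Znorm => vc x.
set s1 := supnorm v in vc; set s2 := supnorm _ in vc; set s3 := supnorm _ in vc.
have [p1 p2 p3] : [/\ (0 <= s1)%E, (0 <= s2)%E & (0 <= s3)%E] by split; exact: supnorm_ge0.
split.
- by apply: (supnorm_leP v c x); apply: le_trans vc; exact: le_trans (leeDl s1 p2) (leeDl _ p3).
- apply: (supnorm_leP (fun x => (1 + `|x|) * derive1 v x) c x).
  by apply: le_trans vc; exact: le_trans (leeDr s2 p1) (leeDl _ p3).
- apply: (supnorm_leP (fun x => (1 + x ^+ 2) * derive1n 2 v x) c x).
  by apply: le_trans vc; exact: leeDr _ (adde_ge0 p1 p2).
Qed.

Lemma Cbunif_der v x : Cbunif 2 v ->
  is_derive x 1 v (derive1 v x) /\ is_derive x 1 (derive1 v) (derive1n 2 v x).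
Proof.
move=> [vd _]; split.
  by rewrite derive1E; apply: derivableP; exact: (vd 0%N).
by rewrite derive1nS derive1E derive1n1; apply: derivableP; exact: (vd 1%N).
Qed.

Lemma pde_classical (rem : R -> R -> R -> R) (lam eps T : R) u m :
  pde_solution rem lam eps T u m ->
  classical_sol (fun t p => reaction rem lam p (m t) eps) T u
    (fun t => derive1 (u t)) (fun t => derive1n 2 (u t)).
Proof.
move=> [usp uc ueq _ _]; split.
- by move=> t x /usp [Cu _]; exact: (Cbunif_der (u t) x Cu).1.
- by move=> t x /usp [Cu _]; exact: (Cbunif_der (u t) x Cu).2.
- move=> t tT e e0; have [d d0 Hd] := uc t tT e e0; exists d => // s sT st x.
  by apply: (supnorm_leP (fun x => u s x - u t x) e x); apply/ltW; exact: Hd.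
- by move=> t x tT; exact: ueq.
Qed.

(** The equation for mu holds at interior times only; continuity up to the ends fixes the constant
    of integration. *)
Lemma pde_mu_eq (rem : R -> R -> R -> R) (lam eps T : R) u m (m0 : R) : 0 < T ->
  pde_solution rem lam eps T u m -> m 0 = m0 -> forall t, 0 <= t <= T -> m t = m0 + eps * t.
Proof.
move=> T0 [_ _ _ mc md] m00 t /andP[t0 tT].
pose k s := m s - eps * s.
have kd s : 0 < s < T -> is_derive s 1 k 0.
  move=> sT; apply: (derE (derB (md s sT) (derZ eps (der_id s)))).
  by rewrite mulr1 subrr.
suff : k t = k 0 by rewrite /k m00 mulr0 subr0 => <-; rewrite subrK.
have kc : {within `[0, t], continuous k}.
  have sub : `[0, t]%classic `<=` `[0, T]%classic.
    by move=> s /=; rewrite !in_itv /= => /andP[-> /le_trans -> //].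
  apply: (continuous_subspaceW sub) => s.
  apply: continuousB; first exact: mc.
  by apply: continuous_subspaceT => w; exact: (der_cont (derZ eps (der_id w))).
have kd' s : s \in `]0, t[%R -> is_derive s 1 k 0.
  by rewrite in_itv /= => /andP[s0 st]; apply: kd; rewrite s0 (lt_le_trans st).
have [c _ E] := MVT_segment t0 kd' kc.
by apply/eqP; rewrite -subr_eq0 E mul0r.
Qed.

Lemma classical_pde (rem : R -> R -> R -> R) (lam eps T m0 : R) (u ux uxx : R -> R -> R) :
  classical_sol (fun t p => reaction rem lam p (m0 + eps * t) eps) T u ux uxx ->
  (exists M, forall t x, 0 <= t <= T -> [/\ `|u t x| <= M, `|(1 + `|x|) * ux t x| <= M
     & `|(1 + x ^+ 2) * uxx t x| <= M]) ->
  (forall t, 0 <= t <= T -> unif_continuous (uxx t)) ->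
  pde_solution rem lam eps T u (fun t => m0 + eps * t).
Proof.
move=> [d1 d2 uc ueq] [M HM] uxxc.
have E1 t : 0 <= t <= T -> derive1n 1 (u t) = ux t.
  move=> tT; rewrite derive1n1; apply/funext => x; rewrite derive1E.
  by case: (d1 t x tT).
have E2 t : 0 <= t <= T -> derive1n 2 (u t) = uxx t.
  move=> tT; rewrite derive1nS (E1 t tT); apply/funext => x; rewrite derive1E.
  by case: (d2 t x tT).
have B1 t x : 0 <= t <= T -> `|ux t x| <= M.
  move=> tT; have [_ + _] := HM t x tT; rewrite normrM; apply: le_trans.
  by rewrite ler_peMl // ger0_norm ?lerDl // addr_ge0.
have B2 t x : 0 <= t <= T -> `|uxx t x| <= M.
  move=> tT; have [_ _] := HM t x tT; rewrite normrM; apply: le_trans.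
  by rewrite ler_peMl // ger0_norm ?lerDl ?sqr_ge0 // addr_ge0 // sqr_ge0.
have lipuc v dv : (forall x, is_derive x 1 v (dv x)) -> (forall x, `|dv x| <= M) -> unif_continuous v.
  move=> vd vM; apply/unif_continuousP => e e0; have M0 : 0 <= M by apply: le_trans (vM 0).
  exists (e / (M + 1)); first by rewrite divr_gt0 // ltr_wpDl.
  move=> x y yx; apply: le_trans (der_lip v dv M x y (fun z _ => vd z) (fun z _ => vM z)) _.
  by move: yx; rewrite ler_pdivlMr ?ltr_wpDl //; have := normr_ge0 (y - x); lra.
have fin v : (forall x, `|v x| <= M) -> (supnorm v < +oo)%E.
  by move=> /supnorm_le /le_lt_trans; apply; rewrite ltry.
split.
- move=> t tT; split; last first.
    apply: (@le_lt_trans _ _ (M + M + M)%:E); last by rewrite ltry.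
    apply: Znorm_le => x; rewrite -?derive1n1 ?(E1 t tT) ?(E2 t tT); by case: (HM t x tT).
  split=> [[|[|//]] x _|[|[|[|//]]] _].
  + by rewrite derive1n0; case: (d1 t x tT).
  + by rewrite (E1 t tT); case: (d2 t x tT).
  + rewrite derive1n0; split; first by apply: fin => x; case: (HM t x tT).
    by apply: (lipuc _ (ux t)) => x; [exact: d1|exact: B1].
  + rewrite (E1 t tT); split; first by apply: fin => x; exact: B1.
    by apply: (lipuc _ (uxx t)) => x; [exact: d2|exact: B2].
  + by rewrite (E2 t tT); split; [apply: fin => x; exact: B2|exact: uxxc].
- move=> t tT e e0; have e2 : 0 < e / 2 by exact: divr_gt0.
  have [d d0 Hd] := uc t tT _ e2; exists d => // s sT st.
  apply: (@le_lt_trans _ _ (e / 2)%:E); last by rewrite lte_fin; lra.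
  by apply: supnorm_le => x; exact: Hd.
- move=> t x tT; have tT' : 0 <= t <= T by case/andP: tT => /ltW -> /ltW ->.
  by rewrite (E2 t tT'); exact: ueq.
- apply: continuous_subspaceT => t.
  exact: (der_cont (derD (der_cst m0 t) (derZ eps (der_id t)))).
- move=> t _; apply: (derE (derD (der_cst m0 t) (derZ eps (der_id t)))).
  by rewrite add0r mulr1.
Qed.

Lemma classical_opp (f : R -> R -> R) (T : R) (u ux uxx : R -> R -> R) :
  classical_sol f T u ux uxx -> classical_sol (fun t p => - f t (- p)) T
    (fun t x => - u t x) (fun t x => - ux t x) (fun t x => - uxx t x).
Proof.
move=> [d1 d2 uc ueq]; split.
- by move=> t x tT; exact: derN (d1 t x tT).
- by move=> t x tT; exact: derN (d2 t x tT).
- move=> t tT e e0; have [d d0 Hd] := uc t tT e e0; exists d => // s sT st x.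
  by rewrite -opprD normrN; exact: Hd.
- by move=> t x tT; apply: (derE (derN (ueq t x tT))); rewrite opprD opprK.
Qed.

End Bridge.

(** * Signs of the reaction from the order of the remainder *)

Section ReactionBounds.
Context {R : realType}.
Implicit Types (K d rho eps lam X M q p mu : R).

(** For d <= X <= 2 d the cubic term beats all others: K d <= 1 / 8 controls the quartic term, rho
    <= d^2 / 8 those with mu, and eps (lam + 1) <= d^3 / 4 the forcing and the terms with eps. *)
Lemma order_outer_bound K d rho eps lam X M : 1 <= K -> 8 * (K * d) <= 1 -> d <= X -> X <= 2 * d ->
  0 < d -> 0 <= M -> M <= rho -> 8 * rho <= d ^+ 2 -> 0 < eps -> eps <= rho ->
  0 <= lam -> 4 * (eps * (lam + 1)) <= d ^+ 3 ->
  M * X + eps * lam + K * (X ^+ 4 + X ^+ 2 * M + X * M ^+ 2 + X * eps + M * eps + eps ^+ 2) <= X ^+ 3.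
Proof.
move=> K1 Kd dX Xd d0 M0 Mr rd e0 er lam0 el.
have X0 : 0 < X by lra.
have KX : K * X <= 1 / 4 by have := ler_wpM2l (_ : 0 <= K) Xd; lra.
have d1 : d <= 1 / 8 by nra.
have dX2 : d ^+ 2 <= X ^+ 2 by rewrite lerXn2r ?nnegrE // ltW.
have dX3 : d ^+ 3 <= X ^+ 3 by rewrite lerXn2r ?nnegrE // ltW.
have KM : K * M <= 1 / 4.
  have : K * M <= K * d ^+ 2 by apply: ler_wpM2l; lra.
  have : K * d * d <= 1 / 8 * d by apply: ler_wpM2r; lra.
  by rewrite -mulrA -expr2; lra.
have XM0 : 0 <= X * M by rewrite mulr_ge0 // ltW.
have XM : X * M <= X ^+ 3 / 8.
  have : X * M <= X * (X ^+ 2 / 8) by apply: ler_wpM2l; lra.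
  by rewrite exprS; lra.
have X30 : 0 <= X ^+ 3 by rewrite exprn_ge0 // ltW.
have b : K * X ^+ 4 <= X ^+ 3 / 4 by rewrite exprS mulrA; have := ler_wpM2r X30 KX; lra.
have c : K * (X ^+ 2 * M) <= X ^+ 3 / 32.
  have -> : K * (X ^+ 2 * M) = K * X * (X * M) by ring.
  by have := ler_wpM2r XM0 KX; lra.
have dd : K * (X * M ^+ 2) <= X ^+ 3 / 32.
  have -> : K * (X * M ^+ 2) = K * M * (X * M) by ring.
  by have := ler_wpM2r XM0 KM; lra.
have Ke : K * eps <= 1 / 4.
  have : K * eps <= K * d ^+ 2 by apply: ler_wpM2l; lra.
  have : K * d * d <= 1 / 8 * d by apply: ler_wpM2r; lra.
  by rewrite -mulrA -expr2; lra.
have g : K * (X * eps + M * eps + eps ^+ 2) <= eps * 1.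
  have -> : K * (X * eps + M * eps + eps ^+ 2) = eps * (K * X + K * M + K * eps) by ring.
  by apply: ler_wpM2l; lra.
by lra.
Qed.

(** Here u = - q and mu = - M, so M q and q^3 both push upwards. They absorb the terms without eps,
    and half of the forcing absorbs those with eps. *)
Lemma order_negative_bound K lam eps q M : 0 <= K -> 0 <= q -> 0 <= M -> 0 < eps ->
  K * q <= 1 / 4 -> K * M <= 1 / 2 -> K * (q + M + eps) <= lam / 2 ->
  eps * lam / 2 <= M * q + q ^+ 3 + eps * lam
    - K * (q ^+ 4 + q ^+ 2 * M + q * M ^+ 2 + q * eps + M * eps + eps ^+ 2).
Proof.
move=> K0 q0 M0 e0 Kq KM KL.
have q30 : 0 <= q ^+ 3 by rewrite exprn_ge0.
have Mq0 : 0 <= M * q by rewrite mulr_ge0.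
have a : K * q ^+ 4 <= q ^+ 3 by rewrite exprS mulrA; have := ler_wpM2r q30 Kq; lra.
have b : K * (q ^+ 2 * M) <= M * q / 4.
  have -> : K * (q ^+ 2 * M) = K * q * (M * q) by ring.
  by have := ler_wpM2r Mq0 Kq; lra.
have c : K * (q * M ^+ 2) <= M * q / 2.
  have -> : K * (q * M ^+ 2) = K * M * (M * q) by ring.
  by have := ler_wpM2r Mq0 KM; lra.
have g : K * (q * eps + M * eps + eps ^+ 2) <= eps * (lam / 2).
  have -> : K * (q * eps + M * eps + eps ^+ 2) = eps * (K * (q + M + eps)) by ring.
  by apply: ler_wpM2l => //; exact: ltW.
by lra.
Qed.

(** The terms with eps are charged to three quarters of the forcing; the others cost at most one
    eighth of M p and of p^3. *)
Lemma order_positive_bound K lam eps p M : 0 <= K -> 0 <= p -> 0 <= M -> 0 < eps ->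
  K * p <= 1 / 16 -> K * M <= 1 / 16 -> K * (p + M + eps) <= 3 * lam / 4 ->
  7 / 8 * (M * p) - 9 / 8 * p ^+ 3 + eps * lam / 4 <= M * p - p ^+ 3 + eps * lam
    - K * (p ^+ 4 + p ^+ 2 * M + p * M ^+ 2 + p * eps + M * eps + eps ^+ 2).
Proof.
move=> K0 p0 M0 e0 Kp KM KL.
have p30 : 0 <= p ^+ 3 by rewrite exprn_ge0.
have Mp0 : 0 <= M * p by rewrite mulr_ge0.
have a : K * p ^+ 4 <= p ^+ 3 / 16 by rewrite exprS mulrA; have := ler_wpM2r p30 Kp; lra.
have b : K * (p ^+ 2 * M) <= M * p / 16.
  have -> : K * (p ^+ 2 * M) = K * p * (M * p) by ring.
  by have := ler_wpM2r Mp0 Kp; lra.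
have c : K * (p * M ^+ 2) <= M * p / 16.
  have -> : K * (p * M ^+ 2) = K * M * (M * p) by ring.
  by have := ler_wpM2r Mp0 KM; lra.
have g : K * (p * eps + M * eps + eps ^+ 2) <= eps * (3 * lam / 4).
  have -> : K * (p * eps + M * eps + eps ^+ 2) = eps * (K * (p + M + eps)) by ring.
  by apply: ler_wpM2l => //; exact: ltW.
by lra.
Qed.

End ReactionBounds.

(** * Derivatives and bounds of the full reaction *)

Section Reaction.
Context {R : realType}.
Variables (rem R1 R2 : R -> R -> R -> R) (r K lam d : R).
Hypotheses (loc : local_remainder rem R1 R2 r K) (r1 : r <= 1) (K1 : 1 <= K)
  (d0 : 0 < d) (dr : 2 * d <= r) (Kd : 8 * (K * d) <= 1).
Implicit Types (p q mu nu eps t s rho x : R).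

Definition reaction1 p mu eps : R := mu - 3 * p ^+ 2 + R1 p mu eps.
Definition reaction2 p mu eps : R := - 6 * p + R2 p mu eps.

Lemma reaction_d1 p mu eps : `|p| <= r -> `|mu| <= r -> `|eps| <= r ->
  is_derive p 1 (fun p => reaction rem lam p mu eps) (reaction1 p mu eps).
Proof.
move=> pr mr er; apply: (derE (derD (derD (derB (derZ mu (der_id p)) (derX 3 (der_id p)))
  (der_cst (eps * lam) p)) (lr_d1 _ _ _ _ _ loc p mu eps pr mr er))).
by rewrite /reaction1 /=; ring.
Qed.

Lemma reaction_d2 p mu eps : `|p| <= r -> `|mu| <= r -> `|eps| <= r ->
  is_derive p 1 (fun p => reaction1 p mu eps) (reaction2 p mu eps).
Proof.
move=> pr mr er; apply: (derE (derD (derB (der_cst mu p) (derZ 3 (derX 2 (der_id p))))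
  (lr_d2 _ _ _ _ _ loc p mu eps pr mr er))).
by rewrite /reaction2 /= expr1; ring.
Qed.

Lemma reaction1_le p mu eps : `|p| <= r -> `|mu| <= r -> `|eps| <= r ->
  reaction1 p mu eps <= mu + `|mu| / 100 + K * `|eps| - 299 / 100 * p ^+ 2.
Proof.
move=> pr mr er; have := lr_small _ _ _ _ _ loc p mu eps pr mr er.
by rewrite ler_norml /reaction1 => /andP[_]; lra.
Qed.

Lemma reaction_box rho mu eps p : `|mu| <= rho -> 8 * rho <= d ^+ 2 -> 0 < eps -> eps <= rho ->
  4 * (eps * (`|lam| + 1)) <= d ^+ 3 ->
  (d <= p -> p <= 2 * d -> reaction rem lam p mu eps <= 0) /\
  (- (2 * d) <= p -> p <= - d -> 0 <= reaction rem lam p mu eps).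
Proof.
move=> mr rd e0 er el.
have dd : d ^+ 2 <= d * r by rewrite expr2; apply: ler_wpM2l; [exact: ltW|move: dr d0; lra].
have rr : rho <= r.
  have : d * r <= 1 * r by apply: ler_wpM2r; [move: dr d0; lra|move: dr r1; lra].
  by move: rd dd dr d0; lra.
have key : d <= `|p| -> `|p| <= 2 * d -> `|mu * p + eps * lam + rem p mu eps| <= `|p| ^+ 3.
  move=> dp pd; have pr : `|p| <= r by exact: le_trans dr.
  have eE : `|eps| = eps by rewrite absE // ltW.
  have er' : `|eps| <= r by rewrite eE (le_trans er).
  have := lr_order _ _ _ _ _ loc p mu eps pr (le_trans mr rr) er'; rewrite eE => H.
  apply: le_trans (order_outer_bound K d rho eps `|lam| `|p| `|mu| K1 Kd dp pd d0 _ mr rd e0 er _ el) => //.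
  apply: le_trans (ler_normD _ _) _; apply: lerD H.
  by apply: le_trans (ler_normD _ _) _; rewrite !normrM eE.
rewrite /reaction; split=> p1 p2.
  have p0 : 0 <= p by move: d0; lra.
  have := key; rewrite (absE p p0) => /(_ p1 p2); rewrite ler_norml; move: (p ^+ 3) (mu * p) (rem p mu eps) => A B D; lra.
have p0 : p <= 0 by move: d0; lra.
have := key; rewrite (absNE p p0) lerNr lerNl => /(_ p2 p1); rewrite ler_norml.
have -> : (- p) ^+ 3 = - p ^+ 3 by ring.
by move: (p ^+ 3) (mu * p) (rem p mu eps) => A B D; lra.
Qed.

(** All variables are at most 1 in absolute value, so every term is bounded crudely; the six terms
    of the order condition give 6 K. *)
Lemma reaction_regular rho eps : 0 < rho -> 8 * rho <= d ^+ 2 -> 0 < eps -> eps <= rho ->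
  4 * (eps * (`|lam| + 1)) <= d ^+ 3 ->
  regular_reaction (fun t p => reaction rem lam p (- rho + eps * t) eps)
    (fun t p => reaction1 p (- rho + eps * t) eps) (fun t p => reaction2 p (- rho + eps * t) eps)
    (2 * rho / eps) d (10 + `|lam| + 7 * K).
Proof.
move=> rho0 rd e0 er el.
have d1 : d <= 1 by move: dr r1; lra.
have dr' : d <= r by move: dr d0; lra.
have rr : rho <= r.
  have : d * d <= d * r by apply: ler_wpM2l => //; exact: ltW.
  have : d * r <= 1 * r by apply: ler_wpM2r => //; move: dr d0; lra.
  by move: rd rho0; rewrite expr2; lra.
have eE : `|eps| = eps by rewrite absE // ltW.
have er' : `|eps| <= r by rewrite eE (le_trans er).
have mu_rho t : 0 <= t <= 2 * rho / eps -> `|- rho + eps * t| <= rho.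
  move=> /andP[t0 tT]; have := mulr_ge0 (ltW e0) t0.
  have : eps * t <= eps * (2 * rho / eps) by rewrite ler_wpM2l // ltW.
  have -> : eps * (2 * rho / eps) = 2 * rho by field; rewrite gt_eqF.
  by rewrite ler_norml; lra.
have mu_r t : 0 <= t <= 2 * rho / eps -> `|- rho + eps * t| <= r.
  by move=> /mu_rho h; exact: le_trans rr.
have pr p : `|p| <= d -> `|p| <= r by move=> h; exact: le_trans dr'.
have order t p : 0 <= t <= 2 * rho / eps -> `|p| <= d ->
    `|rem p (- rho + eps * t) eps| <= 6 * K.
  move=> tT pd; apply: le_trans (lr_order _ _ _ _ _ loc _ _ _ (pr p pd) (mu_r t tT) er') _.
  have le1 x : `|x| <= r -> `|x| <= 1 by move=> h; exact: le_trans r1.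
  have := le1 _ (pr p pd); have := le1 _ (mu_r t tT); have := le1 _ er'.
  have := normr_ge0 p; have := normr_ge0 eps; have := normr_ge0 (- rho + eps * t).
  move: (`|p|) (`|eps|) (`|- rho + eps * t|) => X e M M0 e0' X0 e1 M1 X1.
  rewrite mulrC ler_wpM2r //; first by move: K1; lra.
  have X4 : X ^+ 4 <= 1 by rewrite expr_le1.
  have X2 : X ^+ 2 <= 1 by rewrite expr_le1.
  have M2 : M ^+ 2 <= 1 by rewrite expr_le1.
  have e2 : e ^+ 2 <= 1 by rewrite expr_le1.
  have a1 : X ^+ 2 * M <= 1 by rewrite mulr_ile1 // exprn_ge0.
  have a2 : X * M ^+ 2 <= 1 by rewrite mulr_ile1 // exprn_ge0.
  have a3 : X * e <= 1 by rewrite mulr_ile1.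
  have a4 : M * e <= 1 by rewrite mulr_ile1.
  by move: X4 e2 a1 a2 a3 a4; lra.
have lam0 := normr_ge0 lam.
split.
- by move=> t p tT pd; apply: reaction_d1; [exact: pr|exact: mu_r|].
- by move=> t p tT pd; apply: reaction_d2; [exact: pr|exact: mu_r|].
- move=> t p tT pd; rewrite /reaction; have := order t p tT pd.
  have : `|(- rho + eps * t) * p| <= 1.
    rewrite normrM mulr_ile1 //; first exact: le_trans (mu_r t tT) r1.
    exact: le_trans pd d1.
  have : `|p ^+ 3| <= 1 by rewrite normrX expr_le1 // (le_trans pd d1).
  have : `|eps * lam| <= `|lam|.
    by rewrite normrM ler_piMl // (le_trans er' r1).
  rewrite !ler_norml; move: (rem p _ _) (p ^+ 3) (_ * p) (eps * lam) K1 lam0 => A B D E; lra.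
- move=> t p tT pd; rewrite /reaction1.
  have := lr_small _ _ _ _ _ loc p _ eps (pr p pd) (mu_r t tT) er'.
  have p2 : p ^+ 2 <= 1 by rewrite -(real_normK (num_real p)) expr_le1 // (le_trans pd d1).
  have p20 := sqr_ge0 p.
  have m1 := le_trans (mu_r t tT) r1.
  have : K * `|eps| <= K * 1 by apply: ler_wpM2l; [move: K1; lra|exact: le_trans er' r1].
  move: (R1 p _ _) => Y; move: (- rho + eps * t) m1 => M m1.
  have /andP[Ml Mr] : - 1 <= M <= 1 by rewrite -ler_norml.
  move: (p ^+ 2) (K * `|eps|) (`|M|) p2 p20 m1 => P E N P1 P0 N1 E1.
  rewrite !ler_norml; move: K1 lam0; lra.
- move=> t p tT pd; rewrite /reaction2.
  have := lr_b2 _ _ _ _ _ loc p _ eps (pr p pd) (mu_r t tT) er'.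
  have := le_trans pd d1; rewrite !ler_norml; move: (R2 p _ _) K1 lam0 => A; lra.
- move=> t p q tT pd qd; rewrite /reaction2.
  have := lr_lip2 _ _ _ _ _ loc p q _ eps (pr p pd) (pr q qd) (mu_r t tT) er'.
  move: (R2 p _ _) (R2 q _ _) => A B H.
  rewrite (_ : _ - _ = - 6 * (p - q) + (A - B)); last by ring.
  apply: le_trans (ler_normD _ _) _; rewrite normrM normrN (absE 6) //.
  have := normr_ge0 (p - q); have : 0 <= `|lam| * `|p - q| by rewrite mulr_ge0.
  have : 0 <= (K - 1) * `|p - q| by rewrite mulr_ge0 // subr_ge0.
  by move: H; lra.
- move=> t s p tT sT pd; rewrite /reaction.
  have := lr_mu _ _ _ _ _ loc p _ _ eps (pr p pd) (mu_r t tT) (mu_r s sT) er'.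
  rewrite (_ : - rho + eps * t - (- rho + eps * s) = eps * (t - s)); last by ring.
  move: (rem p _ _) (rem p _ _) => A B H.
  rewrite (_ : _ - _ = eps * (t - s) * p + (B - A)); last by ring.
  apply: le_trans (ler_normD _ _) _; rewrite !normrM eE in H *.
  have e1 : eps <= 1 by rewrite -eE (le_trans er' r1).
  have p1 := le_trans pd d1.
  have E : eps * `|t - s| <= `|t - s| by rewrite ler_piMl.
  have E' : eps * `|t - s| * `|p| <= `|t - s|.
    by apply: le_trans E; rewrite ler_piMr // mulr_ge0 // ltW.
  have KE : K * (eps * `|t - s|) <= K * `|t - s| by apply: ler_wpM2l => //; move: K1; lra.
  have : 0 <= `|lam| * `|t - s| by rewrite mulr_ge0.
  have : 0 <= (K - 1) * `|t - s| by rewrite mulr_ge0 // subr_ge0.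
  have := normr_ge0 (t - s).
  by move: (`|B - A|) H E' KE => D; lra.
- move=> t tT; apply: (reaction_box rho _ _ _ (mu_rho t tT) rd e0 er el).1 => //.
  by move: d0; lra.
- move=> t tT; apply: (reaction_box rho _ _ _ (mu_rho t tT) rd e0 er el).2 => //.
  by move: d0; lra.
Qed.

End Reaction.

(** * The passage from mu = - rho to mu = rho for positive lam *)

Section Passage.
Context {R : realType}.
Variables (rem R1 R2 : R -> R -> R -> R) (r K lam d rho eps s chi : R).
(** [s] is the size of the branch at mu = rho and sets the height of the barriers. The conditions
    [es3] and [es4] make mu move slowly enough for the two steeper barrier pieces to lie below the
    reaction. *)
Hypotheses (loc : local_remainder rem R1 R2 r K) (r1 : r <= 1) (K1 : 1 <= K)
  (d0 : 0 < d) (dr : 2 * d <= r) (Kd : 8 * (K * d) <= 1) (lam0 : 0 < lam)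
  (rho0 : 0 < rho) (rd : 8 * rho <= d ^+ 2) (e0 : 0 < eps) (er : eps <= rho)
  (el : 4 * (eps * (`|lam| + 1)) <= d ^+ 3)
  (s0 : 0 < s) (sE : s ^+ 2 = rho) (s1 : s <= 1) (sd : s <= d) (Ks : 16 * (K * s) <= 1)
  (Kslam : 8 * (K * s) <= lam) (lams : lam * s <= 1)
  (chi0 : 0 < chi) (chid : chi <= d) (chirho : chi <= rho) (chilam : 2 * chi <= rho * lam)
  (es3 : 90 * (100 * (s * eps)) <= lam * rho ^+ 3) (es4 : 50 * eps <= rho ^+ 2).
Implicit Types (t x y p q mu : R).

Let T := 2 * rho / eps.
Let f t p := reaction rem lam p (- rho + eps * t) eps.
Let f1 t p := reaction1 R1 p (- rho + eps * t) eps.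
Let reg := reaction_regular rem R1 R2 r K lam d loc r1 K1 d0 dr Kd rho eps rho0 rd e0 er el.
Let L := 10 + `|lam| + 7 * K.

Let rs : rho <= s. Proof. by rewrite -sE expr2 ler_piMl // ltW. Qed.
Let dr' : d <= r. Proof. by move: dr d0; lra. Qed.
Let rr : rho <= r. Proof. by apply: le_trans dr'; apply: le_trans sd; exact: rs. Qed.
Let eE : `|eps| = eps. Proof. by rewrite absE // ltW. Qed.
Let er' : `|eps| <= r. Proof. by rewrite eE (le_trans er rr). Qed.
Let K0 : 0 <= K. Proof. by move: K1; lra. Qed.
Let Krho : K * rho <= K * s. Proof. exact: ler_wpM2l. Qed.
Let Keps : K * eps <= K * rho. Proof. exact: ler_wpM2l. Qed.
Let Kchi : K * chi <= K * rho. Proof. exact: ler_wpM2l. Qed.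
Let T0 : 0 <= T. Proof. by rewrite /T divr_ge0 ?mulr_ge0 // ltW. Qed.
Let epsT : eps * T = 2 * rho. Proof. by rewrite /T; field; rewrite gt_eqF. Qed.

Let reaction_neg q mu : 0 <= q -> q <= chi -> - rho <= mu -> mu <= 0 ->
  eps * lam / 2 <= reaction rem lam (- q) mu eps.
Proof.
move=> q0 qc m1 m0.
have qE : `|- q| = q by rewrite normrN absE.
have mE : `|mu| = - mu by rewrite absNE.
have qr : `|- q| <= r by rewrite qE; apply: le_trans dr'; exact: le_trans chid.
have mr : `|mu| <= r by rewrite mE; apply: le_trans rr; rewrite lerNl.
have := lr_order _ _ _ _ _ loc _ _ _ qr mr er'; rewrite qE mE eE.
have M0 : 0 <= - mu by rewrite oppr_ge0.
have Kq : K * q <= K * chi by exact: ler_wpM2l.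
have Km : K * (- mu) <= K * rho by apply: ler_wpM2l => //; rewrite lerNl.
have h1 : K * q <= 1 / 4 by move: Kq Kchi Krho Ks; lra.
have h2 : K * (- mu) <= 1 / 2 by move: Km Krho Ks; lra.
have h3 : K * (q + - mu + eps) <= lam / 2 by rewrite !mulrDr; move: Kq Kchi Keps Km Krho Kslam lam0; lra.
have := order_negative_bound K lam eps q (- mu) K0 q0 M0 e0 h1 h2 h3.
rewrite /reaction ler_norml; have -> : (- q) ^+ 3 = - q ^+ 3 by ring.
set B := K * _; move: (rem _ _ _) B => X B; lra.
Qed.

Let reaction_pos p mu : 0 <= p -> p <= s -> 0 <= mu -> mu <= rho ->
  7 / 8 * (mu * p) - 9 / 8 * p ^+ 3 + eps * lam / 4 <= reaction rem lam p mu eps.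
Proof.
move=> p0 ps m0 m1.
have pE : `|p| = p by rewrite absE.
have mE : `|mu| = mu by rewrite absE.
have pr : `|p| <= r by rewrite pE; apply: le_trans dr'; exact: le_trans sd.
have mr : `|mu| <= r by rewrite mE; exact: le_trans rr.
have := lr_order _ _ _ _ _ loc _ _ _ pr mr er'; rewrite pE mE eE.
have Kp : K * p <= K * s by exact: ler_wpM2l.
have Km : K * mu <= K * rho by exact: ler_wpM2l.
have h1 : K * p <= 1 / 16 by move: Kp Ks; lra.
have h2 : K * mu <= 1 / 16 by move: Km Krho Ks; lra.
have h3 : K * (p + mu + eps) <= 3 * lam / 4 by rewrite !mulrDr; move: Kp Keps Km Krho Kslam lam0; lra.
have := order_positive_bound K lam eps p mu K0 p0 m0 e0 h1 h2 h3.
rewrite /reaction ler_norml; set B := K * _; move: (rem _ _ _) B => X B; lra.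
Qed.

Variables (u ux uxx : R -> R -> R).
Hypotheses (usol : classical_sol f T u ux uxx) (ui : forall x, `|u 0 x| <= chi).

Lemma passage_box t x : 0 <= t <= T -> `|u t x| <= d.
Proof.
apply: (invariant_box f T u ux uxx usol d (2 * d)).
- by move: d0; lra.
- by move=> y; apply: le_trans (ui y) chid.
- move=> w p wT /andP[p1 p2]; apply: (reaction_box _ _ _ _ _ _ _ loc r1 K1 d0 dr Kd rho _ _ _ _ rd e0 er el).1 => //.
  have /andP[w1 w2] := wT.
  have : eps * w <= eps * T by rewrite ler_wpM2l // ltW.
  have := mulr_gt0 e0 w1; rewrite epsT ler_norml; move: rho0; lra.
- move=> w p wT /andP[p1 p2]; apply: (reaction_box _ _ _ _ _ _ _ loc r1 K1 d0 dr Kd rho _ _ _ _ rd e0 er el).2 => //.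
  have /andP[w1 w2] := wT.
  have : eps * w <= eps * T by rewrite ler_wpM2l // ltW.
  have := mulr_gt0 e0 w1; rewrite epsT ler_norml; move: rho0; lra.
Qed.

Let fd t p : 0 < t < T -> `|p| <= d -> is_derive p 1 (f t) (f1 t p).
Proof. by move=> /andP[/ltW t0 /ltW tT] pd; apply: (rr_d1 _ _ _ _ _ _ reg) => //; rewrite t0. Qed.

Let f1L t p : 0 < t < T -> `|p| <= d -> f1 t p <= L.
Proof.
move=> /andP[/ltW t0 /ltW tT] pd; have tT' : 0 <= t <= T by rewrite t0.
by have := rr_b1 _ _ _ _ _ _ reg t p tT' pd; rewrite ler_norml => /andP[].
Qed.

(** [lower_barrier] in the variable mu = - rho + eps t: a slope k in mu is a speed eps k in time. *)
Let barrier (m0 m1 p0 k : R) : - rho <= m0 -> m0 < m1 -> m1 <= rho ->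
  (forall mu, m0 < mu -> mu < m1 -> `|p0 + k * (mu - m0)| <= d /\
     eps * k <= reaction rem lam (p0 + k * (mu - m0)) mu eps) ->
  (forall t x, - rho + eps * t = m0 -> p0 <= u t x) ->
  forall t x, m0 <= - rho + eps * t -> - rho + eps * t <= m1 ->
    p0 + k * (- rho + eps * t - m0) <= u t x.
Proof.
move=> m0r m01 m1r H init t x tm0 tm1.
pose a := (m0 + rho) / eps; pose b := (m1 + rho) / eps.
have aE : eps * a = m0 + rho by rewrite /a; field; rewrite gt_eqF.
have bE : eps * b = m1 + rho by rewrite /b; field; rewrite gt_eqF.
have a0 : 0 <= a by rewrite divr_ge0 ?(ltW e0) //; move: m0r; lra.
have ab : a <= b by rewrite -(ler_pM2l e0) aE bE; move: m01; lra.
have bT : b <= T by rewrite -(ler_pM2l e0) bE epsT; move: m1r; lra.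
have pE w : p0 + k * (- rho + eps * w - m0) = p0 + eps * k * (w - a).
  have -> : m0 = eps * a - rho by rewrite aE; ring.
  ring.
rewrite pE; apply: (lower_barrier f f1 T d u ux uxx usol passage_box fd L a b p0 (eps * k)) => //.
- move=> w /andP[aw wb]; rewrite -pE; apply: H.
  + by move: aw; rewrite -(ltr_pM2l e0) aE; lra.
  + by move: wb; rewrite -(ltr_pM2l e0) bE; lra.
- by move=> y; apply: init; rewrite aE; ring.
- by rewrite -(ler_pM2l e0) aE -[_ <= b](ler_pM2l e0) bE; move: tm0 tm1; lra.
Qed.

(* The barrier is piecewise linear in mu; its last piece is the tangent line of
   (mu/2)^(1/2) at mu = rho/2. *)
Lemma passage_lower t x : rho / 4 <= - rho + eps * t -> - rho + eps * t <= rho ->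
  s / 4 * (1 + 2 * (- rho + eps * t) / rho) <= u t x.
Proof.
have lamr : lam * rho <= s by rewrite -sE expr2 mulrA ler_piMl // ltW.
(* The barrier rises from - chi at mu = - rho to 0 at mu = 0. By [chilam] its speed eps chi / rho is
   at most eps lam / 2, which half of the forcing provides. *)
have b1 w y : - rho + eps * w = 0 -> 0 <= u w y.
  move=> w0; have := barrier (- rho) 0 (- chi) (chi / rho) (lexx _).
  rewrite oppr_lt0 => /(_ rho0 (ltW rho0)) H.
  have : - chi + chi / rho * (- rho + eps * w - - rho) <= u w y.
    apply: H; rewrite ?w0 ?oppr_le0 ?(ltW rho0) //; last first.
      move=> v z h; have ev : eps * v = 0 by move: h; lra.
      have -> : v = 0 by move/eqP: ev; rewrite mulf_eq0 gt_eqF //= => /eqP.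
      by have := ui z; rewrite ler_norml => /andP[].
    move=> mu m1 m2; pose q := chi * (- mu / rho).
    have -> : - chi + chi / rho * (mu - - rho) = - q by rewrite /q; field; rewrite gt_eqF.
    have z0 : 0 <= - mu / rho by rewrite divr_ge0 ?(ltW rho0) // oppr_ge0 ltW.
    have z1 : - mu / rho <= 1 by rewrite ler_pdivrMr // mul1r; move: m1; lra.
    have q0 : 0 <= q by rewrite mulr_ge0 ?(ltW chi0).
    have qc : q <= chi by rewrite /q ler_piMr ?(ltW chi0).
    split; first by rewrite normrN absE // (le_trans qc).
    apply: le_trans (reaction_neg q mu q0 qc (ltW m1) (ltW m2)).
    rewrite mulrA ler_pdivrMr //; have := ler_wpM2l (ltW e0) chilam; lra.
  rewrite w0; have -> : - chi + chi / rho * (0 - - rho) = 0 by field; rewrite gt_eqF.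
  by [].
(* On [0, rho / 5] the slope lam / 4 is paid for by a quarter of the forcing, the rest of the
   reaction being nonnegative along the barrier. This lifts u off the unstable state 0. *)
have b2 w y : - rho + eps * w = rho / 5 -> lam * rho / 20 <= u w y.
  move=> w5; have : 0 + lam / 4 * (- rho + eps * w - 0) <= u w y.
    apply: (barrier 0 (rho / 5) 0 (lam / 4)); rewrite ?w5; try (by move: rho0; lra).
      move=> mu m1 m2; rewrite subr0 add0r.
      have p0 : 0 <= lam / 4 * mu by rewrite mulr_ge0 ?(ltW m1) // divr_ge0 // ltW.
      have lm : lam * mu <= s.
        by apply: le_trans lamr; rewrite ler_wpM2l ?(ltW lam0) //; move: m2 rho0; lra.
      have ps : lam / 4 * mu <= s by move: lm s0; lra.
      split; first by rewrite absE // (le_trans ps).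
      have mr : mu <= rho by move: m2 rho0; lra.
      apply: le_trans (reaction_pos _ mu p0 ps (ltW m1) mr).
      have -> : eps * (lam / 4) = eps * lam / 4 by ring.
      rewrite -subr_ge0 addrK exprSr.
      have -> : 7 / 8 * (mu * (lam / 4 * mu)) - 9 / 8 * ((lam / 4 * mu) ^+ 2 * (lam / 4 * mu)) =
        (7 / 8 * mu - 9 / 8 * (lam / 4 * mu) ^+ 2) * (lam / 4 * mu) by ring.
      rewrite mulr_ge0 //.
      have : lam * (lam * mu) <= lam * s by rewrite ler_wpM2l // ltW.
      move=> h; have h1 : lam * (lam * mu) <= 1 by exact: le_trans lams.
      have -> : (lam / 4 * mu) ^+ 2 = lam * (lam * mu) * mu / 16 by field.
      have := ler_wpM2r (ltW m1) h1; move: (lam * (lam * mu) * mu) => A; move: m1; lra.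
    by move=> v z v0; exact: b1.
  by rewrite w5; lra.
(* On [rho / 5, rho / 4] the linear growth takes over: while p <= 3 s / 8, the growth rate 7 mu / 8
   - 9 p^2 / 8 is at least rho / 60, and [es3] makes this enough. The tangent line of the last piece
   has the value 3 s / 8 at mu = rho / 4. *)
have b3 w y : - rho + eps * w = rho / 4 -> 3 / 8 * s <= u w y.
  move=> w4; pose k := (3 / 8 * s - lam * rho / 20) * 20 / rho.
  have : lam * rho / 20 + k * (- rho + eps * w - rho / 5) <= u w y.
    apply: (barrier (rho / 5) (rho / 4) (lam * rho / 20) k) => //; rewrite ?w4;
      try (by move: rho0; lra).
    move=> mu m1 m2.
    have k0 : 0 <= k.
      by rewrite divr_ge0 ?(ltW rho0) // mulr_ge0 //; move: lamr s0; lra.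
    have krho : k * (rho / 20) = 3 / 8 * s - lam * rho / 20.
      by rewrite /k; field; rewrite gt_eqF.
    have plo : 0 <= k * (mu - rho / 5) by rewrite mulr_ge0 // subr_ge0 ltW.
    have phi_ : k * (mu - rho / 5) <= k * (rho / 20).
      by rewrite ler_wpM2l //; move: m2; lra.
    set p := lam * rho / 20 + k * (mu - rho / 5).
    have lr0 : 0 < lam * rho by exact: mulr_gt0.
    have p1 : lam * rho / 20 <= p by rewrite /p; lra.
    have p2 : p <= 3 / 8 * s by rewrite /p; move: phi_; rewrite krho; lra.
    have p0 : 0 <= p by lra.
    have ps : p <= s by move: s0; lra.
    have mu0 : 0 <= mu by move: m1 rho0; lra.
    have mr : mu <= rho by move: m2 rho0; lra.
    split; first by rewrite absE // (le_trans ps).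
    apply: le_trans (reaction_pos p mu p0 ps mu0 mr).
    have pp : p ^+ 2 <= 9 / 64 * rho.
      rewrite -sE (_ : 9 / 64 * s ^+ 2 = (3 / 8 * s) ^+ 2); last by field.
      by rewrite lerXn2r ?nnegrE // (le_trans p0).
    have c0 : rho / 60 <= 7 / 8 * mu - 9 / 8 * p ^+ 2 by move: pp m1 rho0; lra.
    have -> : 7 / 8 * (mu * p) - 9 / 8 * p ^+ 3 = (7 / 8 * mu - 9 / 8 * p ^+ 2) * p by rewrite exprSr; ring.
    have A1 : rho / 60 * (lam * rho / 20) <= (7 / 8 * mu - 9 / 8 * p ^+ 2) * p.
      by apply: ler_pM => //; move: lr0 rho0; lra.
    have A2 : eps * k <= rho / 60 * (lam * rho / 20).
      have : eps * k <= eps * (3 / 8 * s * 20 / rho).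
        rewrite ler_wpM2l ?(ltW e0) // /k -![_ * 20 / rho]mulrA ler_wpM2r //.
          by rewrite divr_ge0 // ltW.
        by move: lr0; lra.
      move=> h; apply: le_trans h _.
      have -> : eps * (3 / 8 * s * 20 / rho) = 15 / 2 * (s * eps) / rho by field; rewrite gt_eqF.
      rewrite ler_pdivrMr //.
      have -> : rho / 60 * (lam * rho / 20) * rho = lam * rho ^+ 3 / (60 * 20) by field.
      by move: es3; move: (s * eps) (lam * rho ^+ 3) => A B; lra.
    have : 0 <= eps * lam by rewrite mulr_ge0 // ltW.
    by move: A1 A2; lra.
  by rewrite w4 /k; have -> : lam * rho / 20 + (3 / 8 * s - lam * rho / 20) * 20 / rho * (rho / 4 - rho / 5)
    = 3 / 8 * s by field; rewrite gt_eqF.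
move=> tm tr.
have : 3 / 8 * s + s / (2 * rho) * (- rho + eps * t - rho / 4) <= u t x.
  apply: (barrier (rho / 4) rho) => //; try (by move: rho0; lra).
  move=> mu m1 m2.
  set p := 3 / 8 * s + s / (2 * rho) * (mu - rho / 4).
  have pE : p = s / 4 * (1 + 2 * mu / rho) by rewrite /p; field; rewrite gt_eqF.
  have z1 : 1 / 4 <= mu / rho by rewrite ler_pdivlMr //; move: m1; lra.
  have z2 : mu / rho <= 1 by rewrite ler_pdivrMr // mul1r ltW.
  have pz : p = s / 4 * (1 + 2 * (mu / rho)) by rewrite pE mulrA.
  have p1 : 3 / 8 * s <= p.
    by rewrite pz; have := ler_wpM2l (ltW s0) z1; lra.
  have p2 : p <= 3 / 4 * s.
    by rewrite pz; have := ler_wpM2l (ltW s0) z2; lra.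
  have p0 : 0 <= p by move: s0 p1; lra.
  have ps : p <= s by move: s0 p2; lra.
  have mu0 : 0 <= mu by move: m1 rho0; lra.
  split; first by rewrite absE // (le_trans ps).
  apply: le_trans (reaction_pos p mu p0 ps mu0 (ltW m2)).
  (* On [1/4, 1] one has (1 + 2 z)^2 / 16 <= 2 z / 3, so the line stays far enough below the branch
     to leave the growth rate mu / 8. *)
  have pp : p ^+ 2 <= 2 / 3 * mu.
    have -> : mu = s ^+ 2 * (mu / rho) by rewrite sE; field; rewrite gt_eqF.
    rewrite pz exprMn; move: z1 z2; move: (mu / rho) => z z1 z2.
    have : (1 + 2 * z) ^+ 2 / 16 <= 2 / 3 * z by nra.
    by move=> /(ler_wpM2l (sqr_ge0 s)); lra.
  have -> : 7 / 8 * (mu * p) - 9 / 8 * p ^+ 3 = (7 / 8 * mu - 9 / 8 * p ^+ 2) * p by rewrite exprSr; ring.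
  have A1 : rho / 4 / 8 * (3 / 8 * s) <= (7 / 8 * mu - 9 / 8 * p ^+ 2) * p.
    apply: ler_pM; [by move: rho0; lra|by move: s0; lra| |exact: p1].
    by move: pp m1; move: (p ^+ 2) => P; lra.
  have A2 : eps * (s / (2 * rho)) <= rho / 4 / 8 * (3 / 8 * s).
    rewrite mulrA ler_pdivrMr ?mulr_gt0 //.
    by have := ler_wpM2r (ltW s0) es4; have := mulr_ge0 (ltW s0) (sqr_ge0 rho); lra.
  have : 0 <= eps * lam by rewrite mulr_ge0 // ltW.
  by move: A1 A2; lra.
apply: le_trans; rewrite le_eqVlt; apply/orP; left; apply/eqP; field; rewrite gt_eqF //.
Qed.

(** The tangent line lies above the concave function (mu / 2)^(1/2); with z = mu / rho this is (1 -
    2 z)^2 >= 0. *)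
Let lower_sq mu p : 0 <= mu -> s / 4 * (1 + 2 * mu / rho) <= p -> 0 <= p /\ mu / 2 <= p ^+ 2.
Proof.
move=> m0 H; have z0 : 0 <= mu / rho by rewrite divr_ge0 // ltW.
have q0 : 0 <= s / 4 * (1 + 2 * mu / rho).
  by rewrite mulr_ge0 // ?divr_ge0 ?(ltW s0) // addr_ge0 // -mulrA mulr_ge0.
have p0 := le_trans q0 H; split=> //.
have : (s / 4 * (1 + 2 * mu / rho)) ^+ 2 <= p ^+ 2 by rewrite lerXn2r ?nnegrE.
apply: le_trans; have -> : mu / 2 = s ^+ 2 * (mu / rho) / 2 by rewrite sE; field; rewrite gt_eqF.
have -> : (s / 4 * (1 + 2 * mu / rho)) ^+ 2 = s ^+ 2 * ((1 + 2 * (mu / rho)) ^+ 2 / 16) by field; rewrite gt_eqF.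
rewrite -mulrA ler_wpM2l ?sqr_ge0 //; move: (mu / rho) z0 => z z0.
have := sqr_ge0 (1 - 2 * z); lra.
Qed.

Let mu_T t : 0 < t < T -> - rho < - rho + eps * t < rho.
Proof.
move=> /andP[t0 tT]; have := mulr_gt0 e0 t0.
have : eps * t < eps * T by rewrite ltr_pM2l.
rewrite epsT; lra.
Qed.

Let btw_lower mu p q w : 0 <= mu -> 0 <= p -> mu / 2 <= p ^+ 2 -> 0 <= q -> mu / 2 <= q ^+ 2 ->
  Num.min p q <= w <= Num.max p q -> mu / 2 <= w ^+ 2.
Proof.
move=> m0 p0 p2 q0 q2; have [pq|qp] := leP p q => /andP[w1 w2].
  by apply: le_trans p2 _; rewrite lerXn2r ?nnegrE // (le_trans p0).
by apply: le_trans q2 _; rewrite lerXn2r ?nnegrE // (le_trans q0).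
Qed.

(* With y = 1 + mu / rho, the function rho * Q y is a quadratic majorant of the
   slope of the reaction along the solution, and its primitive P satisfies
   P y <= - y / 200 on [0, 2]. *)
Let P y : R := - (47 / 50) * y + 4 / 5 * y ^+ 2 - y ^+ 3 / 6.
Let Q y : R := - (47 / 50) + 8 / 5 * y - y ^+ 2 / 2.
Let E t : R := rho ^+ 2 / eps * P (eps * t / rho) + K * eps * t.
Let dE t : R := rho * Q (eps * t / rho) + K * eps.
(** The inverse width of the weight. The rate given up for localisation is 6 dd^2 = rho / 100, small
    enough for [Q] to remain a majorant. *)
Let dd : R := Num.sqrt (rho / 600).

Let Ed t : is_derive t 1 E (dE t).
Proof.
have yd : is_derive t 1 (fun t => eps * t / rho) (eps / rho).
  apply: (derE (derM (derZ eps (der_id t)) (der_cst rho^-1 t))).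
  by rewrite mulr1 mulr0 addr0.
apply: (derE (derD (derZ (rho ^+ 2 / eps) (derB (derD (derZ (- (47 / 50)) yd)
  (derZ (4 / 5) (derX 2 yd))) (derM (derX 3 yd) (der_cst 6^-1 t)))) (derZ (K * eps) (der_id t)))).
by rewrite /dE /Q /= expr1; field; rewrite !gt_eqF.
Qed.

Let rho600 : 0 < rho / 600. Proof. by move: rho0; lra. Qed.

Let dd2 : dd ^+ 2 = rho / 600.
Proof. exact: sqr_sqrtr (ltW rho600). Qed.

Let dd0 : 0 < dd.
Proof. by rewrite sqrtr_gt0. Qed.

Let dd1 : 0 <= dd <= 1.
Proof.
rewrite (ltW dd0) /= -(@expr_le1 _ 2) ?(ltW dd0) // dd2.
by move: rs s1 rho0; lra.
Qed.

Let rate t x y p : 0 < t < T -> Num.min (u t x) (u t y) <= p <= Num.max (u t x) (u t y) ->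
  f1 t p <= dE t - 6 * dd ^+ 2.
Proof.
move=> tT pb; have /andP[m1 m2] := mu_T t tT.
have tT' : 0 <= t <= T by case/andP: tT => /ltW -> /ltW ->.
have pd : `|p| <= r := le_trans (btw_box T d u passage_box t x y p tT' pb) dr'.
have mr : `|- rho + eps * t| <= r by apply: le_trans rr; rewrite ler_norml !ltW.
apply: le_trans (reaction1_le _ _ _ _ _ loc p _ _ pd mr er') _.
rewrite dd2 eE /dE; pose m := - 1 + eps * t / rho.
have mE : - rho + eps * t = rho * m by rewrite /m; field; rewrite gt_eqF.
have -> : eps * t / rho = m + 1 by rewrite /m; ring.
rewrite mE in m1 m2 *.
have m1' : -1 < m by rewrite -(ltr_pM2l rho0) mulrN1.
have m2' : m < 1 by rewrite -(ltr_pM2l rho0) mulr1.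
rewrite normrM (absE rho) ?(ltW rho0) //.
have QE : rho * Q (m + 1) - 6 * (rho / 600) = rho * (3 / 20 + 3 / 5 * m - m ^+ 2 / 2).
  by rewrite /Q; field.
suff : rho * m + rho * `|m| / 100 - 299 / 100 * p ^+ 2 <= rho * (3 / 20 + 3 / 5 * m - m ^+ 2 / 2).
  by rewrite -QE; move: (rho * Q _) (K * eps) (rho * `|m|) (p ^+ 2) (rho * m) => A B D G H; lra.
(* Up to mu = rho / 4 the term - p^2 is dropped; afterwards p^2 >= mu / 2 makes the slope of the
   reaction negative up to the term K eps. *)
have [m4|m4] := leP m (1 / 4).
  apply: (@le_trans _ _ (rho * (m + `|m| / 100))).
    by have := sqr_ge0 p; move: (p ^+ 2) => G G0; lra.
  rewrite ler_wpM2l ?(ltW rho0) //; have [mneg|mpos] := leP m 0.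
    by rewrite (absNE m) //; move: m1' mneg; clear m1 m2 m2' m4 QE mE; nra.
  by rewrite (absE m) ?(ltW mpos) //; move: mpos m4; clear m1 m2 m2' m1' QE mE; nra.
have m0 : 0 <= m by lra.
rewrite (absE m) //.
have rm : rho / 4 <= - rho + eps * t by rewrite mE; have := ler_wpM2l (ltW rho0) (ltW m4); lra.
have rmr : - rho + eps * t <= rho by rewrite mE ltW.
have mr0 : 0 <= - rho + eps * t by rewrite mE mulr_ge0 // ltW.
have [p0 p2] := lower_sq _ _ mr0 (passage_lower t x rm rmr).
have [q0 q2] := lower_sq _ _ mr0 (passage_lower t y rm rmr).
have := btw_lower _ _ _ _ mr0 p0 p2 q0 q2 pb; rewrite mE => w2.
apply: (@le_trans _ _ 0).
  by move: w2 mr0; rewrite mE; move: (rho * m) (p ^+ 2) => A B; lra.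
by rewrite mulr_ge0 ?(ltW rho0) //; move: m4 m2'; clear m1 m2 m1' QE mE; nra.
Qed.

Let P_le y : 0 <= y -> y <= 2 -> P y <= - (y / 200).
Proof.
move=> y0 y2; rewrite /P -subr_ge0.
have -> : - (y / 200) - (- (47 / 50) * y + 4 / 5 * y ^+ 2 - y ^+ 3 / 6)
  = y * ((2 - y) * (2 - y + 4 / 5) / 6 + 1 / 600) by field.
have y2' : 0 <= 2 - y by rewrite subr_ge0.
apply: (mulr_ge0 y0); apply: addr_ge0; last by rewrite mul1r invr_ge0 ler0n.
apply: mulr_ge0; last by rewrite invr_ge0 ler0n.
by apply: (mulr_ge0 y2'); apply: (addr_ge0 y2'); apply: divr_ge0; rewrite ler0n.
Qed.

Let E_le t : 0 <= t <= T -> E t <= - (rho * t / 200) + 2 * K * rho.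
Proof.
move=> /andP[t0 tT].
have y0 : 0 <= eps * t / rho by rewrite divr_ge0 ?mulr_ge0 // ltW.
have et : eps * t <= 2 * rho by rewrite -epsT ler_wpM2l // ltW.
have y2 : eps * t / rho <= 2 by rewrite ler_pdivrMr.
have re : 0 <= rho ^+ 2 / eps by rewrite divr_ge0 ?sqr_ge0 // ltW.
have := ler_wpM2l re (P_le _ y0 y2); rewrite /E.
have -> : rho ^+ 2 / eps * - (eps * t / rho / 200) = - (rho * t / 200).
  by field; rewrite !gt_eqF.
have : K * (eps * t) <= K * (2 * rho) by rewrite ler_wpM2l.
by move: (rho ^+ 2 / eps * P _) (rho * t) => A B; rewrite -mulrA; lra.
Qed.

Hypotheses (i1 : forall x, `|ux 0 x| * (1 + `|x|) <= chi)
  (i2 : forall x, `|uxx 0 x| * (1 + x ^+ 2) <= chi)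
  (uxxc : forall t x, 0 <= t <= T -> {for x, continuous (uxx t)}).

(** [E T] is at most - 2 X plus a constant. One half is the decay that is kept; the other absorbs
    the factor [T] in the bound of the second derivative, [T] being a multiple of X. *)
Let X := rho ^+ 2 / (200 * eps).
Let EM := expR (2 * K * rho).

Lemma passage_derivatives x :
  `|(1 + `|x|) * ux T x| <= 4 * chi * EM / dd * expR (- X) /\
  `|(1 + x ^+ 2) * uxx T x| <=
     (6 * chi + 12 * L * chi ^+ 2 * EM * (400 / rho)) * EM / dd ^+ 2 * expR (- X).
Proof.
have L0 : 0 <= L by rewrite /L; have := normr_ge0 lam; move: K0; lra.
have TT : 0 <= T <= T by rewrite T0 lexx.
have f1lip t p q : 0 < t < T -> `|p| <= d -> `|q| <= d -> `|f1 t p - f1 t q| <= L * `|p - q|.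
  move=> tT; apply: (f1_lip _ _ _ _ _ _ reg).
  by case/andP: tT => /ltW -> /ltW ->.
have E0 : E 0 = 0 by rewrite /E /P !mulr0 mul0r; ring.
have EK t : 0 < t < T -> dE t <= 3 * rho + K * eps.
  move=> /andP[/ltW t0 /ltW tT]; rewrite /dE lerD2r mulrC ler_wpM2r ?(ltW rho0) //.
  have y2 : eps * t / rho <= 2 by rewrite ler_pdivrMr // -epsT ler_wpM2l // ltW.
  by rewrite /Q; move: (eps * t / rho) y2 => y y2; have := sqr_ge0 y; lra.
have EEM t : 0 <= t <= T -> expR (E t) <= EM.
  move=> tT; rewrite /EM ler_expR; apply: le_trans (E_le t tT) _.
  have : 0 <= rho * t by rewrite mulr_ge0 ?(ltW rho0) //; case/andP: tT.
  by lra.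
have [H1 H2] := weighted_derivatives f f1 T d (3 * rho + K * eps) L chi dd EM u ux uxx E dE
  T0 usol passage_box fd f1lip E0 Ed EK rate dd1 (ltW chi0) L0 i1 i2 EEM T x dd0 TT (uxxc T x TT).
have e200 : 0 < 200 * eps by move: e0; lra.
have c400 : 0 <= 400 / rho by apply: divr_ge0 (ltW rho0); lra.
have X0 : 0 <= X := divr_ge0 (sqr_ge0 rho) (ltW e200).
have EM0 : 0 < EM := expR_gt0 _.
have ET : expR (E T) <= EM * expR (- X) * expR (- X).
  rewrite -!expRD ler_expR; apply: le_trans (E_le T TT) _.
  have -> : rho * T / 200 = X + X by rewrite /X /T; field; rewrite gt_eqF.
  by move: (2 * K * rho) => A; lra.
have eX1 : expR (- X) <= 1 by rewrite -expR0 ler_expR oppr_le0.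
have eX0 := expR_gt0 (- X).
have XeX : X * expR (- X) <= 1.
  rewrite expRN ler_pdivrMr ?expR_gt0 // mul1r.
  by have := expR_ge1Dx X; lra.
have TX : T = 400 / rho * X by rewrite /T /X; field; rewrite !gt_eqF.
have ET1 : expR (E T) <= EM * expR (- X).
  by apply: le_trans ET _; apply: ler_piMr eX1; exact: mulr_ge0 (ltW EM0) (ltW eX0).
have ET2 : T * expR (E T) <= 400 / rho * EM * expR (- X).
  have : T * expR (E T) <= T * (EM * expR (- X) * expR (- X)) by rewrite ler_wpM2l.
  move/le_trans; apply; rewrite TX.
  have -> : 400 / rho * X * (EM * expR (- X) * expR (- X)) =
    400 / rho * EM * expR (- X) * (X * expR (- X)) by ring.
  apply: ler_piMr XeX; apply: mulr_ge0 (ltW eX0); exact: mulr_ge0 c400 (ltW EM0).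
split.
  apply: le_trans H1 _.
  have -> : 4 * chi * EM / dd * expR (- X) = 4 * chi / dd * (EM * expR (- X)) by ring.
  have -> : 4 * chi * expR (E T) / dd = 4 * chi / dd * expR (E T) by ring.
  apply: ler_wpM2l ET1; apply: divr_ge0 (ltW dd0); exact: mulr_ge0 (ltW chi0).
apply: le_trans H2 _.
have -> : (6 * chi + 12 * L * chi ^+ 2 * EM * (400 / rho)) * EM / dd ^+ 2 * expR (- X) =
   (6 * chi * (EM * expR (- X)) + 12 * L * chi ^+ 2 * EM * (400 / rho * EM * expR (- X))) / dd ^+ 2 by ring.
rewrite ler_wpM2r ?invr_ge0 ?sqr_ge0 //.
have -> : (6 * chi + 12 * L * chi ^+ 2 * EM * T) * expR (E T) =
  6 * chi * expR (E T) + 12 * L * chi ^+ 2 * EM * (T * expR (E T)) by ring.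
apply: lerD; first by apply: ler_wpM2l ET1; exact: mulr_ge0 (ltW chi0).
apply: ler_wpM2l ET2; apply: mulr_ge0 (ltW EM0); apply: mulr_ge0 (sqr_ge0 chi).
exact: mulr_ge0.
Qed.

Lemma passage_contraction (a b : R) (phi : R -> R) x : 0 < a -> a < rho -> rho < b ->
  5 * (K * eps) <= a ->
  (forall t, a < eps * t < b ->
     is_derive t 1 (fun t => phi (eps * t)) (reaction rem lam (phi (eps * t)) (eps * t) eps)) ->
  (forall mu, a < mu < b -> [/\ 0 <= phi mu, phi mu <= d & mu / 2 <= phi mu ^+ 2]) ->
  `|u T x - phi rho| <= 2 * d * expR (- (a * (rho - a) / (10 * eps))).
Proof.
move=> a0 ar rb Ka phid phib.
(* The comparison starts at mu = (a + rho) / 2: strictly above a, where the slow manifold is an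
   orbit, and above rho / 4, where [passage_lower] holds. The rate a / 5 over the remaining time
   (rho - a) / (2 eps) gives the exponent. *)
pose ts := ((a + rho) / 2 + rho) / eps.
have tsE : eps * ts = (a + rho) / 2 + rho by rewrite /ts; field; rewrite gt_eqF.
have ts0 : 0 <= ts by rewrite divr_ge0 ?(ltW e0) //; move: a0 rho0; lra.
have tsT : ts <= T by rewrite -(ler_pM2l e0) tsE epsT; move: ar; lra.
have TT : ts <= T <= T by rewrite tsT lexx.
have mu_in t : ts <= t <= T -> (a + rho) / 2 <= - rho + eps * t <= rho.
  move=> /andP[]; rewrite -(ler_pM2l e0) tsE -(ler_pM2l e0 t) epsT; lra.
have mu_ab t : ts <= t <= T -> a < - rho + eps * t < b.
  by move=> /mu_in; move: ar rb; lra.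
pose psi t := phi (- rho + eps * t).
have psid t : ts <= t <= T -> is_derive t 1 psi (f t (psi t)) /\ `|psi t| <= d.
  move=> tT; have m := mu_ab t tT; have [h1 h2 _] := phib _ m.
  split; last by rewrite absE.
  have E1 w : eps * (w + - rho / eps) = - rho + eps * w by field; rewrite gt_eqF.
  have Eg : (fun w => phi (eps * (w + - rho / eps))) =1 psi by move=> w; rewrite E1.
  have m' : a < eps * (t + - rho / eps) < b by rewrite E1.
  by apply: (derE (der_ext Eg (der_shift (- rho / eps) (phid _ m')))); rewrite E1.
have rate' t y p : ts < t < T -> Num.min (psi t) (u t y) <= p <= Num.max (psi t) (u t y) ->
    f1 t p <= - (a / 5).
  move=> /andP[/ltW t1 /ltW t2] pb; have tT : ts <= t <= T by rewrite t1.
  have [h1 h2 h3] := phib _ (mu_ab t tT); have /andP[m1 m2] := mu_in t tT.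
  have m0 : 0 <= - rho + eps * t by move: m1 a0 rho0; lra.
  have m4 : rho / 4 <= - rho + eps * t by move: m1 a0 rho0; lra.
  have tT' : 0 <= t <= T by rewrite (le_trans ts0).
  have [q0 q2] := lower_sq _ _ m0 (passage_lower t y m4 m2).
  have w2 := btw_lower _ _ _ _ m0 h1 h3 q0 q2 pb.
  have psir : `|psi t| <= d by rewrite absE.
  have pd : `|p| <= r := le_trans (secant_box d t _ _ p pb psir (passage_box t y tT')) dr'.
  have mr : `|- rho + eps * t| <= r by rewrite absE //; exact: le_trans rr.
  (* With p^2 >= mu / 2, mu >= a and K eps <= a / 5 the slope is at most - 97 mu / 200 + a / 5,
     hence at most - a / 5. *)
  apply: le_trans (reaction1_le _ _ _ _ _ loc p _ _ pd mr er') _.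
  rewrite eE (absE _ m0); move: (- rho + eps * t) (p ^+ 2) (K * eps) w2 m1 Ka => m B D w2 m1 Ka'.
  by move: a0 ar; lra.
have := contraction f f1 T d u ux uxx usol passage_box fd ts T (a / 5) psi ts0 tsT (lexx _)
  psid rate' T x TT.
rewrite /psi (_ : - rho + eps * T = rho); last by rewrite epsT; ring.
have -> : - (a / 5) * (T - ts) = - (a * (rho - a) / (10 * eps)).
  by rewrite /T /ts; field; rewrite gt_eqF.
by [].
Qed.

End Passage.

(** * Existence in the weighted space, and the reflected remainder *)

Section Main.
Context {R : realType}.
Implicit Types (rem : R -> R -> R -> R) (r K lam C a b d rho chi eps t x y p q e : R).

Record small_parameters r K lam d rho chi eps : Prop := {
  sp_d : 0 < d; sp_dr : 2 * d <= r; sp_Kd : 8 * (K * d) <= 1;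
  sp_rho : 0 < rho; sp_rhod : 8 * rho <= d ^+ 2; sp_chi : 0 < chi; sp_chid : chi <= d;
  sp_eps : 0 < eps; sp_epsr : eps <= rho; sp_epsl : 4 * (eps * (`|lam| + 1)) <= d ^+ 3 }.

Lemma local_remainder_opp rem (R1 R2 : R -> R -> R -> R) r K : local_remainder rem R1 R2 r K ->
  local_remainder (fun u mu eps => - rem (- u) mu eps) (fun u mu eps => R1 (- u) mu eps)
    (fun u mu eps => - R2 (- u) mu eps) r K.
Proof.
move=> [h1 h2 h3 h4 h5 h6 h7]; split.
- move=> u mu eps ur mr er; rewrite -normrN in ur.
  apply: (derE (derN (der_comp (g := fun u => - u) (h1 _ _ _ ur mr er) (derN (der_id u))))).
  by rewrite mulrN1 opprK.
- move=> u mu eps ur mr er; rewrite -normrN in ur.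
  apply: (derE (der_comp (g := fun u => - u) (h2 _ _ _ ur mr er) (derN (der_id u)))).
  by rewrite mulrN1.
- by move=> u mu eps ur mr er; rewrite normrN; apply: h3; rewrite ?normrN.
- move=> u v mu eps ur vr mr er; rewrite -opprD normrN.
  by apply: le_trans (h4 _ _ _ _ _ _ mr er) _; rewrite ?normrN // -opprD normrN.
- move=> u mu nu eps ur mr nr er; rewrite -opprD normrN.
  by apply: h5; rewrite ?normrN.
- by move=> u mu eps ur mr er; rewrite normrN; have := h6 (- u) mu eps; rewrite normrN; apply.
- by move=> u mu eps ur mr er; have := h7 (- u) mu eps; rewrite normrN sqrrN; apply.
Qed.

(** The scheme bounds the derivatives only uniformly in x. Membership in the weighted space comes
    from [weighted_derivatives] with d = 1 and the crude rate L + 6, as growth in time is harmless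
    here. *)
Lemma passage_existence rem (R1 R2 : R -> R -> R -> R) r K lam d rho chi eps (u0 : R -> R) :
  local_remainder rem R1 R2 r K -> r <= 1 -> 1 <= K ->
  small_parameters r K lam d rho chi eps -> Ztilde u0 -> (Znorm u0 <= chi%:E)%E ->
  exists (u : R -> R -> R) (m : R -> R),
    [/\ pde_solution rem lam eps (2 * rho / eps) u m, u 0 = u0 & m 0 = - rho].
Proof.
move=> loc r1 K1 [d0 dr Kd rho0 rd chi0 chid e0 er el] [Cu _] Zu.
have reg := reaction_regular rem R1 R2 r K lam d loc r1 K1 d0 dr Kd rho eps rho0 rd e0 er el.
set T := 2 * rho / eps in reg *; set L := 10 + `|lam| + 7 * K in reg.
set f := (fun t p : R => reaction _ _ _ _ _) in reg; set f1 := (fun t p : R => reaction1 _ _ _ _) in reg.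
set f2 := (fun t p : R => reaction2 _ _ _ _) in reg.
have T0 : 0 <= T by rewrite divr_ge0 ?mulr_ge0 // ltW.
have L0 : 0 <= L by rewrite /L; have := normr_ge0 lam; lra.
have Zb := Znorm_leP u0 chi Zu.
have one_le x : 1 <= 1 + `|x| by rewrite lerDl.
have one_le2 x : 1 <= 1 + x ^+ 2 by rewrite lerDl sqr_ge0.
have dat : regular_data u0 (derive1 u0) (derive1n 2 u0) d chi chi.
  split=> x; have [z1 z2 z3] := Zb x; have [c1 c2] := Cbunif_der u0 x Cu => //.
  - exact: le_trans z1 chid.
  - by apply: le_trans z2; rewrite normrM ler_peMl // (le_trans (one_le x) (ler_norm _)).
  - by apply: le_trans z3; rewrite normrM ler_peMl // (le_trans (one_le2 x) (ler_norm _)).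
have w0uc e : 0 < e -> exists2 dl : R, 0 < dl & forall x y : R, `|y - x| <= dl ->
    `|derive1n 2 u0 y - derive1n 2 u0 x| <= e.
  by move=> ep; case: Cu => _ /(_ 2%N isT)[_] /unif_continuousP /(_ e ep).
have [u [ux [uxx [usol uu0 ub [M0 HM0] uxxc]]]] :=
  semilinear_existence f f1 f2 T d L u0 (derive1 u0) (derive1n 2 u0) chi chi T0 (ltW d0) L0 reg dat w0uc.
have T00 : 0 <= (0 : R) <= T by rewrite lexx.
have ux0 x : ux 0 x = derive1 u0 x.
  by apply: der_uniq (cs_d1 _ _ _ _ _ usol 0 x T00) _; rewrite uu0; exact: (Cbunif_der u0 x Cu).1.
have uxx0 x : uxx 0 x = derive1n 2 u0 x.
  apply: der_uniq (cs_d2 _ _ _ _ _ usol 0 x T00) _.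
  by rewrite (funext ux0); exact: (Cbunif_der u0 x Cu).2.
exists u, (fun t => - rho + eps * t); split=> //; last by rewrite mulr0 addr0.
have uxxuc t : 0 <= t <= T -> unif_continuous (uxx t).
  move=> tT; apply/unif_continuousP => e ep; have [dl dl0 H] := uxxc e ep.
  by exists dl => // x y; exact: H.
have uxxcc t x : 0 <= t <= T -> {for x, continuous (uxx t)}.
  move=> tT; apply/cvgrPdist_le => e ep; have [dl dl0 H] := uxxc e ep.
  apply/nbhs_ballP; exists dl => //= y; rewrite /ball /= distrC => /ltW yx.
  by rewrite distrC; exact: H.
apply: (classical_pde rem lam eps T (- rho) u ux uxx usol _ uxxuc).
pose E t := (L + 6) * t; pose EM := expR ((L + 6) * T).
have L6 : 0 <= L + 6 by lra.
have Ed t : is_derive t 1 E (L + 6).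
  by apply: (derE (derZ (L + 6) (der_id t))); rewrite mulr1.
have fd t p : 0 < t < T -> `|p| <= d -> is_derive p 1 (f t) (f1 t p).
  by move=> /andP[/ltW t0 /ltW tT]; apply: (rr_d1 _ _ _ _ _ _ reg); rewrite t0.
have f1lip t p q : 0 < t < T -> `|p| <= d -> `|q| <= d -> `|f1 t p - f1 t q| <= L * `|p - q|.
  by move=> /andP[/ltW t0 /ltW tT]; apply: (f1_lip _ _ _ _ _ _ reg); rewrite t0.
have HE t x y p : 0 < t < T -> Num.min (u t x) (u t y) <= p <= Num.max (u t x) (u t y) ->
    f1 t p <= L + 6 - 6 * 1 ^+ 2.
  move=> /andP[/ltW t0 /ltW tT] pb; have tT' : 0 <= t <= T by rewrite t0.
  have := rr_b1 _ _ _ _ _ _ reg t p tT' (btw_box T d u ub t x y p tT' pb).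
  by rewrite ler_norml expr1n mulr1 addrK => /andP[].
have E0 : E 0 = 0 by rewrite /E mulr0.
have EK t : 0 < t < T -> L + 6 <= L + 6 by [].
have EEM t : 0 <= t <= T -> expR (E t) <= EM.
  by move=> /andP[_ tT]; rewrite ler_expR ler_wpM2l.
have one01 : 0 <= (1 : R) <= 1 by rewrite ler01 lexx.
have i1 x : `|ux 0 x| * (1 + `|x|) <= chi.
  rewrite ux0; have [_ + _] := Zb x.
  by rewrite normrM mulrC (absE (1 + `|x|)) // (le_trans ler01 (one_le x)).
have i2 x : `|uxx 0 x| * (1 + x ^+ 2) <= chi.
  rewrite uxx0; have [_ _] := Zb x.
  by rewrite normrM mulrC (absE (1 + x ^+ 2)) // (le_trans ler01 (one_le2 x)).
have EM0 : 0 <= EM := expR_ge0 _.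
have A0 : 0 <= 12 * L * chi ^+ 2 * EM.
  by apply: mulr_ge0 EM0; apply: mulr_ge0 (sqr_ge0 chi); exact: mulr_ge0.
pose M1 := 4 * chi * EM; pose M2 := (6 * chi + 12 * L * chi ^+ 2 * EM * T) * EM.
have M10 : 0 <= M1 by apply: mulr_ge0 EM0; exact: mulr_ge0 (ltW chi0).
have M20 : 0 <= M2.
  by apply: mulr_ge0 EM0; apply: addr_ge0; [exact: mulr_ge0 (ltW chi0)|exact: mulr_ge0].
exists (d + M1 + M2) => t x tT.
have [H1 H2] := weighted_derivatives f f1 T d (L + 6) L chi 1 EM u ux uxx E (fun=> L + 6)
  T0 usol ub fd f1lip E0 Ed EK HE one01 (ltW chi0) L0 i1 i2 EEM t x ltr01 tT (uxxcc t x tT).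
have Et := EEM t tT; have Et0 := expR_ge0 (E t).
rewrite expr1n divr1 in H2; rewrite divr1 in H1.
split.
- by apply: le_trans (ub t x tT) _; rewrite -addrA lerDl addr_ge0.
- apply: le_trans H1 _; apply: (@le_trans _ _ M1).
    by apply: ler_wpM2l Et; exact: mulr_ge0 (ltW chi0).
  by rewrite addrAC lerDr addr_ge0 // ltW.
- apply: le_trans H2 _; apply: (@le_trans _ _ M2).
    have /andP[t0 tT'] := tT.
    apply: ler_pM Et => //; first by apply: addr_ge0; [exact: mulr_ge0 (ltW chi0)|exact: mulr_ge0].
    by rewrite lerD2l ler_wpM2l.
  by rewrite lerDr addr_ge0 // ltW.
Qed.

End Main.

(** * Choice of the constants *)

Section Attraction.
Context {R : realType}.
Implicit Types (rem : R -> R -> R -> R) (r K lam C a b d rho chi eps t x y p q e mu : R).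

Lemma positive_lower_bound (l : seq R) : all (fun x => 0 < x) l ->
  exists2 t : R, 0 < t & all (fun x => t <= x) l.
Proof.
elim: l => [_|x l IH /= /andP[x0 /IH [t t0 tl]]]; first by exists 1.
exists (Num.min x t); first by rewrite lt_min x0.
rewrite ge_min lexx /=; apply: sub_all tl => y ty.
by rewrite ge_min ty orbT.
Qed.

(** Both errors are at most (mu)^(1/2) / 8: the one with mu because (mu)^(1/2) <= tau, the one with
    eps because eps is small against a^(1/2). So phi lies between 3/4 and 5/4 of (mu)^(1/2), and
    9/16 >= 1/2. The first condition makes the bound on mu depend on C. *)
Lemma expansion_bounds (C1 C mu eps a tau d phi : R) : 0 < C1 -> C <= C1 -> 0 < a -> a < mu ->
  Num.sqrt mu <= tau -> 8 * (C1 * tau) <= 1 -> 3 * tau <= d -> 0 <= eps ->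
  8 * (C1 * eps) <= Num.sqrt a -> `|phi - Num.sqrt mu| <= C * (`|mu| + `|eps|) ->
  [/\ 0 <= phi, phi <= d & mu / 2 <= phi ^+ 2].
Proof.
move=> C10 CC1 a0 am st Ct td e0 Ce H.
have mu0 : 0 < mu by exact: lt_trans am.
have sa : Num.sqrt a <= Num.sqrt mu by rewrite ler_wsqrtr // ltW.
have q0 : 0 < Num.sqrt mu by rewrite sqrtr_gt0.
have q2 : Num.sqrt mu ^+ 2 = mu by rewrite sqr_sqrtr // ltW.
rewrite -[X in `|X| + _]q2 -[X in X / 2]q2 in H *.
move: (Num.sqrt mu) (Num.sqrt a) q0 st sa Ce H => q sqa q0 qt sa Ce.
rewrite (absE (q ^+ 2)) ?sqr_ge0 // (absE eps) // => H.
have {}H : `|phi - q| <= C1 * (q ^+ 2 + eps).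
  by apply: le_trans H _; rewrite ler_wpM2r // addr_ge0 // sqr_ge0.
have h1 : C1 * q ^+ 2 <= q / 8.
  rewrite expr2 mulrA; have : C1 * q <= C1 * tau by rewrite ler_wpM2l // ltW.
  move=> h; have h' : C1 * q <= 1 / 8 by lra.
  by have := ler_wpM2r (ltW q0) h'; lra.
move: H; rewrite mulrDr ler_norml => /andP[H1 H2].
have p1 : 3 / 4 * q <= phi by lra.
have p2 : phi <= 5 / 4 * q by lra.
split; [lra|lra|].
have : (3 / 4 * q) ^+ 2 <= phi ^+ 2 by rewrite lerXn2r ?nnegrE //; lra.
by rewrite exprMn; have := sqr_ge0 q; lra.
Qed.

Lemma le_quotient A B x : 0 < B -> x <= A / B -> B * x <= A.
Proof. by move=> B0; rewrite ler_pdivlMr // mulrC. Qed.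

Lemma natmul_gt0 (n : nat) x : 0 < x -> 0 < n.+1%:R * x.
Proof. by move=> x0; rewrite mulr_gt0. Qed.

Lemma decay_le gamma A B rho eps : 0 < rho -> 0 < eps -> 0 < B -> gamma <= 2 * A / (B * rho ^+ 2) ->
  expR (- (A / (B * eps))) <= expR (- (gamma * rho ^+ 2 / (2 * eps))).
Proof.
move=> rho0 e0 B0 gA; have r20 : 0 < rho ^+ 2 by rewrite exprn_gt0.
rewrite ler_expR lerN2 -[leRHS](_ : 2 * A / (B * rho ^+ 2) * rho ^+ 2 / (2 * eps) = _); last first.
  by field; rewrite !gt_eqF.
have e2 : 0 <= (2 * eps)^-1 by rewrite invr_ge0 mulr_ge0 // ltW.
apply: (ler_wpM2r e2); apply: ler_wpM2r gA; exact: ltW.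
Qed.

Lemma attraction rem (R1 R2 : R -> R -> R -> R) r K lam :
  local_remainder rem R1 R2 r K -> 0 < r -> r <= 1 -> 1 <= K -> 0 < lam ->
  forall C, exists2 mu0 : R, 0 < mu0 & forall a b e1 (phi : R -> R -> R),
    0 < a -> a < b -> b < mu0 -> 0 < e1 ->
    (forall eps, 0 < eps < e1 -> forall t, a < eps * t < b ->
       is_derive t 1 (fun t => phi (eps * t) eps)
         (reaction rem lam (phi (eps * t) eps) (eps * t) eps)) ->
    (forall mu eps, a <= mu <= b -> 0 < eps < e1 ->
       `|phi mu eps - Num.sqrt mu| <= C * (`|mu| + `|eps|)) ->
  exists eps0 d chi rho gamma K' : R,
    [/\ 0 < eps0, 0 < chi, 0 < gamma & a <= rho <= b] /\
    (forall eps, 0 < eps < eps0 -> small_parameters r K lam d rho chi eps) /\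
    forall eps (u ux uxx : R -> R -> R), 0 < eps < eps0 ->
      classical_sol (fun t p => reaction rem lam p (- rho + eps * t) eps) (2 * rho / eps) u ux uxx ->
      (forall x, [/\ `|u 0 x| <= chi, `|ux 0 x| * (1 + `|x|) <= chi &
         `|uxx 0 x| * (1 + x ^+ 2) <= chi]) ->
      (forall t x, 0 <= t <= 2 * rho / eps -> {for x, continuous (uxx t)}) ->
      forall x, let decay := expR (- (gamma * rho ^+ 2 / (2 * eps))) in
      [/\ `|u (2 * rho / eps) x - phi rho eps| <= K' * decay,
          `|(1 + `|x|) * ux (2 * rho / eps) x| <= K' * decay &
          `|(1 + x ^+ 2) * uxx (2 * rho / eps) x| <= K' * decay].
Proof.
move=> loc r0 r1 K1 lam0 C.
have K0 : 0 < K by lra.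
have [d d0] : exists2 d : R, 0 < d & (2 * d <= r) && (8 * (K * d) <= 1).
  have [|d d0 /=] := positive_lower_bound [:: r / 2; 1 / (8 * K)].
    have p1 : 0 < r / 2 by lra.
    have p2 : 0 < 1 / (8 * K) by apply: divr_gt0; lra.
    by rewrite /= p1 p2.
  rewrite andbT => /andP[h1 h2]; exists d => //.
  have k8 : 0 < 8 * K by lra.
  have := le_quotient _ _ _ k8 h2.
  by move=> h3; apply/andP; split; lra.
move=> /andP[dr Kd].
pose C1 := `|C| + 1; have C10 : 0 < C1 by rewrite ltr_wpDl.
have CC1 : C <= C1 by rewrite /C1; have := ler_norm C; lra.
have [tau tau0 [t3 tl [tl1 tK tC t1]]] : exists2 tau : R, 0 < tau &
   [/\ 3 * tau <= d, 8 * (K * tau) <= lam & [/\ lam * tau <= 1, 16 * (K * tau) <= 1,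
      8 * (C1 * tau) <= 1 & tau <= 1]].
  have [|t t0 /=] := positive_lower_bound [:: d / 3; lam / (8 * K); 1 / lam; 1 / (16 * K);
    1 / (8 * C1); 1].
    have p1 : 0 < d / 3 by lra.
    have p2 : 0 < lam / (8 * K) by apply: divr_gt0; lra.
    have p3 : 0 < 1 / lam by apply: divr_gt0; lra.
    have p4 : 0 < 1 / (16 * K) by apply: divr_gt0; lra.
    have p5 : 0 < 1 / (8 * C1) by apply: divr_gt0; lra.
    by rewrite /= p1 p2 p3 p4 p5 ltr01.
  rewrite andbT => /andP[h1 /andP[h2 /andP[h3 /andP[h4 /andP[h5 h6]]]]]; exists t => //.
  have k8 : 0 < 8 * K by lra.
  have k16 : 0 < 16 * K by lra.
  have k5 : 0 < 8 * C1 by lra.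
  move: (le_quotient _ _ _ k8 h2) (le_quotient _ _ _ lam0 h3) (le_quotient _ _ _ k16 h4)
    (le_quotient _ _ _ k5 h5) => {}h2 {}h3 {}h4 {}h5.
  by split; [lra|lra|split=> //; lra].
exists (tau ^+ 2) => [|a b e1 phi a0 ab btau e10 inv expan]; first by rewrite exprn_gt0.
(* The midpoint leaves room on both sides: the contraction needs an interval of mu between a and
   rho, and the slow manifold has to be an orbit beyond rho. *)
pose rho := (a + b) / 2; pose s := Num.sqrt rho.
have arho : a < rho by rewrite /rho; lra.
have rhob : rho < b by rewrite /rho; lra.
have rho0 : 0 < rho by lra.
have s0 : 0 < s by rewrite sqrtr_gt0.
have sE : s ^+ 2 = rho by rewrite sqr_sqrtr // ltW.
have st mu : mu < b -> Num.sqrt mu <= tau.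
  move=> mub; have E : Num.sqrt (tau ^+ 2) = tau by rewrite sqrtr_sqr absE // ltW.
  by rewrite -E ler_wsqrtr // ltW // (lt_trans mub).
have stau : s <= tau := st _ rhob.
have Kst : K * s <= K * tau by rewrite ler_wpM2l // ltW.
have lamst : lam * s <= lam * tau by rewrite ler_wpM2l // ltW.
have sd : s <= d by lra.
have rd : 8 * rho <= d ^+ 2.
  have s3 : 3 * s <= d by apply: le_trans t3; rewrite ler_wpM2l.
  have : (3 * s) ^+ 2 <= d ^+ 2 by rewrite lerXn2r ?nnegrE ?(ltW d0) // mulr_ge0 // ltW.
  by rewrite exprMn sE; lra.
have rl0 : 0 < rho * lam / 2 by apply: divr_gt0; [exact: mulr_gt0|lra].
have chis : all (fun x => 0 < x) [:: d; rho; rho * lam / 2] by rewrite /= d0 rho0 rl0.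
have [chi chi0 /=] := positive_lower_bound _ chis.
rewrite andbT => /andP[chid /andP[chirho chilam]].
have {}chilam : 2 * chi <= rho * lam by lra.
have lam1 : 0 < `|lam| + 1 by rewrite ltr_wpDl.
have sa0 : 0 < Num.sqrt a by rewrite sqrtr_gt0.
have s90 : 0 < 90 * (100 * s) by lra.
have [eps0 eps00 epsP] : exists2 e0 : R, 0 < e0 & forall eps, 0 < eps < e0 ->
    [/\ eps < e1, eps <= rho, 4 * (eps * (`|lam| + 1)) <= d ^+ 3,
       90 * (100 * (s * eps)) <= lam * rho ^+ 3 &
       [/\ 50 * eps <= rho ^+ 2, 5 * (K * eps) <= a & 8 * (C1 * eps) <= Num.sqrt a]].
  have [|e0 e00 /=] := positive_lower_bound [:: e1; rho; d ^+ 3 / (4 * (`|lam| + 1));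
      lam * rho ^+ 3 / (90 * (100 * s)); rho ^+ 2 / 50; a / (5 * K); Num.sqrt a / (8 * C1)].
    have p1 : 0 < d ^+ 3 / (4 * (`|lam| + 1)).
      by rewrite divr_gt0 ?exprn_gt0 // natmul_gt0.
    have p2 : 0 < lam * rho ^+ 3 / (90 * (100 * s)).
      by apply: divr_gt0 s90; apply: mulr_gt0 => //; rewrite exprn_gt0.
    have p3 : 0 < rho ^+ 2 / 50 by rewrite divr_gt0 ?exprn_gt0 ?ltr0n.
    have p4 : 0 < a / (5 * K) by rewrite divr_gt0 // natmul_gt0.
    have p5 : 0 < Num.sqrt a / (8 * C1) by rewrite divr_gt0 // natmul_gt0.
    by rewrite /= e10 rho0 p1 p2 p3 p4 p5.
  rewrite andbT => /andP[h1 /andP[h2 /andP[h3 /andP[h4 /andP[h5 /andP[h6 h7]]]]]].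
  exists e0 => // eps /andP[ep ee].
  have eq A B : 0 < B -> e0 <= A / B -> B * eps <= A.
    by move=> B0 /(le_trans (ltW ee)); exact: le_quotient.
  have k3 : 0 < 4 * (`|lam| + 1) by exact: natmul_gt0 lam1.
  have k5 : 0 < (50 : R) by rewrite ltr0n.
  have k6 : 0 < 5 * K by exact: natmul_gt0 K0.
  have k7 : 0 < 8 * C1 by exact: natmul_gt0 C10.
  move: (eq _ _ k3 h3) (eq _ _ s90 h4) (eq _ _ k5 h5) (eq _ _ k6 h6) (eq _ _ k7 h7) => {}h3 {}h4 {}h5 {}h6 {}h7.
  split.
  - exact: lt_le_trans h1.
  - exact: le_trans (ltW ee) h2.
  - by rewrite [eps * _]mulrC mulrA.
  - by rewrite !mulrA in h4 *.
  - by split=> //; rewrite mulrA.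
pose dd := Num.sqrt (rho / 600); pose EM := expR (2 * K * rho); pose L := 10 + `|lam| + 7 * K.
pose A1 := 2 * d; pose A2 := 4 * chi * EM / dd.
pose A3 := (6 * chi + 12 * L * chi ^+ 2 * EM * (400 / rho)) * EM / dd ^+ 2.
have EM0 : 0 < EM := expR_gt0 _.
have r600 : 0 < rho / 600 by rewrite divr_gt0 ?ltr0n.
have dd0 : 0 < dd by rewrite sqrtr_gt0.
have L0 : 0 <= L.
  exact: addr_ge0 (addr_ge0 (ler0n _ 10) (normr_ge0 lam)) (mulr_ge0 (ler0n _ 7) (ltW K0)).
have A10 : 0 <= A1 by rewrite /A1 mulr_ge0 // ltW.
have A20 : 0 <= A2.
  by apply: divr_ge0 (ltW dd0); apply: mulr_ge0 (ltW EM0); rewrite mulr_ge0 // ltW.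
have A30 : 0 <= A3.
  apply: divr_ge0 (sqr_ge0 dd); apply: mulr_ge0 (ltW EM0); apply: addr_ge0; first by rewrite mulr_ge0 // ltW.
  have c400 : 0 <= 400 / rho by apply: divr_ge0 (ltW rho0); rewrite ler0n.
  apply: mulr_ge0 c400; apply: mulr_ge0 (ltW EM0); apply: mulr_ge0 (sqr_ge0 chi); by rewrite mulr_ge0 ?ler0n.
have rho20 : 0 < rho ^+ 2 by rewrite exprn_gt0.
have ara : 0 < a * (rho - a) by rewrite mulr_gt0 // subr_gt0.
(* The two exponents, rho^2 / (200 eps) for the derivatives and a (rho - a) / (10 eps) for the
   contraction, each written as gamma rho^2 / (2 eps). *)
have gpos : all (fun x => 0 < x) [:: 2 * rho ^+ 2 / (200 * rho ^+ 2); 2 * (a * (rho - a)) / (10 * rho ^+ 2)].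
  have p1 : 0 < 2 * rho ^+ 2 / (200 * rho ^+ 2) by rewrite divr_gt0 ?natmul_gt0.
  have p2 : 0 < 2 * (a * (rho - a)) / (10 * rho ^+ 2) by rewrite divr_gt0 ?natmul_gt0.
  by rewrite /= p1 p2.
have [gamma gamma0 /=] := positive_lower_bound _ gpos.
rewrite andbT => /andP[g1 g2].
exists eps0, d, chi, rho, gamma, (A1 + A2 + A3).
split; first by rewrite !ltW.
have params eps : 0 < eps < eps0 -> small_parameters r K lam d rho chi eps.
  by move=> ee; have [h1 h2 h3 h4 [h5 h6 h7]] := epsP _ ee; case/andP: ee.
split=> // eps u ux uxx ee usol i uxxc x.
have ui y : `|u 0 y| <= chi by case: (i y).
have i1 y : `|ux 0 y| * (1 + `|y|) <= chi by case: (i y).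
have i2 y : `|uxx 0 y| * (1 + y ^+ 2) <= chi by case: (i y).
have [h1 h2 h3 h4 [h5 h6 h7]] := epsP _ ee; have /andP[ep elt] := ee.
have e1' : 0 < eps < e1 by rewrite ep.
have s1 : s <= 1 by exact: le_trans t1.
have sKs : 16 * (K * s) <= 1 by apply: le_trans tK; rewrite ler_wpM2l.
have sKl : 8 * (K * s) <= lam by apply: le_trans tl; rewrite ler_wpM2l.
have sl : lam * s <= 1 := le_trans lamst tl1.
have phid := inv eps e1'.
have phib mu : a < mu < b -> [/\ 0 <= phi mu eps, phi mu eps <= d & mu / 2 <= phi mu eps ^+ 2].
  move=> /andP[am mb].
  have amb : a <= mu <= b by rewrite !ltW.
  exact: expansion_bounds C1 C mu eps a tau d (phi mu eps) C10 CC1 a0 am (st _ mb) tC t3 (ltW ep) h7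
    (expan mu eps amb e1').
have [D1 D2] := passage_derivatives rem R1 R2 r K lam d rho eps s chi loc r1 K1 d0 dr Kd lam0 rho0
  rd ep h2 h3 s0 sE s1 sd sKs sKl sl chi0 chid chirho chilam h4 h5 u ux uxx usol ui i1 i2 uxxc x.
have D0 := passage_contraction rem R1 R2 r K lam d rho eps s chi loc r1 K1 d0 dr Kd lam0 rho0
  rd ep h2 h3 s0 sE s1 sd sKs sKl sl chi0 chid chirho chilam h4 h5 u ux uxx usol ui a b
  (fun mu => phi mu eps) x a0 arho rhob h6 phid phib.
have c200 : 0 < (200 : R) by rewrite ltr0n.
have c10 : 0 < (10 : R) by rewrite ltr0n.
have E1 := decay_le gamma _ _ rho eps rho0 ep c200 g1.
have E2 := decay_le gamma _ _ rho eps rho0 ep c10 g2.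
move: E1 E2; set decay := expR (- (gamma * _ / _)) => E1 E2.
have decay0 : 0 <= decay := expR_ge0 _.
have bound y A e : 0 <= A -> A <= A1 + A2 + A3 -> e <= decay -> y <= A * e -> y <= (A1 + A2 + A3) * decay.
  move=> A0 AK ed; move/le_trans; apply; apply: (@le_trans _ _ (A * decay)); first exact: ler_wpM2l.
  exact: ler_wpM2r.
split.
- by apply: (bound _ A1 _ _ _ E2 D0) => //; rewrite -addrA lerDl addr_ge0.
- by apply: (bound _ A2 _ _ _ E1 D1) => //; rewrite addrAC lerDr addr_ge0.
- by apply: (bound _ A3 _ _ _ E1 D2) => //; rewrite lerDr addr_ge0.
Qed.

End Attraction.

(** * Both signs of lam and the final estimate *)

Section Conclusion.
Context {R : realType}.
Implicit Types (rem : R -> R -> R -> R) (r K lam C a b d rho chi eps t x y p q e mu : R).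

Lemma pde_classical_time rem lam rho eps (u : R -> R -> R) (m : R -> R) : 0 < rho -> 0 < eps ->
  pde_solution rem lam eps (2 * rho / eps) u m -> m 0 = - rho ->
  m (2 * rho / eps) = rho /\
  classical_sol (fun t p => reaction rem lam p (- rho + eps * t) eps) (2 * rho / eps) u
    (fun t => derive1 (u t)) (fun t => derive1n 2 (u t)).
Proof.
move=> rho0 e0 sol m0; set T := 2 * rho / eps in sol *.
have T0 : 0 < T by rewrite divr_gt0 // mulr_gt0.
have mE := pde_mu_eq rem lam eps T u m (- rho) T0 sol m0.
have TT : 0 <= T <= T by rewrite lexx ltW.
split; first by rewrite (mE T TT) /T; field; rewrite gt_eqF.
have [d1 d2 uc ueq] := pde_classical rem lam eps T u m sol; split=> // t x tT.
have tT' : 0 <= t <= T by case/andP: tT => /ltW -> /ltW ->.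
by rewrite -(mE t tT'); exact: ueq.
Qed.

Lemma Ztilde_second_continuous (v : R -> R) x : Ztilde v -> {for x, continuous (derive1n 2 v)}.
Proof.
move=> [[_ /(_ 2%N isT)[_ /unif_continuousP vuc]] _].
apply/cvgrPdist_le => e ep; have [dl dl0 H] := vuc e ep.
apply/nbhs_ballP; exists dl => //= y; rewrite /ball /= distrC => /ltW yx.
by rewrite distrC; exact: H.
Qed.

Lemma Znorm_weights (v : R -> R) chi x : (Znorm v <= chi%:E)%E ->
  [/\ `|v x| <= chi, `|derive1 v x| * (1 + `|x|) <= chi & `|derive1n 2 v x| * (1 + x ^+ 2) <= chi].
Proof.
move=> /Znorm_leP /(_ x)[h1 h2 h3]; split=> //.
- by move: h2; rewrite normrM mulrC (absE (1 + `|x|)) // addr_ge0.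
- by move: h3; rewrite normrM mulrC (absE (1 + x ^+ 2)) // addr_ge0 // sqr_ge0.
Qed.

Lemma Znorm_sub_cst_le (v : R -> R) c A : Ztilde v -> (forall x, [/\ `|v x - c| <= A,
    `|(1 + `|x|) * derive1 v x| <= A & `|(1 + x ^+ 2) * derive1n 2 v x| <= A]) ->
  (Znorm (fun x => v x - c)%R <= (3 * A)%:E)%E.
Proof.
move=> [Cv _] H.
have E1 : derive1 (fun x => v x - c) = derive1 v.
  apply/funext => x; rewrite derive1E.
  by have [_ ->] := derB (Cbunif_der v x Cv).1 (der_cst c x); rewrite subr0.
have E2 : derive1n 2 (fun x => v x - c) = derive1n 2 v.
  by rewrite !derive1nS !derive1n0 E1.
have -> : 3 * A = A + A + A by ring.
by apply: Znorm_le => x; rewrite ?E1 ?E2; case: (H x).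
Qed.

Lemma signed_attraction rem (R1 R2 : R -> R -> R -> R) r K lam :
  local_remainder rem R1 R2 r K -> 0 < r -> r <= 1 -> 1 <= K -> lam != 0 ->
  forall C, exists2 mu0 : R, 0 < mu0 & forall a b e1 (phi : R -> R -> R),
    0 < a -> a < b -> b < mu0 -> 0 < e1 ->
    (forall eps, 0 < eps < e1 -> forall t, a < eps * t < b ->
       is_derive t 1 (fun t => phi (eps * t) eps)
         (reaction rem lam (phi (eps * t) eps) (eps * t) eps)) ->
    (forall mu eps, a <= mu <= b -> 0 < eps < e1 ->
       `|phi mu eps - Num.sg lam * Num.sqrt mu| <= C * (`|mu| + `|eps|)) ->
  exists eps0 d chi rho gamma K' : R,
    [/\ 0 < eps0, 0 < chi, 0 < gamma & a <= rho <= b] /\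
    (forall eps, 0 < eps < eps0 -> small_parameters r K lam d rho chi eps) /\
    forall eps (u ux uxx : R -> R -> R), 0 < eps < eps0 ->
      classical_sol (fun t p => reaction rem lam p (- rho + eps * t) eps) (2 * rho / eps) u ux uxx ->
      (forall x, [/\ `|u 0 x| <= chi, `|ux 0 x| * (1 + `|x|) <= chi &
         `|uxx 0 x| * (1 + x ^+ 2) <= chi]) ->
      (forall t x, 0 <= t <= 2 * rho / eps -> {for x, continuous (uxx t)}) ->
      forall x, let decay := expR (- (gamma * rho ^+ 2 / (2 * eps))) in
      [/\ `|u (2 * rho / eps) x - phi rho eps| <= K' * decay,
          `|(1 + `|x|) * ux (2 * rho / eps) x| <= K' * decay &
          `|(1 + x ^+ 2) * uxx (2 * rho / eps) x| <= K' * decay].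
Proof.
move=> loc r0 r1 K1 + C; have [lam0 _|lam0 _|_] := ltgtP lam 0; last by [].
- have lam0' : 0 < - lam by rewrite oppr_gt0.
  have [mu0 mu00 H] := attraction _ _ _ r K (- lam) (local_remainder_opp _ _ _ _ _ loc) r0 r1 K1 lam0' C.
  have opp p mu eps : - reaction rem lam (- p) mu eps =
      reaction (fun u mu eps => - rem (- u) mu eps) (- lam) p mu eps by rewrite /reaction; ring.
  exists mu0 => // a b e1 phi a0 ab bmu e10 inv expan.
  have inv' eps : 0 < eps < e1 -> forall t, a < eps * t < b ->
       is_derive t 1 (fun t => - phi (eps * t) eps)
         (reaction (fun u mu eps => - rem (- u) mu eps) (- lam) (- phi (eps * t) eps) (eps * t) eps).
    by move=> ee t tab; apply: (derE (derN (inv eps ee t tab))); rewrite -opp opprK.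
  have expan' mu eps : a <= mu <= b -> 0 < eps < e1 ->
      `|- phi mu eps - Num.sqrt mu| <= C * (`|mu| + `|eps|).
    move=> mab ee; have := expan mu eps mab ee.
    by rewrite ltr0_sg // mulN1r opprK -opprD normrN.
  have [eps0 [d [chi [rho [gamma [K' [pos [sp concl]]]]]]]] :=
    H a b e1 (fun mu eps => - phi mu eps) a0 ab bmu e10 inv' expan'.
  exists eps0, d, chi, rho, gamma, K'; split=> //; split.
    by move=> eps /sp [*]; split=> //; rewrite -normrN.
  move=> eps u ux uxx ee /classical_opp sol i uxxc x decay.
  have sol' : classical_sol (fun t p => reaction (fun u mu eps => - rem (- u) mu eps) (- lam) p
      (- rho + eps * t) eps) (2 * rho / eps) (fun t x => - u t x) (fun t x => - ux t x)
      (fun t x => - uxx t x).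
    by case: sol => d1 d2 uc ueq; split=> // t y tT; rewrite -opp; exact: ueq.
  have i' y : [/\ `|- u 0 y| <= chi, `|- ux 0 y| * (1 + `|y|) <= chi &
         `|- uxx 0 y| * (1 + y ^+ 2) <= chi] by rewrite !normrN.
  have uxxc' t y : 0 <= t <= 2 * rho / eps -> {for y, continuous (fun x => - uxx t x)}.
    by move=> tT; apply: cvgN; exact: uxxc.
  have := concl eps _ _ _ ee sol' i' uxxc' x.
  by rewrite /= !mulrN !normrN -opprD normrN.
- have [mu0 mu00 H] := attraction _ _ _ r K lam loc r0 r1 K1 lam0 C.
  exists mu0 => // a b e1 phi a0 ab bmu e10 inv expan; apply: (H a b e1 phi) => // mu eps mab ee.
  by have := expan mu eps mab ee; rewrite gtr0_sg // mul1r.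
Qed.

End Conclusion.

Theorem theorem3p3 (R : realType) :
  exists N : nat,
  forall (rem : R -> R -> R -> R) (lam : R),
    smooth_near0 N rem -> remainder_order rem -> lam != 0 ->
  forall C : R, exists mu0 : R, 0 < mu0 /\
  forall a b : R, 0 < a -> a < b -> b < mu0 ->
  forall (k : nat) (e1 : R) (phip phim : R -> R -> R),
    (0 < k)%N -> 0 < e1 ->
    slow_manifold rem lam k 1 C a b e1 phip ->
    slow_manifold rem lam k (-1) C a b e1 phim ->
  exists eps0 chi rho gamma : R,
    [/\ 0 < eps0, 0 < chi, 0 < rho & 0 < gamma] /\
    a <= rho <= b /\
    (forall (eps : R) (u0 : R -> R),
       0 < eps < eps0 -> Ztilde u0 -> (Znorm u0 <= chi%:E)%E ->
       exists (u : R -> R -> R) (m : R -> R),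
         [/\ pde_solution rem lam eps (2 * rho / eps) u m,
             u 0 = u0 & m 0 = - rho]) /\
    (exists K : R, forall (eps : R) (u : R -> R -> R) (m : R -> R),
       0 < eps < eps0 ->
       pde_solution rem lam eps (2 * rho / eps) u m ->
       (Znorm (u 0%R) <= chi%:E)%E -> m 0 = - rho ->
       [/\ m (2 * rho / eps) = rho,
           0 < lam ->
             (Znorm (fun x => u (2 * rho / eps) x - phip rho eps)%R
                <= (K * expR (- (gamma * rho ^+ 2 / (2 * eps))))%:E)%E
         & lam < 0 ->
             (Znorm (fun x => u (2 * rho / eps) x - phim rho eps)%R
                <= (K * expR (- (gamma * rho ^+ 2 / (2 * eps))))%:E)%E]).

Proof.
(* Two u-derivatives enter the equations of the scheme; the third makes the second Lipschitz and
   yields [lr_small]. *)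
exists 3%N => rem lam remS remO lamN C.
have [r [K [R1 [R2 [r0 r1 K1 loc]]]]] := local_remainder_exists rem remS remO.
have [mu0 mu00 H] := signed_attraction rem R1 R2 r K lam loc r0 r1 K1 lamN C.
exists mu0; split=> // a b a0 ab bmu k e1 phip phim k0 e10 Sp Sm.
(* The sign of the forcing selects the branch. *)
pose phi := if 0 < lam then phip else phim.
have [inv expan] : (forall eps, 0 < eps < e1 -> forall t, a < eps * t < b ->
       is_derive t 1 (fun t => phi (eps * t) eps)
         (reaction rem lam (phi (eps * t) eps) (eps * t) eps)) /\
    (forall mu eps, a <= mu <= b -> 0 < eps < e1 ->
       `|phi mu eps - Num.sg lam * Num.sqrt mu| <= C * (`|mu| + `|eps|)).
  rewrite /phi; have [l0|l0|l0] := ltgtP lam 0.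
  - rewrite ltr0_sg //; case: Sm => _ iv _ ex; split=> [eps ee t tab|]; last exact: ex.
    by case: (iv eps ee t tab).
  - rewrite gtr0_sg //; case: Sp => _ iv _ ex; split=> [eps ee t tab|]; last exact: ex.
    by case: (iv eps ee t tab).
  - by rewrite l0 eqxx in lamN.
have [eps0 [d [chi [rho [gamma [K' [[p1 p2 p3 p4] [sp concl]]]]]]]] :=
  H a b e1 phi a0 ab bmu e10 inv expan.
have rho0 : 0 < rho by case/andP: p4 => /(lt_le_trans a0).
exists eps0, chi, rho, gamma; split=> //; split=> //; split.
  move=> eps u0 ee Zu Zle.
  exact: passage_existence rem R1 R2 r K lam d rho chi eps u0 loc r1 K1 (sp eps ee) Zu Zle.
(* The norm is a sum of three suprema with the common bound [K'] times the decay. *)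
exists (3 * K') => eps u m ee sol Zu m0; have /andP[ep _] := ee.
have [mT usol] := pde_classical_time rem lam rho eps u m rho0 ep sol m0.
have T0 : 0 <= 2 * rho / eps by rewrite divr_ge0 ?mulr_ge0 // ltW.
have Zt t : 0 <= t <= 2 * rho / eps -> Ztilde (u t) by exact: pde_space sol t.
have ZT : Ztilde (u (2 * rho / eps)) by apply: Zt; rewrite lexx T0.
have bound := concl eps u _ _ ee usol (fun x => Znorm_weights (u 0) chi x Zu)
  (fun t x tT => Ztilde_second_continuous (u t) x (Zt t tT)).
have := Znorm_sub_cst_le _ _ _ ZT bound; rewrite mulrA /phi; move=> Zb.
split; first exact: mT.
  by move=> l0; move: Zb; rewrite l0; apply.
by move=> l0; move: Zb; rewrite ltNge (ltW l0); apply.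
Qed.
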